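(* Let $\Bbbk$ be an algebraically closed field of characteristic $0$ and let $G$ be a finite nonabelian simple group. Let $0\ne U\in{}^G_G\mathcal{YD}$. If $\mathfrak{B}(U)$ is finite-dimensional, then $U$ is irreducible in ${}^G_G\mathcal{YD}$.
   Context: ${}^G_G\mathcal{YD}$ is the category of (left) Yetter-Drinfeld modules over the group algebra $\Bbbk G$: $G$-graded vector spaces $U=\bigoplus_{s\in G}U_s$ (with coaction $\delta(u)=s\otimes u$ for $u\in U_s$) which are $G$-modules such that $h\cdot U_s=U_{hsh^{-1}}$ for all $h,s\in G$. It is braided with $c(x\otimes y)=s\cdot y\otimes x$ for $x$ of degree $s$. For $U\in{}^G_G\mathcal{YD}$ the tensor algebra $T(U)$ is a braided Hopf algebra in which the elements of $U$ are primitive, and the Nichols algebra is $\mathfrak{B}(U)=T(U)/I_U$, where $I_U$ is the largest coideal of $T(U)$ contained in $\bigoplus_{n\ge2}U^{\otimes n}$. *)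

(* Defs.v *)
From HB Require Import structures.
From mathcomp Require Import all_boot all_algebra all_fingroup.
From mathcomp Require Import boolp classical_sets.
From mathcomp Require Import finmap monalg.

Set Implicit Arguments.
Unset Strict Implicit.
Unset Printing Implicit Defensive.

Import GRing.Theory.
Local Open Scope ring_scope.

Section Span.
Variables (k : fieldType) (V : lmodType k).

Definition subspace (S : set V) : Prop :=
  S 0 /\ forall (a : k) (u v : V), S u -> S v -> S (a *: u + v).

Definition lspan (P : set V) : set V := smallest subspace P.

Lemma lspan_subspace P : subspace (lspan P).
Proof.
split; first by move=> S [[]].
by move=> a u v Pu Pv S PS; case: (PS) => -[_ SZD] _; apply: SZD; [exact: Pu|exact: Pv].
Qed.

Lemma sub_lspan P : (P `<=` lspan P)%classic.
Proof. exact: sub_smallest. Qed.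

Lemma lspan_min P S : subspace S -> (P `<=` S)%classic -> (lspan P `<=` S)%classic.
Proof. exact: smallest_sub. Qed.

Definition in_lspan (P : set V) : {pred V} := fun v => `[< lspan P v >].

Lemma in_lspan_zmod_closed P : zmod_closed (in_lspan P).
Proof.
have [S0 SZD] := lspan_subspace P.
split=> [|u v /asboolP Pu /asboolP Pv]; first exact/asboolP.
by apply/asboolP; rewrite addrC -scaleN1r; apply: SZD.
Qed.

HB.instance Definition _ P :=
  GRing.isZmodClosed.Build V (in_lspan P) (in_lspan_zmod_closed P).

Definition raw_quot (P : set V) : Type := Quotient.quot (in_lspan P).
HB.instance Definition _ P := GRing.Zmodule.on (raw_quot P).

End Span.

Section LinearFun.
Variables (k : fieldType) (V M : lmodType k) (f : V -> M).
Hypothesis f_lin : linear f.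

Lemma linearf0 : f 0 = 0.
Proof. by rewrite -[X in f X](addNr 0) -scaleN1r f_lin scaleN1r addNr. Qed.
Lemma linearfZ a : {morph f : u / a *: u}.
Proof. by move=> u; rewrite -[a *: u]addr0 f_lin linearf0 addr0. Qed.
Lemma linearfD : {morph f : u v / u + v}.
Proof. by move=> u v; rewrite -[u]scale1r f_lin !scale1r. Qed.
Lemma linearfB : {morph f : u v / u - v}.
Proof. by move=> u v; rewrite addrC -scaleN1r f_lin scaleN1r addrC. Qed.
Lemma linearf_sum I (r : seq I) P (F : I -> V) :
  f (\sum_(i <- r | P i) F i) = \sum_(i <- r | P i) f (F i).
Proof. exact: (big_morph f linearfD linearf0). Qed.
End LinearFun.

Section LinearFunComb.
Variable (k : fieldType).

Lemma linearf_comb (V M : lmodType k) (f g : V -> M) b : linear f -> linear g ->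
  linear (fun x => b *: f x + g x).
Proof.
move=> fl gl a x y; rewrite fl gl !scalerDr !scalerA [a * b]mulrC -!addrA.
by congr (_ + _); rewrite addrCA.
Qed.

Lemma linearf_comp (V M N : lmodType k) (f : V -> M) (g : M -> N) :
  linear f -> linear g -> linear (fun x => g (f x)).
Proof. by move=> fl gl a x y; rewrite fl gl. Qed.

Lemma linearf_sumf (V M : lmodType k) (I : finType)
    (F : I -> V -> M) :
  (forall i, linear (F i)) -> linear (fun v => \sum_i F i v).
Proof.
move=> Fl a u v; rewrite scaler_sumr -big_split; apply: eq_bigr => i _ /=.
exact: Fl.
Qed.

End LinearFunComb.

Section RawQuotient.
Variables (k : fieldType) (V : lmodType k) (P : set V).
Local Notation Q := (raw_quot P).

Let pi (v : V) : Q := (\pi_(raw_quot P) v)%qT.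
Let rep (x : Q) : V := generic_quotient.repr x.

Let repK x : pi (rep x) = x.
Proof. exact: reprK. Qed.

Let piP u v : pi u = pi v <-> lspan P (u - v).
Proof.
rewrite /pi; split.
  by move/eqP; rewrite -Quotient.idealrBE => /asboolP.
by move=> Puv; apply/eqP; rewrite -Quotient.idealrBE; apply/asboolP.
Qed.

Let piD : {morph pi : u v / u + v}.
Proof. by move=> u v; rewrite /pi !piE. Qed.

Let scale (a : k) (x : Q) : Q := pi (a *: rep x).

Let piZ a v : pi (a *: v) = scale a (pi v).
Proof.
apply/piP; rewrite -scalerBr -[_ *: _]addr0.
have [S0 SZD] := lspan_subspace P; apply: SZD => //.
by apply/piP; rewrite repK.
Qed.

Let scaleA a b x : scale a (scale b x) = scale (a * b) x.
Proof. by rewrite -[x]repK -!piZ scalerA. Qed.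
Let scale1 : left_id 1 scale.
Proof. by move=> x; rewrite -[x]repK -!piZ scale1r. Qed.
Let scaleDr : right_distributive scale +%R.
Proof.
by move=> a x y; rewrite -[x]repK -[y]repK -piD -!piZ -piD scalerDr.
Qed.
Let scaleDl x : {morph scale^~ x : a b / a + b}.
Proof. by move=> a b; rewrite -[x]repK -!piZ -piD scalerDl. Qed.

HB.instance Definition _ :=
  GRing.Zmodule_isLmodule.Build k Q scaleA scale1 scaleDr scaleDl.

Record quotient_data := QuotientData {
  qspace : lmodType k;
  qpi : V -> qspace;
  qrepr : qspace -> V;
  qpi_linear : linear qpi;
  qreprK : cancel qrepr qpi;
  qpiP : forall u v, qpi u = qpi v <-> lspan P (u - v)
}.

Let pi_linear : linear pi.
Proof. by move=> a u v; rewrite piD piZ. Qed.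

Definition raw_quotient_data : quotient_data :=
  @QuotientData Q pi rep pi_linear repK piP.

End RawQuotient.

(* Sealed, since unfolding the generic quotient makes unification explode. *)
HB.lock Definition quotient (k : fieldType) (V : lmodType k) (P : set V) :
  quotient_data P := raw_quotient_data P.
Arguments quotient {k V} P.

Definition lquot (k : fieldType) (V : lmodType k) (P : set V) : lmodType k :=
  qspace (quotient P).

Section QuotientModule.
Variables (k : fieldType) (V : lmodType k) (P : set V).

Definition lquot_pi : V -> lquot P := @qpi _ _ _ (quotient P).
Definition lquot_repr : lquot P -> V := @qrepr _ _ _ (quotient P).

Lemma lquot_reprK x : lquot_pi (lquot_repr x) = x.
Proof. exact: qreprK. Qed.

Lemma lquot_piP u v : lquot_pi u = lquot_pi v <-> lspan P (u - v).
Proof. exact: qpiP. Qed.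

Lemma lquot_pi_linear : linear lquot_pi.
Proof. exact: qpi_linear. Qed.

Definition lquot_lift (M : Type) (f : V -> M) (x : lquot P) : M :=
  f (lquot_repr x).

Variables (M : lmodType k) (f : V -> M).
Hypotheses (f_lin : linear f) (f0 : forall v, P v -> f v = 0).

Lemma lquot_lift_pi v : lquot_lift f (lquot_pi v) = f v.
Proof.
suff: lspan P (lquot_repr (lquot_pi v) - v).
  rewrite /lquot_lift => Pv; apply/eqP; rewrite -subr_eq0; apply/eqP.
  rewrite -linearfB //; apply: (@lspan_min _ _ P (fun u => f u = 0)) Pv => //.
  by split=> [|a u w fu fw]; rewrite ?linearf0 // f_lin fu fw scaler0 addr0.
by apply/lquot_piP; rewrite lquot_reprK.
Qed.

Lemma lquot_lift_linear : linear (lquot_lift f).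
Proof.
move=> a x y; rewrite -[x]lquot_reprK -[y]lquot_reprK -lquot_pi_linear.
by rewrite !lquot_lift_pi f_lin.
Qed.

End QuotientModule.

Section Presentation.
Variables (k : fieldType) (X : choiceType).
Implicit Types (M : lmodType k) (R : set {malg k[X]}).

Definition lin_ext M (f : X -> M) (v : {malg k[X]}) : M :=
  \sum_(x <- msupp v) v@_x *: f x.

Lemma lin_extEw M (f : X -> M) (d : {fset X}) v : (msupp v `<=` d)%fset ->
  lin_ext f v = \sum_(x <- d) v@_x *: f x.
Proof.
move=> le; rewrite [LHS](big_fset_incl _ le) => //= x xd /mcoeff_outdom ->.
by rewrite scale0r.
Qed.

Lemma lin_extU M (f : X -> M) x : lin_ext f << x >> = f x.
Proof. by rewrite (lin_extEw f msuppU_le) big_seq_fset1 mcoeffUU scale1r. Qed.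

Lemma lin_ext_linear M (f : X -> M) : linear (lin_ext f).
Proof.
move=> a u v; pose d := (msupp (a *: u + v) `|` (msupp u `|` msupp v))%fset.
have le3: (msupp (a *: u + v) `<=` d)%fset by rewrite fsubsetUl.
have le2: (msupp v `<=` d)%fset by rewrite /d fsetUA fsubsetUr.
have le1: (msupp u `<=` d)%fset by rewrite /d fsubsetU // fsubsetUl orbT.
rewrite (lin_extEw f le1) (lin_extEw f le2) (lin_extEw f le3).
rewrite scaler_sumr -big_split /=; apply: eq_bigr => x _.
by rewrite mcoeffD mcoeffZ scalerDl scalerA.
Qed.

(* [R] is the set of combinations of generators that are made equal to 0. *)
Definition presented R : lmodType k := lquot R.
Definition pgen R (x : X) : presented R := lquot_pi R << x >>.
Definition plift R M (f : X -> M) : presented R -> M := lquot_lift (lin_ext f).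

Section Lift.
Variables (R : set {malg k[X]}) (M : lmodType k) (f : X -> M).
Hypothesis fR : forall r, R r -> lin_ext f r = 0.

Lemma plift_gen x : plift f (pgen R x) = f x.
Proof.
rewrite -[RHS](lin_extU f); apply: lquot_lift_pi => //; exact: lin_ext_linear.
Qed.

Lemma plift_linear : linear (plift f : presented R -> M).
Proof. by apply: lquot_lift_linear => //; exact: lin_ext_linear. Qed.
End Lift.

Lemma presented_ind R (S : set (presented R)) :
  subspace S -> (forall x, S (pgen R x)) -> forall v, S v.
Proof.
move=> [S0 SZD] Sgen v; rewrite -[v]lquot_reprK.
rewrite [lquot_repr v]monalgE (linearf_sum (@lquot_pi_linear _ _ R)).
apply: (big_ind S) => // [x y Sx Sy|x _]; first by rewrite -[x]scale1r; apply: SZD.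
have -> : << (lquot_repr v)@_x *g x >> = (lquot_repr v)@_x *: << x >>.
  by apply/malgP => y; rewrite mcoeffZ !mcoeffU mulrnAr mulr1.
rewrite (linearfZ (@lquot_pi_linear _ _ R)) -[X in S X]addr0.
by apply: SZD => //; apply: Sgen.
Qed.

Lemma presented_eq R M (f g : presented R -> M) : linear f -> linear g ->
  (forall x, f (pgen R x) = g (pgen R x)) -> f =1 g.
Proof.
move=> flin glin fg; apply: (@presented_ind R (fun v => f v = g v)) => //.
by split=> [|a u v fu fv]; rewrite ?linearf0 // flin glin fu fv.
Qed.

End Presentation.

Section PresentedLemmas.
Variable (k : fieldType).

Lemma pgen_rel (X : choiceType) (R : set {malg k[X]}) a x y z :
  R (<< x >> - (a *: << y >> + << z >>)) ->
  pgen R x = a *: pgen R y + pgen R z.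
Proof.
move=> /sub_lspan /lquot_piP; rewrite /pgen => ->; exact: lquot_pi_linear.
Qed.

Lemma lin_ext_rel (X : choiceType) (M : lmodType k) (f : X -> M) a x y z :
  f x = a *: f y + f z ->
  lin_ext f (<< x >> - (a *: << y >> + << z >>) : {malg k[X]}) = 0.
Proof.
have f_lin := lin_ext_linear f; move=> fx.
by rewrite linearfB // f_lin !lin_extU fx subrr.
Qed.

End PresentedLemmas.

Section Bilinear.
Variables (k : fieldType) (V W : lmodType k).

Definition bilin (M : lmodType k) (f : V -> W -> M) : Prop :=
  (forall w, linear (f^~ w)) /\ (forall v, linear (f v)).

Definition tprod_rel : set {malg k[(V * W)%type]} := [set r |
     (exists a v v' w,
        r = << (a *: v + v', w) >> - (a *: << (v, w) >> + << (v', w) >>))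
  \/ (exists a v w w',
        r = << (v, a *: w + w') >> - (a *: << (v, w) >> + << (v, w') >>))]%classic.

Definition tprod : lmodType k := presented tprod_rel.

End Bilinear.

HB.lock Definition tens (k : fieldType) (V W : lmodType k) (v : V) (w : W) :
    tprod V W :=
  pgen (@tprod_rel k V W) (v, w).
Arguments tens {k V W} v w.

HB.lock Definition tprod_lift (k : fieldType) (V W M : lmodType k)
    (f : V -> W -> M) (z : tprod V W) : M :=
  plift (fun vw => f vw.1 vw.2) z.
Arguments tprod_lift {k V W M} f z.

Section TensorProduct.
Variables (k : fieldType) (V W : lmodType k).

Lemma tens_bilin : bilin (@tens k V W).
Proof.
split=> [w a v v'|v a w w']; rewrite tens.unlock; apply: pgen_rel.
  by left; exists a, v, v', w.
by right; exists a, v, w, w'.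
Qed.

Lemma tprod_lift_rel (M : lmodType k) (f : V -> W -> M) : bilin f ->
  forall r, @tprod_rel k V W r -> lin_ext (fun vw => f vw.1 vw.2) r = 0.
Proof.
move=> [f1 f2] r [[a [v [v' [w ->]]]]|[a [v [w [w' ->]]]]]; apply: lin_ext_rel.
  exact: f1.
exact: f2.
Qed.

Lemma tprod_lift_tens (M : lmodType k) (f : V -> W -> M) v w :
  bilin f -> tprod_lift f (tens v w) = f v w.
Proof. by move=> /tprod_lift_rel fr; rewrite tprod_lift.unlock tens.unlock plift_gen. Qed.

Lemma tprod_lift_linear (M : lmodType k) (f : V -> W -> M) :
  bilin f -> linear (tprod_lift f).
Proof. by move=> /tprod_lift_rel fr; rewrite tprod_lift.unlock; apply: plift_linear. Qed.

Lemma tprod_eq (M : lmodType k) (f g : tprod V W -> M) : linear f -> linear g ->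
  (forall v w, f (tens v w) = g (tens v w)) -> f =1 g.
Proof.
move=> fl gl fg; apply: presented_eq => // -[v w].
by move: (fg v w); rewrite tens.unlock.
Qed.

End TensorProduct.

Section TensorAlgebraDef.
Variables (k : fieldType) (U : lmodType k).

Definition multilin (M : lmodType k) (f : seq U -> M) : Prop :=
  forall p q, linear (fun u => f (p ++ u :: q)).

(* [word [:: u1; ...; un]] is u1 (x) ... (x) un: the relations are those of
   multilinearity, so that the words of size n span the n-th tensor power. *)
Definition talg_rel : set {malg k[seq U]} := [set r | exists a p u u' q,
  r = << p ++ (a *: u + u') :: q >>
      - (a *: << p ++ u :: q >> + << p ++ u' :: q >>)]%classic.

Definition talg : Type := presented talg_rel.
HB.instance Definition _ := GRing.Lmodule.on talg.

End TensorAlgebraDef.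

HB.lock Definition word (k : fieldType) (U : lmodType k) (w : seq U) : talg U :=
  pgen (@talg_rel k U) w.
Arguments word {k U} w.

HB.lock Definition talg_lift (k : fieldType) (U M : lmodType k)
    (f : seq U -> M) (x : talg U) : M :=
  plift f x.
Arguments talg_lift {k U M} f x.

Section TensorAlgebra.
Variables (k : fieldType) (U : lmodType k).
Local Notation talg := (talg U).
Local Notation talg_rel := (@talg_rel k U).

Lemma word_multilin : multilin (@word k U).
Proof. by move=> p q a u u'; rewrite word.unlock; apply: pgen_rel; exists a, p, u, u', q. Qed.

Section Lift.
Variables (M : lmodType k) (f : seq U -> M).
Hypothesis f_lin : multilin f.

Let frel r : talg_rel r -> lin_ext f r = 0.
Proof. by move=> [a [p [u [u' [q ->]]]]]; apply: lin_ext_rel; apply: f_lin. Qed.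

Lemma talg_lift_word w : talg_lift f (word w) = f w.
Proof. by rewrite talg_lift.unlock word.unlock plift_gen. Qed.

Lemma talg_lift_linear : linear (talg_lift f).
Proof. by rewrite talg_lift.unlock; apply: plift_linear. Qed.
End Lift.

Lemma talg_eq (M : lmodType k) (f g : talg -> M) : linear f -> linear g ->
  (forall w, f (word w) = g (word w)) -> f =1 g.
Proof.
move=> fl gl fg; apply: presented_eq => // w.
by move: (fg w); rewrite word.unlock.
Qed.

Definition talg_mul (x y : talg) : talg :=
  talg_lift (fun v => talg_lift (fun w => word (v ++ w)) y) x.

Let catl (v : seq U) : multilin (fun w => word (v ++ w)).
Proof. by move=> p q a u u' /=; rewrite !catA; apply: word_multilin. Qed.

Let catr y : multilin (fun v : seq U => talg_lift (fun w => word (v ++ w)) y).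
Proof.
move=> p q a u u'; move: y; apply: talg_eq.
- exact/talg_lift_linear/catl.
- by apply: linearf_comb; apply/talg_lift_linear/catl.
by move=> w; rewrite !talg_lift_word // -!catA; apply: word_multilin.
Qed.

Lemma talg_mul_linl y : linear (talg_mul^~ y).
Proof. exact: talg_lift_linear. Qed.

Lemma talg_mul_linr x : linear (talg_mul x).
Proof.
move=> a y z; move: x; apply: talg_eq.
- exact: talg_mul_linl.
- by apply: linearf_comb; apply: talg_mul_linl.
by move=> w; rewrite /talg_mul !talg_lift_word //; apply: talg_lift_linear.
Qed.

Lemma talg_mul_word v w : talg_mul (word v) (word w) = word (v ++ w).
Proof. by rewrite /talg_mul !talg_lift_word. Qed.

Let mulA : associative talg_mul.
Proof.
move=> x y z; move: x; apply: talg_eq => [||u].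
- exact: talg_mul_linl.
- by apply: linearf_comp; apply: talg_mul_linl.
move: y; apply: talg_eq => [||v].
- by apply: linearf_comp; [apply: talg_mul_linl|apply: talg_mul_linr].
- by apply: linearf_comp; [apply: talg_mul_linr|apply: talg_mul_linl].
move: z; apply: talg_eq => [||w].
- by apply: linearf_comp; apply: talg_mul_linr.
- exact: talg_mul_linr.
by rewrite !talg_mul_word catA.
Qed.

Let mul1 : left_id (word [::]) talg_mul.
Proof.
apply: talg_eq => [||w]; [exact: talg_mul_linr|by []|].
by rewrite talg_mul_word.
Qed.

Let mulr1 : right_id (word [::]) talg_mul.
Proof.
apply: talg_eq => [||w]; [exact: talg_mul_linl|by []|].
by rewrite talg_mul_word cats0.
Qed.

Let mulDl : left_distributive talg_mul +%R.
Proof. by move=> x y z; apply: (linearfD (@talg_mul_linl z)). Qed.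

Let mulDr : right_distributive talg_mul +%R.
Proof. by move=> x y z; apply: (linearfD (@talg_mul_linr x)). Qed.

Definition talg_counit : talg -> k^o := talg_lift (fun w => (w == [::])%:R : k^o).

Lemma talg_counit_multilin : multilin (fun w : seq U => (w == [::])%:R : k^o).
Proof. by move=> [|? p] q a u u' /=; rewrite scaler0 addr0. Qed.

Lemma talg_counit_word w : talg_counit (word w) = (w == [::])%:R.
Proof. by rewrite /talg_counit talg_lift_word //; apply: talg_counit_multilin. Qed.

Lemma talg_counit_linear : linear talg_counit.
Proof. exact/talg_lift_linear/talg_counit_multilin. Qed.

Let one_neq0 : (word [::] : talg) != 0.
Proof.
apply/eqP => w0; move: (talg_counit_word [::]); rewrite w0 (linearf0 talg_counit_linear).
by move=> /eqP; rewrite eq_sym oner_eq0.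
Qed.

HB.instance Definition _ := GRing.Zmodule_isNzRing.Build talg
  mulA mul1 mulr1 mulDl mulDr one_neq0.

Let scaleAl a (x y : talg) : a *: (x * y) = (a *: x) * y.
Proof. exact/esym/(linearfZ (@talg_mul_linl y)). Qed.
Let scaleAr a (x y : talg) : a *: (x * y) = x * (a *: y).
Proof. exact/esym/(linearfZ (@talg_mul_linr x)). Qed.

HB.instance Definition _ := GRing.Lmodule_isLalgebra.Build k talg scaleAl.
HB.instance Definition _ := GRing.Lalgebra_isAlgebra.Build k talg scaleAr.

Definition iota (u : U) : talg := word [:: u].

Lemma wordM v w : word (v ++ w) = word v * word w.
Proof. exact/esym/talg_mul_word. Qed.

Lemma word_prod w : word w = \prod_(u <- w) iota u.
Proof.
elim: w => [|u w IH]; first by rewrite big_nil.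
by rewrite big_cons -IH -[u :: w]/([:: u] ++ w) wordM.
Qed.

End TensorAlgebra.

(* The grading is given by its projections [yd_proj s] onto the components U_s,
   that is by the coaction u |-> \sum_s s (x) yd_proj s u: [yd_projK] is its
   coassociativity and [yd_proj_sum] its counit law.  The component U_s is
   [set u | yd_proj s u = u]; [yd_act_deg] is h . U_s = U_(h s h^-1). *)
Record yd_module (k : fieldType) (gT : finGroupType) : Type := YDModule {
  yd_space :> lmodType k;
  yd_act : gT -> yd_space -> yd_space;
  yd_proj : gT -> yd_space -> yd_space;
  yd_act_linear : forall h, linear (yd_act h);
  yd_act1 : forall u, yd_act 1%g u = u;
  yd_actM : forall g h u, yd_act (g * h)%g u = yd_act g (yd_act h u);
  yd_proj_linear : forall s, linear (yd_proj s);
  yd_projK : forall s t u, yd_proj s (yd_proj t u) = if s == t then yd_proj t u else 0;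
  yd_proj_sum : forall u, \sum_s yd_proj s u = u;
  yd_act_deg : forall h s,
    (yd_act h @` [set u | yd_proj s u = u] =
     [set u | yd_proj (h * s * h^-1)%g u = u])%classic
}.

Definition yd_deg (k : fieldType) (gT : finGroupType) (U : yd_module k gT) (s : gT)
  : set U := [set u | yd_proj s u = u]%classic.

Section YDTheory.
Variables (k : fieldType) (gT : finGroupType) (U : yd_module k gT).

Lemma yd_act_proj h s (u : U) :
  yd_act h (yd_proj s u) = yd_proj (h * s * h^-1)%g (yd_act h u).
Proof.
have act_deg t : yd_proj (h * t * h^-1)%g (yd_act h (yd_proj t u)) =
                 yd_act h (yd_proj t u).
  have : (yd_act h @` [set v | yd_proj t v = v])%classic (yd_act h (yd_proj t u)).
    by exists (yd_proj t u) => //=; rewrite yd_projK eqxx.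
  by rewrite yd_act_deg.
rewrite -{2}[u]yd_proj_sum (linearf_sum (@yd_act_linear _ _ U h)).
rewrite (linearf_sum (@yd_proj_linear _ _ U _)) (bigD1 s) //= act_deg.
rewrite big1 ?addr0 // => t ts; rewrite -act_deg yd_projK.
by rewrite (inj_eq (mulIg _)) (inj_eq (mulgI _)) eq_sym (negPf ts).
Qed.

Lemma sum_if_eq (M : zmodType) (t : gT) (F : gT -> M) :
  \sum_s (if s == t then F s else 0) = F t.
Proof. by rewrite -big_mkcond big_pred1_eq. Qed.

Lemma iota_linear : linear (@iota k U).
Proof. exact: (@word_multilin k U [::] [::]). Qed.

Definition talg_act (h : gT) : talg U -> talg U :=
  talg_lift (fun w => word (map (yd_act h) w)).

Lemma talg_act_multilin h : multilin (fun w : seq U => word (map (yd_act h) w)).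
Proof.
by move=> p q a u u'; rewrite !map_cat /= yd_act_linear word_multilin.
Qed.

Lemma talg_act_word h w : talg_act h (word w) = word (map (yd_act h) w).
Proof. exact/talg_lift_word/talg_act_multilin. Qed.

Lemma talg_act_linear h : linear (talg_act h).
Proof. exact/talg_lift_linear/talg_act_multilin. Qed.

Lemma talg_act1 x : talg_act 1%g x = x.
Proof.
move: x; apply: talg_eq => // [|w]; first exact: talg_act_linear.
by rewrite talg_act_word (eq_map (@yd_act1 _ _ U)) map_id.
Qed.

Lemma talg_actM g h x : talg_act (g * h)%g x = talg_act g (talg_act h x).
Proof.
move: x; apply: talg_eq => [||w]; first exact: talg_act_linear.
  by apply: linearf_comp; apply: talg_act_linear.
rewrite !talg_act_word -map_comp; congr word.
by apply: eq_map => u; rewrite /= yd_actM.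
Qed.

Lemma talg_act_mul h x y : talg_act h (x * y) = talg_act h x * talg_act h y.
Proof.
move: x; apply: talg_eq => [||v].
- exact: (linearf_comp (@talg_mul_linl k U y) (@talg_act_linear h)).
- exact: (linearf_comp (@talg_act_linear h) (@talg_mul_linl k U _)).
move: y; apply: talg_eq => [||w].
- exact: (linearf_comp (@talg_mul_linr k U _) (@talg_act_linear h)).
- exact: (linearf_comp (@talg_act_linear h) (@talg_mul_linr k U _)).
by rewrite -wordM !talg_act_word map_cat wordM.
Qed.

(* A product of homogeneous vectors of degrees s_1, ..., s_n has degree
   s_1 ... s_n; [talg_proj_mul] and [talg_projK] check that this is a grading. *)
Fixpoint word_proj (s : gT) (w : seq U) : talg U :=
  if w is u :: w' then \sum_t iota (yd_proj t u) * word_proj (t^-1 * s)%g w'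
  else (s == 1%g)%:R.

Definition talg_proj (s : gT) : talg U -> talg U := talg_lift (word_proj s).

Lemma word_proj_multilin s : multilin (word_proj s).
Proof.
move=> p q a u u'; elim: p s => [|v p IH] s /=.
  rewrite scaler_sumr -big_split; apply: eq_bigr => t _ /=.
  by rewrite yd_proj_linear iota_linear mulrDl scalerAl.
rewrite scaler_sumr -big_split; apply: eq_bigr => t _ /=.
by rewrite IH mulrDr scalerAr.
Qed.

Lemma talg_proj_word s w : talg_proj s (word w) = word_proj s w.
Proof. exact/talg_lift_word/word_proj_multilin. Qed.

Lemma talg_proj_linear s : linear (talg_proj s).
Proof. exact/talg_lift_linear/word_proj_multilin. Qed.

Lemma word_proj_cat s v w :
  word_proj s (v ++ w) = \sum_t word_proj t v * word_proj (t^-1 * s)%g w.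
Proof.
elim: v s => [|u v IH] s /=.
  under eq_bigr => t _ do rewrite mulr_natl mulrb.
  by rewrite sum_if_eq invg1 mul1g.
under [RHS]eq_bigr => t _ do rewrite mulr_suml.
rewrite exchange_big; apply: eq_bigr => r _ /=.
rewrite IH mulr_sumr [RHS](reindex_inj (mulgI r)) /=; apply: eq_bigr => t _.
by rewrite mulKg invMg mulgA mulrA.
Qed.

Lemma talg_proj_mul s x y :
  talg_proj s (x * y) = \sum_t talg_proj t x * talg_proj (t^-1 * s)%g y.
Proof.
move: x; apply: talg_eq => [||v].
- exact: (linearf_comp (@talg_mul_linl k U y) (@talg_proj_linear s)).
- move=> a x x'; rewrite scaler_sumr -big_split; apply: eq_bigr => t _ /=.
  by rewrite talg_proj_linear mulrDl scalerAl.
move: y; apply: talg_eq => [||w].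
- exact: (linearf_comp (@talg_mul_linr k U _) (@talg_proj_linear s)).
- move=> a y y'; rewrite scaler_sumr -big_split; apply: eq_bigr => t _ /=.
  by rewrite talg_proj_linear mulrDr scalerAr.
rewrite -wordM talg_proj_word word_proj_cat.
by apply: eq_bigr => t _; rewrite !talg_proj_word.
Qed.

Lemma talg_proj_iota s u : talg_proj s (iota u) = iota (yd_proj s u).
Proof.
rewrite talg_proj_word /=.
under eq_bigr => t _ do rewrite mulr_natr mulrb -eq_mulVg1.
by rewrite sum_if_eq.
Qed.

Lemma talg_proj_iotaM s u x :
  talg_proj s (iota u * x) = \sum_t iota (yd_proj t u) * talg_proj (t^-1 * s)%g x.
Proof. by rewrite talg_proj_mul; under eq_bigr => t _ do rewrite talg_proj_iota. Qed.

Lemma word_projK s t w :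
  talg_proj s (word_proj t w) = if s == t then word_proj t w else 0.
Proof.
elim: w s t => [|u w IH] s t /=.
  rewrite mulrb; case: (t =P 1%g) => [->|t1].
    by rewrite -[1]/(word [::]) talg_proj_word /= mulrb.
  by rewrite (linearf0 (@talg_proj_linear s)) if_same.
rewrite (linearf_sum (@talg_proj_linear s)).
transitivity (\sum_r (if s == t then iota (yd_proj r u) * word_proj (r^-1 * t)%g w else 0)); last first.
  by case: eqP => // _; rewrite big1.
apply: eq_bigr => r _; rewrite talg_proj_iotaM.
under eq_bigr => q _.
  have -> : iota (yd_proj q (yd_proj r u)) * talg_proj (q^-1 * s)%g (word_proj (r^-1 * t)%g w)
   = if q == r then iota (yd_proj r u) * talg_proj (q^-1 * s)%g (word_proj (r^-1 * t)%g w) else 0.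
    by rewrite yd_projK; case: eqP => // _; rewrite (linearf0 iota_linear) mul0r.
  over.
rewrite sum_if_eq IH (inj_eq (mulgI _)).
by case: eqP => // _; rewrite mulr0.
Qed.

Lemma talg_projK s t x :
  talg_proj s (talg_proj t x) = if s == t then talg_proj t x else 0.
Proof.
move: x; apply: talg_eq => [||w].
- exact: linearf_comp (@talg_proj_linear t) (@talg_proj_linear s).
- by case: eqP => _; [exact: talg_proj_linear|move=> a x y; rewrite scaler0 addr0].
by rewrite !talg_proj_word word_projK.
Qed.

Lemma word_proj_sum w : \sum_s word_proj s w = word w.
Proof.
elim: w => [|u w IH] /=.
  by under eq_bigr => s _ do rewrite mulrb; rewrite sum_if_eq.
rewrite exchange_big /=.
transitivity (\sum_t iota (yd_proj t u) * word w).
  apply: eq_bigr => t _; rewrite -mulr_sumr -IH; congr (_ * _).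
  rewrite [LHS](reindex_inj (mulgI t)) /=.
  by apply: eq_bigr => s _; rewrite mulKg.
by rewrite -mulr_suml -(linearf_sum iota_linear) yd_proj_sum -wordM.
Qed.

Lemma talg_proj_sum x : \sum_s talg_proj s x = x.
Proof.
move: x; apply: talg_eq => // [|w].
  move=> a x y; rewrite scaler_sumr -big_split; apply: eq_bigr => s _ /=.
  exact: talg_proj_linear.
by rewrite -[RHS]word_proj_sum; apply: eq_bigr => s _; rewrite talg_proj_word.
Qed.

Lemma word_act_proj h s w :
  talg_act h (word_proj s w) = word_proj (h * s * h^-1)%g (map (yd_act h) w).
Proof.
elim: w s => [|u w IH] s /=.
  have -> : (h * s * h^-1)%g = (s ^ h^-1)%g by rewrite conjgE invgK mulgA.
  rewrite conjg_eq1 !mulrb; case: eqP => _; last exact: linearf0 (@talg_act_linear h).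
  by rewrite -[1]/(word [::]) talg_act_word.
rewrite (linearf_sum (@talg_act_linear h)).
rewrite [RHS](reindex_inj (conjg_inj (h^-1)%g)) /=; apply: eq_bigr => t _.
have -> : (t ^ h^-1)%g = (h * t * h^-1)%g by rewrite conjgE invgK mulgA.
rewrite talg_act_mul IH talg_act_word /= yd_act_proj; congr (_ * word_proj _ _).
by rewrite !invMg invgK !mulgA mulgKV.
Qed.

Lemma talg_act_proj h s x :
  talg_act h (talg_proj s x) = talg_proj (h * s * h^-1)%g (talg_act h x).
Proof.
move: x; apply: talg_eq => [||w].
- exact: linearf_comp (@talg_proj_linear _) (@talg_act_linear _).
- exact: linearf_comp (@talg_act_linear _) (@talg_proj_linear _).
by rewrite talg_act_word !talg_proj_word word_act_proj.
Qed.

Lemma talg_act_deg h s :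
  (talg_act h @` [set x | talg_proj s x = x] =
   [set x | talg_proj (h * s * h^-1)%g x = x])%classic.
Proof.
apply/seteqP; split=> [_ [x /= sx <-]|y /= sy] /=.
  by rewrite -talg_act_proj sx.
exists (talg_act h^-1%g y) => /=; last by rewrite -talg_actM mulgV talg_act1.
rewrite -[in RHS]sy talg_act_proj; congr (talg_proj _ _).
by rewrite invgK !mulgA mulVg mul1g mulgKV.
Qed.

Definition talg_yd : yd_module k gT :=
  @YDModule k gT (talg U) talg_act talg_proj talg_act_linear talg_act1 talg_actM
    talg_proj_linear talg_projK talg_proj_sum talg_act_deg.

End YDTheory.

(* [braid_deg]: c(x (x) y) = s . y (x) x for x of degree s. *)
Definition braid (k : fieldType) (gT : finGroupType) (X Y : yd_module k gT) :
    tprod X Y -> tprod Y X :=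
  tprod_lift (fun x y => \sum_s tens (yd_act s y) (yd_proj s x)).

Lemma tprod_lift_linearf (k : fieldType) (V W M N : lmodType k)
    (f : N -> V -> W -> M) (z : tprod V W) :
  (forall n, bilin (f n)) -> (forall v w, linear (fun n => f n v w)) ->
  linear (fun n => tprod_lift (f n) z).
Proof.
move=> fb fl a m n; move: z; apply: tprod_eq => [||v w].
- exact: tprod_lift_linear.
- by apply: linearf_comb; apply: tprod_lift_linear.
by rewrite !tprod_lift_tens // fl.
Qed.

Lemma braid_bilin (k : fieldType) (gT : finGroupType) (X Y : yd_module k gT) :
  bilin (fun (x : X) (y : Y) => \sum_s tens (yd_act s y) (yd_proj s x)).
Proof.
have [t1 t2] := tens_bilin Y X.
split=> [y|x]; apply: linearf_sumf => s.
  exact: (linearf_comp (@yd_proj_linear _ _ X s) (t2 _)).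
exact: (linearf_comp (@yd_act_linear _ _ Y s) (t1 _)).
Qed.

Lemma braid_tens (k : fieldType) (gT : finGroupType) (X Y : yd_module k gT)
    (x : X) (y : Y) :
  braid (tens x y) = \sum_s tens (yd_act s y) (yd_proj s x).
Proof. exact/tprod_lift_tens/braid_bilin. Qed.

Lemma braid_deg (k : fieldType) (gT : finGroupType) (X Y : yd_module k gT)
    (s : gT) (x : X) (y : Y) :
  yd_deg s x -> braid (tens x y) = tens (yd_act s y) x.
Proof.
move=> sx; rewrite braid_tens (bigD1 s) //= sx big1 ?addr0 // => t ts.
by rewrite -sx yd_projK (negPf ts) (linearf0 ((tens_bilin Y X).2 _)).
Qed.

Section BraidedBialgebra.
Variables (k : fieldType) (gT : finGroupType) (U : yd_module k gT).
Local Notation T := (talg U).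
Local Notation TT := (tprod T T).

Let t1 := (tens_bilin T T).1.
Let t2 := (tens_bilin T T).2.

(* The product (m (x) m)(id (x) c (x) id) of T(U) (x) T(U). *)
Definition braid_mul (z z' : TT) : TT :=
  tprod_lift (fun a b =>
    tprod_lift (fun a' b' =>
      tprod_lift (fun x y => tens (a * x) (y * b'))
        (@braid _ _ (talg_yd U) (talg_yd U) (tens b a')))
    z') z.

Let mid (a b' : T) : bilin (fun x y : T => tens (a * x) (y * b')).
Proof.
split=> [y|x].
  exact: linearf_comp (@talg_mul_linr k U a) (t1 _).
exact: linearf_comp (@talg_mul_linl k U b') (t2 _).
Qed.

Let midE a b a' b' :
  tprod_lift (fun x y : T => tens (a * x) (y * b'))
    (@braid _ _ (talg_yd U) (talg_yd U) (tens b a')) =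
  \sum_s tens (a * talg_act s a') (talg_proj s b * b').
Proof.
rewrite braid_tens (linearf_sum (tprod_lift_linear (mid _ _))).
by apply: eq_bigr => s _; rewrite tprod_lift_tens.
Qed.

Let inner (a b : T) : bilin (fun a' b' : T =>
  tprod_lift (fun x y : T => tens (a * x) (y * b'))
    (@braid _ _ (talg_yd U) (talg_yd U) (tens b a'))).
Proof.
rewrite (_ : (fun _ => _) = fun a' b' : T =>
    \sum_s tens (a * talg_act s a') (talg_proj s b * b')); last first.
  by apply/funext => a'; apply/funext => b'; apply: midE.
split=> [b'|a']; apply: linearf_sumf => s.
  apply: linearf_comp (t1 _).
  exact: linearf_comp (@talg_act_linear _ _ U s) (@talg_mul_linr k U a).
exact: linearf_comp (@talg_mul_linr k U _) (t2 _).
Qed.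

Let outer (z' : TT) : bilin (fun a b : T =>
  tprod_lift (fun a' b' =>
      tprod_lift (fun x y => tens (a * x) (y * b'))
        (@braid _ _ (talg_yd U) (talg_yd U) (tens b a'))) z').
Proof.
split=> [b|a].
  apply: tprod_lift_linearf => [?|a' b']; first exact: inner.
  rewrite (_ : (fun _ => _) = fun a : T =>
    \sum_s tens (a * talg_act s a') (talg_proj s b * b')); last first.
    by apply/funext => a; apply: midE.
  apply: linearf_sumf => s.
  exact: linearf_comp (@talg_mul_linl k U _) (t1 _).
apply: tprod_lift_linearf => [?|a' b']; first exact: inner.
rewrite (_ : (fun _ => _) = fun b : T =>
    \sum_s tens (a * talg_act s a') (talg_proj s b * b')); last first.
  by apply/funext => b; apply: midE.
apply: linearf_sumf => s; apply: linearf_comp (t2 _).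
exact: linearf_comp (@talg_proj_linear _ _ U s) (@talg_mul_linl k U b').
Qed.

Let braid_mulEl a b z' : braid_mul (tens a b) z' =
  tprod_lift (fun a' b' =>
    tprod_lift (fun x y => tens (a * x) (y * b'))
      (@braid _ _ (talg_yd U) (talg_yd U) (tens b a'))) z'.
Proof. exact: (tprod_lift_tens a b (outer z')). Qed.

Lemma braid_mul_linl z' : linear (braid_mul^~ z').
Proof. exact: (tprod_lift_linear (outer z')). Qed.

Lemma braid_mul_linr z : linear (braid_mul z).
Proof.
move=> c u v; move: z; apply: tprod_eq => [||a b].
- exact: braid_mul_linl.
- by apply: linearf_comb; apply: braid_mul_linl.
rewrite 3!braid_mulEl.
exact: (tprod_lift_linear (inner a b)).
Qed.

Lemma braid_mul_tens a b a' b' :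
  braid_mul (tens a b) (tens a' b') =
  \sum_s tens (a * talg_act s a') (talg_proj s b * b').
Proof.
rewrite braid_mulEl.
by rewrite (tprod_lift_tens a' b' (inner a b)) midE.
Qed.

#[local] Opaque braid_mul braid.

Lemma braid_mulA : associative braid_mul.
Proof.
move=> x y z; move: x; apply: tprod_eq => [||a b].
- exact: braid_mul_linl.
- by apply: linearf_comp; apply: braid_mul_linl.
move: y; apply: tprod_eq => [||a' b'].
- by apply: linearf_comp; [apply: braid_mul_linl|apply: braid_mul_linr].
- by apply: linearf_comp; [apply: braid_mul_linr|apply: braid_mul_linl].
move: z; apply: tprod_eq => [||a'' b''].
- by apply: linearf_comp; apply: braid_mul_linr.
- exact: braid_mul_linr.
rewrite (braid_mul_tens a b a' b') (braid_mul_tens a' b' a'' b'').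
rewrite (linearf_sum (@braid_mul_linr _)).
rewrite (linearf_sum (@braid_mul_linl _)).
under eq_bigr => r _ do rewrite braid_mul_tens.
under [RHS]eq_bigr => s _ do rewrite braid_mul_tens (reindex_inj (mulgI s)) /=.
rewrite exchange_big; apply: eq_bigr => s _ /=.
transitivity (\sum_r tens (a * talg_act s a' * talg_act (s * r)%g a'')
                        (talg_proj s b * talg_proj r b' * b'')).
  by apply: eq_bigr => r _; rewrite talg_act_mul talg_actM !mulrA.
apply: eq_bigr => r _; congr (tens _ (_ * _)).
rewrite talg_proj_mul (bigD1 s) //= talg_projK eqxx mulKg big1 ?addr0 // => t ts.
by rewrite talg_projK (negPf ts) mul0r.
Qed.

Lemma talg_act_one s : talg_act s (1 : T) = 1.
Proof. exact: (talg_act_word s [::]). Qed.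

Lemma talg_proj_one s : talg_proj s (1 : T) = (s == 1%g)%:R.
Proof. exact: (talg_proj_word s [::]). Qed.

Lemma braid_mul1 : left_id (tens 1 1) braid_mul.
Proof.
apply: tprod_eq => // [|a b]; first exact: braid_mul_linr.
rewrite braid_mul_tens (bigD1 1%g) //= talg_proj_one eqxx talg_act1 !mul1r.
by rewrite big1 ?addr0 // => s /negPf s1; rewrite talg_proj_one s1 mul0r (linearf0 (t2 _)).
Qed.

Lemma braid_mulr1 : right_id (tens 1 1) braid_mul.
Proof.
apply: tprod_eq => // [|a b]; first exact: braid_mul_linl.
rewrite braid_mul_tens -[in RHS](talg_proj_sum b) (linearf_sum (t2 _)).
by apply: eq_bigr => s _; rewrite talg_act_one !mulr1.
Qed.

(* The algebra map making the elements of U primitive: see [talg_delta_mul] and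
   [talg_delta_iota]. *)
Definition talg_delta : T -> TT :=
  talg_lift (fun w =>
    \big[braid_mul/tens 1 1]_(u <- w) (tens (iota u) 1 + tens 1 (iota u))).

Lemma delta_multilin : multilin (fun w : seq U =>
  \big[braid_mul/tens 1 1]_(u <- w) (tens (iota u) 1 + tens 1 (iota u))).
Proof.
move=> p q a u u'; elim: p => [|v p IH] /=; last first.
  by rewrite !big_cons IH braid_mul_linr.
rewrite !big_cons -braid_mul_linl; congr braid_mul.
by rewrite iota_linear t1 t2 scalerDr addrACA.
Qed.

Lemma talg_delta_linear : linear talg_delta.
Proof. exact/talg_lift_linear/delta_multilin. Qed.

Lemma talg_delta_word w : talg_delta (word w) =
  \big[braid_mul/tens 1 1]_(u <- w) (tens (iota u) 1 + tens 1 (iota u)).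
Proof. exact/talg_lift_word/delta_multilin. Qed.

Lemma talg_delta1 : talg_delta 1 = tens 1 1.
Proof. by rewrite (talg_delta_word [::]) big_nil. Qed.

Lemma talg_delta_iota u : talg_delta (iota u) = tens (iota u) 1 + tens 1 (iota u).
Proof. by rewrite talg_delta_word big_seq1_id braid_mulr1. Qed.

Lemma talg_delta_mul x y : talg_delta (x * y) = braid_mul (talg_delta x) (talg_delta y).
Proof.
move: x; apply: talg_eq => [||v].
- exact: linearf_comp (@talg_mul_linl k U y) talg_delta_linear.
- exact: linearf_comp talg_delta_linear (@braid_mul_linl _).
move: y; apply: talg_eq => [||w].
- exact: linearf_comp (@talg_mul_linr k U _) talg_delta_linear.
- exact: linearf_comp talg_delta_linear (@braid_mul_linr _).
rewrite -wordM !talg_delta_word; elim: v => [|u v IH].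
  by rewrite big_nil braid_mul1.
by rewrite !big_cons IH braid_mulA.
Qed.

Definition coideal (J : set T) : Prop :=
  [/\ subspace J,
      forall x, J x -> talg_counit x = 0 &
      forall x, J x ->
        lspan [set z | exists a b, (J a \/ J b) /\ z = tens a b]%classic
          (talg_delta x)].

Definition talg_ge2 : set T :=
  lspan [set x | exists2 w, (1 < size w)%N & x = word w]%classic.

(* The sum of all coideals contained in degrees at least 2, which is the largest
   one by [nichols_ideal_ge2], [nichols_ideal_max] and [nichols_ideal_coideal]. *)
Definition nichols_ideal : set T :=
  lspan [set x | exists J, [/\ coideal J, (J `<=` talg_ge2)%classic & J x]]%classic.

Lemma nichols_ideal_ge2 : (nichols_ideal `<=` talg_ge2)%classic.
Proof.
apply: lspan_min; first exact: lspan_subspace.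
by move=> x [J [_ Jge2 Jx]]; apply: Jge2.
Qed.

Lemma nichols_ideal_max J : coideal J -> (J `<=` talg_ge2)%classic ->
  (J `<=` nichols_ideal)%classic.
Proof. by move=> cJ J2 x Jx; apply: sub_lspan; exists J. Qed.

Lemma nichols_ideal_coideal : coideal nichols_ideal.
Proof.
split; first exact: lspan_subspace.
  apply: lspan_min => [|x [J [[_ J0 _] _ /J0 //]]].
  split=> [|a x y x0 y0]; first exact: linearf0 (@talg_counit_linear k U).
  by rewrite (@talg_counit_linear k U) x0 y0 scaler0 addr0.
have [S0 SZD] := lspan_subspace
  [set z | exists a b, (nichols_ideal a \/ nichols_ideal b) /\ z = tens a b]%classic.
apply: lspan_min => [|x [J [cJ J2 Jx]]].
  split=> [|a x y xS yS]; first by rewrite (linearf0 talg_delta_linear).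
  by rewrite talg_delta_linear; apply: SZD.
have [_ _ /(_ x Jx)] := cJ; apply: lspan_min => // z [a [b [Jab ->]]].
apply: sub_lspan; exists a, b; split=> //.
by case: Jab => [Ja|Jb]; [left|right]; apply: (nichols_ideal_max cJ J2).
Qed.

(* Only the underlying vector space of the Nichols algebra is recorded. *)
Definition nichols : lmodType k := lquot nichols_ideal.

End BraidedBialgebra.

(* No [vectType] structure is available on a quotient of [talg U]; this is the
   axiom of [vectType] stated as a proposition. *)
Definition finite_dim (k : fieldType) (V : lmodType k) : Prop :=
  exists (n : nat) (f : {linear V -> 'rV[k]_n}), bijective f.

Definition yd_submodule (k : fieldType) (gT : finGroupType) (U : yd_module k gT)
    (N : set U) : Prop :=
  [/\ subspace N,
      forall h u, N u -> N (yd_act h u) &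
      forall s u, N u -> N (yd_proj s u)].

Definition yd_irreducible (k : fieldType) (gT : finGroupType)
    (U : yd_module k gT) : Prop :=
  (exists u : U, u != 0) /\
  forall N : set U, yd_submodule N -> N = [set 0]%classic \/ N = setT.

(* Main.v *)
(* By Maschke's theorem a reducible U splits as V + W with V, W nonzero, so it
   suffices to show that the Nichols algebra B(V + W) is never finite-dimensional.
   It is bigraded by the numbers of letters from V and W; write B_(m,n).  Suppose
   that it is finite-dimensional, and of least dimension among all such pairs
   (V, W).  No letter has degree 1, since all its powers would be nonzero.

   - If B_(2,1) = V B_(1,1), a twisted derivation argument shows that every t in the
     support of W moves at most two elements of the support of V by conjugation.
     Conjugation on that class would then contain a transposition, an odd
     permutation, contradicting the perfectness of G.  Hence the largest M with
     B_(M,1) <> V B_(M-1,1) is at least 2.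
   - Reflection: put V' = V^* and let W' be the quotient B_(M,1) / V B_(M-1,1).
     Skew derivations and multiplications make B(V + W) a Fock space for V' + W',
     whose vacuum is the top degree element of B(V), of degree a say; this gives a
     map Psi to functions on words in V' + W' taking B_(m,n) to bidegree
     (a + M n - m, n), with B(V' + W') in its image.  So dim B(V' + W') is at most
     dim B(V + W), and by minimality Psi is an isomorphism.
   - If B_(m,n) <> 0 with m <= n, then m' = a + M n - m > n and B'_(m',n) <> 0.
     Exchanging the roles of V' and W' and repeating, one finds nonzero components
     of arbitrarily large degree, a contradiction.

   Nichols algebras are realised as quantum shuffle algebras: an element is the
   function sending a word i_1 ... i_n to the value of its iterated left skew
   derivative, so that no quotient is needed. *)

Require Import Defs.
From mathcomp Require Import boolp classical_sets functions.
From mathcomp Require Import all_boot all_algebra all_fingroup all_solvable.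
From mathcomp Require Import zify ring.

Set Implicit Arguments.
Unset Strict Implicit.
Unset Printing Implicit Defensive.

Import GRing.Theory.
Local Open Scope ring_scope.

(** * Linear independence modulo a subspace *)

Section Independence.
Variables (k : fieldType) (V : lmodType k).
Implicit Types (S Q : set V).

Lemma subspaceZ Q a u : subspace Q -> Q u -> Q (a *: u).
Proof. by move=> [Q0 QZD] Qu; rewrite -[_ *: _]addr0; apply: QZD. Qed.

Lemma subspaceD Q u v : subspace Q -> Q u -> Q v -> Q (u + v).
Proof. by move=> [_ QZD] Qu Qv; rewrite -[u]scale1r; apply: QZD. Qed.

Lemma subspaceB Q u v : subspace Q -> Q u -> Q v -> Q (u - v).
Proof. by move=> [_ QZD] Qu Qv; rewrite addrC -scaleN1r; apply: QZD. Qed.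

Lemma subspace_sum Q (I : Type) (r : seq I) (P : pred I) (F : I -> V) :
  subspace Q -> (forall i, P i -> Q (F i)) -> Q (\sum_(i <- r | P i) F i).
Proof.
move=> sQ QF; apply: (big_ind Q) => //; first by case: sQ.
by move=> u v; apply: subspaceD.
Qed.

Lemma subspace_set0 : subspace [set (0 : V)]%classic.
Proof. by split=> // a u v /= -> ->; rewrite scaler0 addr0. Qed.

Lemma subspace_preim (W : lmodType k) (f : V -> W) (P : set W) :
  linear f -> subspace P -> subspace (f @^-1` P)%classic.
Proof.
move=> fl [P0 PZD]; split=> [|a u v Pu Pv] /=; first by rewrite linearf0.
by rewrite /= fl; apply: PZD.
Qed.

(** Independence of the classes in V/Q, expressed without forming the quotient. Below, the negation
    of [has_indep Q S n] is the form in which finite dimension is carried. *)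
Definition indep_mod Q n (e : 'I_n -> V) : Prop :=
  forall c : 'I_n -> k, Q (\sum_i c i *: e i) -> forall i, c i = 0.

Definition has_indep Q S n : Prop :=
  exists e : 'I_n -> V, (forall i, S (e i)) /\ indep_mod Q e.

Lemma has_indep_le Q S m n : subspace Q -> (m <= n)%N ->
  has_indep Q S n -> has_indep Q S m.
Proof.
move=> sQ le_mn [e [eS ei]].
exists (fun i => e (widen_ord le_mn i)); split=> // c Qc i.
pose c' (j : 'I_n) := if insub (val j) is Some j' then c j' else 0.
have c'w (j : 'I_m) : c' (widen_ord le_mn j) = c j.
  rewrite /c'; case: insubP => [j' _ jj'|]; last by rewrite /= ltn_ord.
  by congr c; apply: val_inj.
rewrite -c'w; apply: ei.
rewrite (bigID (fun j : 'I_n => (j < m)%N)) /=.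
rewrite [X in _ + X]big1 ?addr0; last first.
  by move=> j jm; rewrite /c' insubN // scale0r.
suff -> : \sum_(j < n | (j < m)%N) c' j *: e j =
          \sum_i c i *: e (widen_ord le_mn i) by [].
rewrite (big_ord_narrow le_mn).
by apply: eq_bigr => j _; rewrite c'w.
Qed.

Lemma has_indepW Q Q' S n : (Q' `<=` Q)%classic ->
  has_indep Q S n -> has_indep Q' S n.
Proof.
by move=> Q'Q [e [eS ei]]; exists e; split=> // c /Q'Q; apply: ei.
Qed.

Lemma has_indepS Q S S' n : (S `<=` S')%classic ->
  has_indep Q S n -> has_indep Q S' n.
Proof. by move=> SS' [e [eS ei]]; exists e; split=> // i; apply/SS'/eS. Qed.

(** If [x] were outside the span modulo [Q], adjoining it at index 0 would keep the family
    independent: a relation in which [x] has a nonzero coefficient can be solved for [x]. *)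
Lemma indep_mod_ex Q S n (e : 'I_n -> V) x : subspace Q ->
  (forall i, S (e i)) -> indep_mod Q e -> S x -> ~ has_indep Q S n.+1 ->
  exists c : 'I_n -> k, Q (x - \sum_i c i *: e i).
Proof.
move=> sQ eS ei Sx; apply: contra_notP => xne.
exists (fun i => if unlift ord0 i is Some j then e j else x).
split=> [i|c]; first by case: unliftP.
rewrite big_ord_recl unlift_none.
under eq_bigr => i _ do rewrite liftK.
move=> Qc.
have c0 : c ord0 = 0.
  apply: contra_notP xne => /eqP c0.
  exists (fun i => - ((c ord0)^-1 * c (lift ord0 i))).
  have := subspaceZ (c ord0)^-1 sQ Qc.
  rewrite scalerDr scalerA mulVf // scale1r scaler_sumr; congr Q; congr (_ + _).
  by rewrite -sumrN; apply: eq_bigr => i _; rewrite scaleNr opprK scalerA.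
move=> i; case: (unliftP ord0 i) => [j ->|-> //].
by apply: (ei (fun j => c (lift ord0 j))); rewrite c0 scale0r add0r in Qc.
Qed.

Lemma indep_mod_max Q S N : subspace Q -> ~ has_indep Q S N ->
  exists n (e : 'I_n -> V), [/\ forall i, S (e i), indep_mod Q e &
    forall x, S x -> exists c : 'I_n -> k, Q (x - \sum_i c i *: e i)].
Proof.
move=> sQ; elim: N => [|N IH] nS.
  by case: nS; exists (fun i => 0); split=> [[]|c _ []].
case: (pselect (has_indep Q S N)) => [[e [eS ei]]|]; last exact: IH.
by exists N, e; split=> // x Sx; apply: (indep_mod_ex sQ eS ei).
Qed.

Section Coefficients.
Variables (Q : set V) (n : nat) (e : 'I_n -> V).
Hypotheses (sQ : subspace Q) (ei : indep_mod Q e).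

(** The coordinates are picked by choice and take the default value 0 outside [span_mod], so
    linearity is available on [span_mod] only. *)
Definition coef_mod (x : V) : 'I_n -> k :=
  xget (fun=> 0) [set c | Q (x - \sum_i c i *: e i)]%classic.

Definition span_mod (x : V) : Prop :=
  exists c : 'I_n -> k, Q (x - \sum_i c i *: e i).

Lemma coef_modP x : span_mod x -> Q (x - \sum_i coef_mod x i *: e i).
Proof. by case=> c Qc; rewrite /coef_mod; case: xgetP => [y _ //|/(_ c)]. Qed.

Lemma coef_mod_uniq x (c : 'I_n -> k) :
  Q (x - \sum_i c i *: e i) -> coef_mod x = c.
Proof.
move=> Qc; have /coef_modP Qx : span_mod x by exists c.
apply/funext => i; apply/eqP; rewrite -subr_eq0; apply/eqP; move: i.
apply: ei; have := subspaceB sQ Qc Qx; congr Q.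
rewrite opprB addrC subrKA -sumrB; apply: eq_bigr => i _.
by rewrite scalerBl.
Qed.

Lemma coef_mod_linear a x y : span_mod x -> span_mod y ->
  coef_mod (a *: x + y) = (fun i => a * coef_mod x i + coef_mod y i).
Proof.
move=> /coef_modP Qx /coef_modP Qy; apply: coef_mod_uniq.
have := sQ.2 a _ _ Qx Qy; congr Q.
rewrite scalerBr scaler_sumr addrACA; congr (_ + _).
rewrite -opprD -big_split /=; congr (- _); apply: eq_bigr => i _.
by rewrite scalerA scalerDl.
Qed.

Lemma coef_mod0 x : Q x -> coef_mod x = fun=> 0.
Proof.
move=> Qx; apply: coef_mod_uniq; rewrite big1 ?subr0 // => i _.
by rewrite scale0r.
Qed.

Lemma coef_mod_e j : coef_mod (e j) = fun i => (i == j)%:R.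
Proof.
apply: coef_mod_uniq; rewrite (bigD1 j) //= eqxx scale1r big1 ?addr0 ?subrr.
  by case: sQ.
by move=> i /negPf ->; rewrite scale0r.
Qed.

Lemma span_mod_subspace : subspace span_mod.
Proof.
split=> [|a x y [c Qc] [d Qd]].
  exists (fun=> 0); rewrite big1 ?subrr; first by case: sQ.
  by move=> i _; rewrite scale0r.
exists (fun i => a * c i + d i); have := sQ.2 a _ _ Qc Qd; congr Q.
rewrite scalerBr scaler_sumr addrACA; congr (_ + _).
rewrite -opprD -big_split /=; congr (- _); apply: eq_bigr => i _.
by rewrite scalerA scalerDl.
Qed.

Lemma sub_span_mod x : Q x -> span_mod x.
Proof.
move=> Qx; exists (fun=> 0); rewrite big1 ?subr0 // => i _.
by rewrite scale0r.
Qed.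

End Coefficients.

End Independence.

(** * Operators on functions on words *)

(* Coordinates for a Yetter-Drinfeld module V + W: [ix] indexes a homogeneous basis,
   [dg] is its degree, [rh h] the matrix of the action of h, and [sd] singles out the
   basis of V. *)
Record ydd (k : fieldType) (gT : finGroupType) : Type := Ydd {
  ix :> finType;
  dg : ix -> gT;
  rh : gT -> ix -> ix -> k;
  sd : pred ix;
  rh1 : forall i j, rh 1%g i j = (i == j)%:R;
  rhM : forall g h i j, rh (g * h)%g i j = \sum_l rh g i l * rh h l j;
  rh_dg : forall h i j, rh h i j != 0 -> dg i = (h * dg j * h^-1)%g;
  rh_sd : forall h i j, rh h i j != 0 -> sd i = sd j
}.

Section Operators.
Variables (k : fieldType) (gT : finGroupType) (D : ydd k gT).
Local Notation I := (ix D).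
Local Notation F := (seq I -> k^o).
Implicit Types (phi psi : F) (w u : seq I) (i j l : I) (g h : gT).

Definition shl i phi : F := fun w => phi (i :: w).
Definition shr u phi : F := fun w => phi (w ++ u).

(* With functions on words read as elements of the shuffle algebra, [lmul j] is left
   multiplication by the letter j, and [rmul j] right multiplication twisted by the
   inverse braiding, chosen so as to commute with [lmul] up to the action of G. *)
Fixpoint yact_rec h phi w : k^o :=
  if w is i :: w' then \sum_l rh h i l *: yact_rec h (shl l phi) w' else phi [::].
Definition yact h phi : F := yact_rec h phi.

Fixpoint lmul_rec j phi w : k^o :=
  if w is i :: w' then
    (i == j)%:R *: phi w' + \sum_l rh (dg j) i l *: lmul_rec j (shl l phi) w'
  else 0.
Definition lmul j phi : F := lmul_rec j phi.

Fixpoint rmul_rec j phi w : k^o :=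
  if w is i :: w' then
    (i == j)%:R *: phi w' + \sum_l rh (dg i)^-1 l j *: rmul_rec l (shl i phi) w'
  else 0.
Definition rmul j phi : F := rmul_rec j phi.

Definition vac : F := fun w => (w == [::])%:R.

Lemma shl_linear i : linear (shl i).
Proof. by []. Qed.
Lemma shr_linear u : linear (shr u).
Proof. by []. Qed.

Lemma evalZD (a : k) phi psi w : (a *: phi + psi) w = a *: phi w + psi w.
Proof. by []. Qed.

Lemma evalD phi psi w : (phi + psi) w = phi w + psi w.
Proof. by []. Qed.

Lemma evalZ (a : k) phi w : (a *: phi) w = a *: phi w.
Proof. by []. Qed.

Lemma evalB phi psi w : (phi - psi) w = phi w - psi w.
Proof. by []. Qed.

Lemma eval_sum (T : Type) (r : seq T) (P : pred T) (f : T -> F) w :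
  (\sum_(x <- r | P x) f x) w = \sum_(x <- r | P x) f x w.
Proof. by apply: (big_morph (fun phi : F => phi w)). Qed.

Lemma yact_nil h phi : yact h phi [::] = phi [::].
Proof. by []. Qed.
Lemma lmul_nil j phi : lmul j phi [::] = 0.
Proof. by []. Qed.
Lemma rmul_nil j phi : rmul j phi [::] = 0.
Proof. by []. Qed.

Lemma shl_yact i h phi : shl i (yact h phi) = \sum_l rh h i l *: yact h (shl l phi).
Proof. by apply/funext => w; rewrite eval_sum. Qed.

(** [shl i] is a left skew derivation, and this is its twisted Leibniz rule. With the value at the
    empty word it determines [lmul]; later identities between operators are proved by comparing left
    derivatives. *)
Lemma shl_lmul i j phi :
  shl i (lmul j phi) = (i == j)%:R *: phi + \sum_l rh (dg j) i l *: lmul j (shl l phi).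
Proof. by apply/funext => w; rewrite evalD eval_sum. Qed.

Lemma shl_rmul i j phi :
  shl i (rmul j phi) = (i == j)%:R *: phi + \sum_l rh (dg i)^-1 l j *: rmul l (shl i phi).
Proof. by apply/funext => w; rewrite evalD eval_sum. Qed.

Lemma shl_vac i : shl i vac = 0.
Proof. by []. Qed.

Lemma shlD i phi psi : shl i (phi + psi) = shl i phi + shl i psi.
Proof. by []. Qed.
Lemma shlZ i a phi : shl i (a *: phi) = a *: shl i phi.
Proof. by []. Qed.
Lemma shl_sum i (T : Type) (r : seq T) (P : pred T) (f : T -> F) :
  shl i (\sum_(x <- r | P x) f x) = \sum_(x <- r | P x) shl i (f x).
Proof. exact: (linearf_sum (shl_linear i)). Qed.

Lemma yact_linear h : linear (yact h).
Proof.
move=> a phi psi; apply/funext => w; elim: w phi psi => [//|i w IH] phi psi.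
rewrite -[LHS]/(shl i (yact h (a *: phi + psi)) w) shl_yact evalZD.
rewrite -[yact h phi _]/(shl i (yact h phi) w) -[yact h psi _]/(shl i (yact h psi) w).
rewrite !shl_yact !eval_sum scaler_sumr -big_split; apply: eq_bigr => l _ /=.
by rewrite !evalZ shlD shlZ IH !scalerDr !scalerA mulrC.
Qed.

Lemma lmul_linear j : linear (lmul j).
Proof.
move=> a phi psi; apply/funext => w; elim: w phi psi => [|i w IH] phi psi.
  by rewrite evalZD !lmul_nil scaler0 addr0.
rewrite -[LHS]/(shl i (lmul j (a *: phi + psi)) w) shl_lmul [RHS]evalZD.
rewrite -[lmul j phi _]/(shl i (lmul j phi) w) -[lmul j psi _]/(shl i (lmul j psi) w).
rewrite !shl_lmul !evalD !eval_sum [in RHS]scalerDr [RHS]addrACA; congr (_ + _).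
  by rewrite !evalZ evalZD scalerDr !scalerA mulrC.
rewrite scaler_sumr -big_split; apply: eq_bigr => l _ /=.
by rewrite !evalZ shlD shlZ IH !scalerDr !scalerA mulrC.
Qed.

Lemma rmul_linear j : linear (rmul j).
Proof.
move=> a phi psi; apply/funext => w; elim: w j phi psi => [|i w IH] j phi psi.
  by rewrite evalZD !rmul_nil scaler0 addr0.
rewrite -[LHS]/(shl i (rmul j (a *: phi + psi)) w) shl_rmul [RHS]evalZD.
rewrite -[rmul j phi _]/(shl i (rmul j phi) w) -[rmul j psi _]/(shl i (rmul j psi) w).
rewrite !shl_rmul !evalD !eval_sum [in RHS]scalerDr [RHS]addrACA; congr (_ + _).
  by rewrite !evalZ evalZD scalerDr !scalerA mulrC.
rewrite scaler_sumr -big_split; apply: eq_bigr => l _ /=.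
by rewrite !evalZ shlD shlZ IH !scalerDr !scalerA mulrC.
Qed.

Lemma yactD h phi psi : yact h (phi + psi) = yact h phi + yact h psi.
Proof. exact: (linearfD (yact_linear h)). Qed.
Lemma yactB h phi psi : yact h (phi - psi) = yact h phi - yact h psi.
Proof. exact: (linearfB (yact_linear h)). Qed.
Lemma yactZ h a phi : yact h (a *: phi) = a *: yact h phi.
Proof. exact: (linearfZ (yact_linear h)). Qed.
Lemma yact0 h : yact h 0 = 0.
Proof. exact: (linearf0 (yact_linear h)). Qed.
Lemma yact_sum h (T : Type) (r : seq T) (P : pred T) (f : T -> F) :
  yact h (\sum_(x <- r | P x) f x) = \sum_(x <- r | P x) yact h (f x).
Proof. exact: (linearf_sum (yact_linear h)). Qed.

Lemma lmulD j phi psi : lmul j (phi + psi) = lmul j phi + lmul j psi.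
Proof. exact: (linearfD (lmul_linear j)). Qed.
Lemma lmulZ j a phi : lmul j (a *: phi) = a *: lmul j phi.
Proof. exact: (linearfZ (lmul_linear j)). Qed.
Lemma lmul0 j : lmul j 0 = 0.
Proof. exact: (linearf0 (lmul_linear j)). Qed.
Lemma lmul_sum j (T : Type) (r : seq T) (P : pred T) (f : T -> F) :
  lmul j (\sum_(x <- r | P x) f x) = \sum_(x <- r | P x) lmul j (f x).
Proof. exact: (linearf_sum (lmul_linear j)). Qed.

Lemma rmulD j phi psi : rmul j (phi + psi) = rmul j phi + rmul j psi.
Proof. exact: (linearfD (rmul_linear j)). Qed.
Lemma rmulZ j a phi : rmul j (a *: phi) = a *: rmul j phi.
Proof. exact: (linearfZ (rmul_linear j)). Qed.
Lemma rmul0 j : rmul j 0 = 0.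
Proof. exact: (linearf0 (rmul_linear j)). Qed.
Lemma rmul_sum j (T : Type) (r : seq T) (P : pred T) (f : T -> F) :
  rmul j (\sum_(x <- r | P x) f x) = \sum_(x <- r | P x) rmul j (f x).
Proof. exact: (linearf_sum (rmul_linear j)). Qed.

(** Induction on the word with the argument left free, because passing from [w] to [i :: w] replaces
    a function by its derivatives. *)
Lemma F_ind_eq (T : Type) (f g : T -> F) :
  (forall x, f x [::] = g x [::]) ->
  (forall w, (forall x, f x w = g x w) -> forall x i, f x (i :: w) = g x (i :: w)) ->
  f =1 g.
Proof.
move=> fg0 fgS x; apply/funext => w.
by elim: w x => [|i w IH] x; [apply: fg0|apply: fgS].
Qed.

Lemma yact1 phi : yact 1%g phi = phi.
Proof.
apply: (@F_ind_eq F (yact 1%g) id) => // w IH x i.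
rewrite -[LHS]/(shl i (yact 1%g x) w) shl_yact eval_sum (bigD1 i) //= evalZ.
rewrite rh1 eqxx scale1r IH big1 ?addr0 // => l /negPf li.
by rewrite evalZ rh1 eq_sym li scale0r.
Qed.

Lemma yactM g h phi : yact (g * h)%g phi = yact g (yact h phi).
Proof.
apply: (@F_ind_eq F (yact (g * h)%g) (fun phi => yact g (yact h phi))) => // w IH x i.
rewrite -[LHS]/(shl i (yact (g * h)%g x) w) -[RHS]/(shl i (yact g (yact h x)) w).
rewrite !shl_yact !eval_sum.
transitivity (\sum_l \sum_m (rh g i l * rh h l m) *: yact g (yact h (shl m x)) w).
  rewrite exchange_big; apply: eq_bigr => m _ /=.
  by rewrite evalZ rhM scaler_suml IH.
apply: eq_bigr => l _; rewrite evalZ shl_yact yact_sum eval_sum scaler_sumr.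
by apply: eq_bigr => m _; rewrite yactZ evalZ scalerA.
Qed.

Lemma yactK h phi : yact h^-1%g (yact h phi) = phi.
Proof. by rewrite -yactM mulVg yact1. Qed.
Lemma yactVK h phi : yact h (yact h^-1%g phi) = phi.
Proof. by rewrite -yactM mulgV yact1. Qed.

Lemma yact_vac h : yact h vac = vac.
Proof.
apply/funext => -[//|i w]; rewrite -[LHS]/(shl i (yact h vac) w) shl_yact eval_sum.
by rewrite big1 // => l _; rewrite shl_vac yact0 scaler0.
Qed.

Lemma shr_shl u i phi : shr u (shl i phi) = shl i (shr u phi).
Proof. by []. Qed.

Lemma shr_nil phi : shr [::] phi = phi.
Proof. by apply/funext => w; rewrite /shr cats0. Qed.

Lemma shr_cons i u phi : shr (i :: u) phi = shr [:: i] (shr u phi).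
Proof. by apply/funext => w; rewrite /shr -catA. Qed.

(** The last letter of a term of the product either comes from [phi] or is [j] itself, which has
    then passed through all of [phi] and acted on it by its degree. *)
Lemma shr_lmul i j phi :
  shr [:: i] (lmul j phi) = lmul j (shr [:: i] phi) + (i == j)%:R *: yact (dg j) phi.
Proof.
apply: (@F_ind_eq F (fun phi => shr [:: i] (lmul j phi))
  (fun phi => lmul j (shr [:: i] phi) + (i == j)%:R *: yact (dg j) phi)).
  move=> x; rewrite evalD evalZ yact_nil lmul_nil add0r.
  rewrite -[LHS]/(shl i (lmul j x) [::]) shl_lmul evalD eval_sum big1 ?addr0 //.
  by move=> l _; rewrite evalZ lmul_nil scaler0.
move=> w IH x l.
rewrite -[LHS]/(shr [:: i] (shl l (lmul j x)) w) -[RHS]/(shl l (_ + _) w).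
rewrite shl_lmul shlD shlZ shl_lmul shl_yact.
rewrite (linearfD (shr_linear _)) (linearfZ (shr_linear _)) (linearf_sum (shr_linear _)).
rewrite !evalD -!addrA evalZ; congr (_ + _); rewrite !evalZ !eval_sum.
rewrite scaler_sumr -big_split; apply: eq_bigr => m _ /=.
rewrite (linearfZ (shr_linear _)) !evalZ IH evalD evalZ scalerDr shr_shl.
by rewrite !scalerA mulrC.
Qed.

Lemma rh_moveL (M : lmodType k) h i (f g : I -> M) :
  (forall l, rh h i l != 0 -> f l = g l) ->
  \sum_l rh h i l *: f l = \sum_l rh h i l *: g l.
Proof.
move=> fg; apply: eq_bigr => l _.
by have [->|/fg -> //] := eqVneq (rh h i l) 0; rewrite !scale0r.
Qed.

Lemma rh_moveR (M : lmodType k) h i (f g : I -> M) :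
  (forall l, rh h l i != 0 -> f l = g l) ->
  \sum_l rh h l i *: f l = \sum_l rh h l i *: g l.
Proof.
move=> fg; apply: eq_bigr => l _.
by have [->|/fg -> //] := eqVneq (rh h l i) 0; rewrite !scale0r.
Qed.

Lemma sum_delta (M : lmodType k) (c : I -> k) (f : M) i :
  \sum_l c l *: ((i == l)%:R *: f) = c i *: f.
Proof.
rewrite (bigD1 i) //= eqxx scale1r big1 ?addr0 // => l li.
by rewrite eq_sym (negPf li) scale0r scaler0.
Qed.

Lemma sum_delta' (M : lmodType k) (c : I -> k) (f : I -> M) i :
  \sum_l c l *: ((l == i)%:R *: f l) = c i *: f i.
Proof.
rewrite (bigD1 i) //= eqxx scale1r big1 ?addr0 // => l li.
by rewrite (negPf li) scale0r scaler0.
Qed.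

Lemma sum_rhM (M : lmodType k) g h (f : I -> M) i :
  \sum_l rh g i l *: (\sum_m rh h l m *: f m) = \sum_m rh (g * h)%g i m *: f m.
Proof.
under eq_bigr => l _ do rewrite scaler_sumr.
rewrite exchange_big; apply: eq_bigr => m _ /=.
by rewrite rhM scaler_suml; apply: eq_bigr => l _; rewrite scalerA.
Qed.

Lemma sum_rhM' (M : lmodType k) g h (f : I -> M) i :
  \sum_l rh h l i *: (\sum_m rh g m l *: f m) = \sum_m rh (g * h)%g m i *: f m.
Proof.
under eq_bigr => l _ do rewrite scaler_sumr.
rewrite exchange_big; apply: eq_bigr => m _ /=.
by rewrite rhM scaler_suml; apply: eq_bigr => l _; rewrite scalerA mulrC.
Qed.

Lemma sum_rh1 (M : lmodType k) (f : I -> M) i : \sum_l rh 1%g i l *: f l = f i.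
Proof.
rewrite (bigD1 i) //= rh1 eqxx scale1r big1 ?addr0 // => l /negPf li.
by rewrite rh1 eq_sym li scale0r.
Qed.

Lemma sum_rh1' (M : lmodType k) (f : I -> M) i : \sum_l rh 1%g l i *: f l = f i.
Proof.
rewrite (bigD1 i) //= rh1 eqxx scale1r big1 ?addr0 // => l /negPf li.
by rewrite rh1 li scale0r.
Qed.

Lemma yact_lmul h j phi :
  yact h (lmul j phi) = \sum_l rh h l j *: lmul l (yact h phi).
Proof.
apply: (@F_ind_eq F (fun phi => yact h (lmul j phi))
  (fun phi => \sum_l rh h l j *: lmul l (yact h phi))).
  move=> x; rewrite yact_nil lmul_nil eval_sum big1 // => l _.
  by rewrite evalZ lmul_nil scaler0.
move=> w IH x i.
rewrite -[LHS]/(shl i (yact h (lmul j x)) w) -[RHS]/(shl i (\sum_l _) w).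
have IH' y : yact h (lmul j y) w = \sum_l rh h l j *: lmul l (yact h y) w.
  by rewrite IH eval_sum; apply: eq_bigr => l _; rewrite evalZ.
rewrite shl_yact shl_sum.
under [X in _ = X _]eq_bigr => l _ do rewrite shlZ shl_lmul scalerDr.
rewrite big_split /= sum_delta evalD.
under eq_bigr => l _ do rewrite shl_lmul yactD yactZ scalerDr.
rewrite big_split /= evalD sum_delta'; congr (_ + _).
under eq_bigr => l _ do rewrite yact_sum.
under eq_bigr => l _.
  under eq_bigr => m _ do rewrite yactZ.
  over.
rewrite sum_rhM.
under [in RHS]eq_bigr => l _.
  under eq_bigr => m _ do rewrite shl_yact lmul_sum.
  under eq_bigr => m _.
    under eq_bigr => n _ do rewrite lmulZ.
    over.
  rewrite sum_rhM.
  over.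
rewrite (rh_moveR (g := fun l => \sum_m rh (h * dg j)%g i m *: lmul l (yact h (shl m x)))); last first.
  by move=> l /rh_dg ->; rewrite mulgKV.
under [in RHS]eq_bigr => l _ do rewrite scaler_sumr.
rewrite exchange_big /= !eval_sum; apply: eq_bigr => m _.
rewrite evalZ IH' eval_sum scaler_sumr; apply: eq_bigr => l _.
by rewrite !evalZ !scalerA mulrC.
Qed.

(** Associativity makes left and right multiplications commute; the inverse braiding built into
    [rmul] leaves only the action of the inverse of [dg j] on the letter [i]. *)
Lemma rmul_lmul i j phi :
  rmul i (lmul j phi) = \sum_l rh (dg j)^-1 l i *: lmul j (rmul l phi).
Proof.
apply: (@F_ind_eq (I * F) (fun x => rmul x.1 (lmul j x.2))
  (fun x => \sum_l rh (dg j)^-1 l x.1 *: lmul j (rmul l x.2)) _ _ (i, phi)).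
  move=> x; rewrite rmul_nil eval_sum big1 // => l _.
  by rewrite evalZ lmul_nil scaler0.
move=> w IH [{}i x] m /=.
have IH' n y : rmul n (lmul j y) w = \sum_l rh (dg j)^-1 l n *: lmul j (rmul l y) w.
  by rewrite (IH (n, y)) eval_sum; apply: eq_bigr => l _; rewrite evalZ.
rewrite -[LHS]/(shl m (rmul i (lmul j x)) w) -[RHS]/(shl m (\sum_l _) w).
rewrite shl_rmul shl_sum.
under [X in _ = X _]eq_bigr => l _ do rewrite shlZ shl_lmul scalerDr.
rewrite big_split /=.
have -> : \sum_l rh (dg j)^-1 l i *: ((m == j)%:R *: rmul l x) =
   \sum_l rh (dg m)^-1 l i *: rmul l ((m == j)%:R *: x).
  case: eqP => [->|_]; first by apply: eq_bigr => l _; rewrite !scale1r.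
  by rewrite !big1 // => l _; rewrite scale0r ?rmul0 scaler0.
have -> : \sum_l rh (dg m)^-1 l i *: rmul l (shl m (lmul j x)) =
  \sum_l rh (dg m)^-1 l i *: rmul l ((m == j)%:R *: x) +
  \sum_l rh (dg m)^-1 l i *: (\sum_n rh (dg j) m n *: rmul l (lmul j (shl n x))).
  rewrite -big_split; apply: eq_bigr => l _ /=.
  rewrite shl_lmul rmulD scalerDr rmul_sum; congr (_ + _); congr (_ *: _).
  by apply: eq_bigr => n _; rewrite rmulZ.
rewrite addrCA !evalD; congr (_ + _).
have -> : \sum_l rh (dg j)^-1 l i *: (\sum_n rh (dg j) m n *: lmul j (shl n (rmul l x))) =
  (m == i)%:R *: lmul j x +
  \sum_n rh (dg j) m n *: \sum_q rh ((dg n)^-1 * (dg j)^-1)%g q i *: lmul j (rmul q (shl n x)).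
  transitivity (\sum_l rh (dg j)^-1 l i *: (rh (dg j) m l *: lmul j x) +
    \sum_l rh (dg j)^-1 l i *: \sum_n rh (dg j) m n *: \sum_q rh (dg n)^-1 q l *: lmul j (rmul q (shl n x))).
    rewrite -big_split; apply: eq_bigr => l _ /=; rewrite -scalerDr; congr (_ *: _).
    transitivity (\sum_n rh (dg j) m n *: ((n == l)%:R *: lmul j x) +
       \sum_n rh (dg j) m n *: \sum_q rh (dg n)^-1 q l *: lmul j (rmul q (shl n x))).
      rewrite -big_split; apply: eq_bigr => n _ /=; rewrite -scalerDr; congr (_ *: _).
      rewrite shl_rmul lmulD lmulZ lmul_sum; congr (_ + _).
      by apply: eq_bigr => q _; rewrite lmulZ.
    by rewrite sum_delta'.
  congr (_ + _).
    rewrite -(rh1 m i) -(mulgV (dg j)) rhM scaler_suml.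
    by apply: eq_bigr => l _; rewrite scalerA mulrC.
  under eq_bigr => l _ do rewrite scaler_sumr.
  rewrite exchange_big; apply: eq_bigr => n _ /=.
  rewrite -sum_rhM' scaler_sumr; apply: eq_bigr => l _.
  by rewrite !scalerA mulrC.
rewrite evalD; congr (_ + _).
(* A nonzero entry [rh (dg j) m n] makes [dg m] the conjugate of [dg n] by [dg j], so the two
   twisting group elements agree. *)
rewrite (rh_moveL (g := fun n => \sum_q rh ((dg j)^-1 * (dg m)^-1)%g q i *: lmul j (rmul q (shl n x)))); last first.
  by move=> n /rh_dg ->; rewrite !invMg invgK !mulgA mulVg mul1g.
under eq_bigr => l _ do rewrite scaler_sumr.
rewrite exchange_big /= !eval_sum; apply: eq_bigr => n _.
rewrite -sum_rhM' eval_sum evalZ eval_sum scaler_sumr; apply: eq_bigr => l _.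
by rewrite !evalZ eval_sum IH' !scalerA mulrC; congr (_ *: _).
Qed.

End Operators.

Arguments vac {k gT} D _.

Lemma sum_neq0 (T : finType) (M : nmodType) (f : T -> M) :
  \sum_x f x != 0 -> exists x, f x != 0.
Proof.
apply: contra_neqP => nf; apply: big1 => x _; apply/eqP.
by apply: contra_notT nf => fx; exists x.
Qed.

(** * The quantum shuffle model of the Nichols algebra *)

Section NicholsModel.
Variables (k : fieldType) (gT : finGroupType) (D : ydd k gT).
Local Notation I := (ix D).
Local Notation F := (seq I -> k^o).
Implicit Types (phi psi : F) (w u : seq I) (i j l : I) (g h : gT).

Definition lword w : F := foldr (@lmul k gT D) (vac D) w.

(** The subalgebra of the shuffle algebra generated by the letters, that is, the image of the
    quantum symmetriser. *)
Definition nich : set F := lspan [set phi | exists w, phi = lword w]%classic.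

Lemma nich_subspace : subspace nich.
Proof. exact: lspan_subspace. Qed.

Lemma nich_lword w : nich (lword w).
Proof. by apply: sub_lspan; exists w. Qed.

Lemma nich_ind (S : set F) : subspace S -> (forall w, S (lword w)) ->
  forall phi, nich phi -> S phi.
Proof. by move=> sS Sw; apply: lspan_min => // phi [w ->]. Qed.

Lemma nich0 : nich 0.
Proof. by case: nich_subspace. Qed.

Lemma nichZ a phi : nich phi -> nich (a *: phi).
Proof. exact: (subspaceZ _ nich_subspace). Qed.

Lemma nichD phi psi : nich phi -> nich psi -> nich (phi + psi).
Proof. exact: (subspaceD nich_subspace). Qed.

Lemma nich_sum (T : Type) (r : seq T) (P : pred T) (f : T -> F) :
  (forall x, P x -> nich (f x)) -> nich (\sum_(x <- r | P x) f x).
Proof. by move=> nf; apply: (@subspace_sum _ _ nich T) => //; apply: nich_subspace. Qed.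

Lemma nich_lmul j phi : nich phi -> nich (lmul j phi).
Proof.
apply: (@nich_ind (lmul j @^-1` nich)%classic) => [|w].
  exact: subspace_preim (@lmul_linear _ _ D j) nich_subspace.
exact: (nich_lword (j :: w)).
Qed.

Lemma nich_yact h phi : nich phi -> nich (yact h phi).
Proof.
apply: (@nich_ind (yact h @^-1` nich)%classic) => [|w].
  exact: subspace_preim (@yact_linear _ _ D h) nich_subspace.
elim: w => [|j w IH] /=; first by rewrite yact_vac; apply: (nich_lword [::]).
rewrite yact_lmul; apply: nich_sum => l _.
by apply: nichZ; apply: nich_lmul.
Qed.

Lemma nich_shl i phi : nich phi -> nich (shl i phi).
Proof.
apply: (@nich_ind (shl i @^-1` nich)%classic) => [|w].
  exact: subspace_preim (@shl_linear _ _ D i) nich_subspace.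
elim: w i => [|j w IH] i /=; first exact: nich0.
rewrite shl_lmul; apply: nichD.
  by apply: nichZ; apply: nich_lword.
apply: nich_sum => l _.
by apply: nichZ; apply: nich_lmul; apply: IH.
Qed.

Lemma rmul_vac i : rmul i (vac D) = lmul i (vac D).
Proof.
apply/funext => -[//|j w].
rewrite -[LHS]/(shl j (rmul i (vac D)) w) -[RHS]/(shl j (lmul i (vac D)) w).
rewrite shl_rmul shl_lmul !evalD !eval_sum; congr (_ + _).
by rewrite !big1 // => l _; rewrite !shl_vac ?rmul0 ?lmul0 scaler0.
Qed.

Lemma nich_rmul i phi : nich phi -> nich (rmul i phi).
Proof.
apply: (@nich_ind (rmul i @^-1` nich)%classic) => [|w].
  exact: subspace_preim (@rmul_linear _ _ D i) nich_subspace.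
elim: w i => [|j w IH] i /=; first by rewrite rmul_vac; apply: (nich_lword [:: i]).
rewrite rmul_lmul; apply: nich_sum => l _.
by apply: nichZ; apply: nich_lmul; apply: IH.
Qed.

Lemma nich_shr u phi : nich phi -> nich (shr u phi).
Proof.
elim: u phi => [|i u IH] phi nphi; first by rewrite shr_nil.
rewrite shr_cons; move: (shr u phi) (IH _ nphi).
apply: (@nich_ind (shr [:: i] @^-1` nich)%classic) => [|w].
  exact: subspace_preim (@shr_linear _ _ D [:: i]) nich_subspace.
elim: w => [|j w IHw] /=.
  by apply: eq_ind nich0 _ _; apply/funext => -[].
rewrite shr_lmul; apply: nichD; first exact: nich_lmul.
by apply: nichZ; apply: nich_yact; apply: nich_lword.
Qed.

Definition nV w := count (@sd k gT D) w.
Definition nW w := count (predC (@sd k gT D)) w.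

(* The offsets [a] and [b] account for letters already removed from the words. *)
Definition hom_off (a b m n : nat) phi : Prop :=
  forall w, phi w != 0 -> (nV w + a = m)%N /\ (nW w + b = n)%N.

Definition bihom m n phi := hom_off 0 0 m n phi.

Lemma hom_off_subspace a b m n : subspace [set phi | hom_off a b m n phi]%classic.
Proof.
split=> [w|c phi psi hp hq w]; first by rewrite eqxx.
rewrite evalZD; have [->|/hp //] := eqVneq (phi w) 0.
by rewrite scaler0 add0r => /hq.
Qed.

Lemma hom_off_shl a b m n i phi : hom_off a b m n phi ->
  hom_off (sd i + a) (~~ sd i + b) m n (shl i phi).
Proof. by move=> hp w /hp /= [<- <-]; rewrite /= !addnA ![(_ + sd i)%N]addnC ![(_ + ~~ sd i)%N]addnC. Qed.

Lemma hom_off_yact a b m n h phi : hom_off a b m n phi -> hom_off a b m n (yact h phi).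
Proof.
move=> hp w; elim: w a b phi hp => [|i w IH] a b phi hp; first exact: hp.
rewrite -[yact h phi _]/(shl i (yact h phi) w) shl_yact eval_sum => /sum_neq0 [l].
rewrite evalZ => nz; have rl : rh h i l != 0.
  by apply: contraNneq nz => ->; rewrite scale0r.
have : yact h (shl l phi) w != 0 by apply: contraNneq nz => ->; rewrite scaler0.
move=> /(IH _ _ _ (hom_off_shl (i := l) hp)) [<- <-]; rewrite -(rh_sd rl) /=.
by rewrite !addnA ![(_ + sd i)%N]addnC ![(_ + ~~ sd i)%N]addnC.
Qed.

Lemma hom_off_lmul a b m n j phi : hom_off a b m n phi ->
  hom_off a b (sd j + m) (~~ sd j + n) (lmul j phi).
Proof.
move=> hp w; elim: w a b phi hp => [|i w IH] a b phi hp; first by rewrite eqxx.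
rewrite -[lmul j phi _]/(shl i (lmul j phi) w) shl_lmul evalD eval_sum => nz.
have [/eqP ij|] := boolP ((i == j) && (phi w != 0)).
  move: ij; rewrite eqb_id => /andP [/eqP -> /hp [<- <-]] /=.
  by rewrite !addnA.
rewrite negb_and => ijp.
have e0 : ((i == j)%:R *: phi) w = 0.
  rewrite evalZ; case/orP: ijp => [/negPf ->|]; first by rewrite scale0r.
  by rewrite negbK => /eqP ->; rewrite scaler0.
move: nz; rewrite e0 add0r => /sum_neq0 [l].
rewrite evalZ => nz; have rl : rh (dg j) i l != 0.
  by apply: contraNneq nz => ->; rewrite scale0r.
have : lmul j (shl l phi) w != 0 by apply: contraNneq nz => ->; rewrite scaler0.
move=> /(IH _ _ _ (hom_off_shl (i := l) hp)) [<- <-]; rewrite -(rh_sd rl) /=.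
by rewrite !addnA ![(_ + sd i)%N]addnC ![(_ + ~~ sd i)%N]addnC.
Qed.

Lemma hom_off_rmul a b m n j phi : hom_off a b m n phi ->
  hom_off a b (sd j + m) (~~ sd j + n) (rmul j phi).
Proof.
move=> hp w; elim: w a b j phi hp => [|i w IH] a b j phi hp; first by rewrite eqxx.
rewrite -[rmul j phi _]/(shl i (rmul j phi) w) shl_rmul evalD eval_sum => nz.
have [/eqP ij|] := boolP ((i == j) && (phi w != 0)).
  move: ij; rewrite eqb_id => /andP [/eqP -> /hp [<- <-]] /=.
  by rewrite !addnA.
rewrite negb_and => ijp.
have e0 : ((i == j)%:R *: phi) w = 0.
  rewrite evalZ; case/orP: ijp => [/negPf ->|]; first by rewrite scale0r.
  by rewrite negbK => /eqP ->; rewrite scaler0.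
move: nz; rewrite e0 add0r => /sum_neq0 [l].
rewrite evalZ => nz; have rl : rh (dg i)^-1 l j != 0.
  by apply: contraNneq nz => ->; rewrite scale0r.
have : rmul l (shl i phi) w != 0 by apply: contraNneq nz => ->; rewrite scaler0.
move=> /(IH _ _ _ _ (hom_off_shl (i := i) hp)) [];  rewrite (rh_sd rl) => <- <- /=.
by rewrite !addnA ![(_ + sd i)%N]addnC ![(_ + ~~ sd i)%N]addnC.
Qed.

Lemma hom_lword w : bihom (nV w) (nW w) (lword w).
Proof.
elim: w => [|j w IH]; first by case=> // i w; rewrite eqxx.
exact: hom_off_lmul.
Qed.

Definition nich_hom m n phi : Prop := nich phi /\ bihom m n phi.

Lemma nich_hom_subspace m n : subspace (nich_hom m n).
Proof.
have [h0 hZD] := hom_off_subspace 0 0 m n.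
split=> [|a u v [nu hu] [nv hv]]; first by split; [exact: nich0|].
by split; [apply: nich_subspace.2|apply: hZD].
Qed.

Lemma nich_hom_lword w : nich_hom (nV w) (nW w) (lword w).
Proof. by split; [apply: nich_lword|apply: hom_lword]. Qed.

Lemma nich_hom_lmul m n j phi : nich_hom m n phi ->
  nich_hom (sd j + m) (~~ sd j + n) (lmul j phi).
Proof. by move=> [nphi hphi]; split; [apply: nich_lmul|apply: hom_off_lmul]. Qed.

Lemma nich_hom_rmul m n j phi : nich_hom m n phi ->
  nich_hom (sd j + m) (~~ sd j + n) (rmul j phi).
Proof. by move=> [nphi hphi]; split; [apply: nich_rmul|apply: hom_off_rmul]. Qed.

Lemma nich_hom_yact m n h phi : nich_hom m n phi -> nich_hom m n (yact h phi).
Proof. by move=> [nphi hphi]; split; [apply: nich_yact|apply: hom_off_yact]. Qed.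

Lemma nich_hom_shl m n j phi : nich_hom (sd j + m) (~~ sd j + n) phi ->
  nich_hom m n (shl j phi).
Proof.
move=> [nphi hphi]; split; first exact: nich_shl.
by move=> w /hphi [/=]; rewrite !addn0 => /addnI -> /addnI ->.
Qed.

Lemma nich_hom_shr m n u phi : nich_hom (nV u + m) (nW u + n) phi ->
  nich_hom m n (shr u phi).
Proof.
move=> [nphi hphi]; split; first exact: nich_shr.
move=> w /hphi []; rewrite /nV /nW !count_cat !addn0.
by rewrite ![(count _ w + _)%N]addnC => /addnI -> /addnI ->.
Qed.

Definition prt m n phi : F :=
  fun w => ((nV w == m) && (nW w == n))%:R *: phi w.

Lemma prt_linear m n : linear (prt m n).
Proof.
move=> a phi psi; apply/funext => w.
by rewrite /prt !evalZD !scalerDr !scalerA mulrC.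
Qed.

Lemma prt_id m n phi : bihom m n phi -> prt m n phi = phi.
Proof.
move=> hp; apply/funext => w; rewrite /prt.
have [->|/hp [<- <-]] := eqVneq (phi w) 0; first by rewrite scaler0.
by rewrite !addn0 !eqxx scale1r.
Qed.

Lemma prt_0 m n m' n' phi : bihom m' n' phi -> (m', n') != (m, n) -> prt m n phi = 0.
Proof.
move=> hp ne; apply/funext => w; rewrite /prt.
have [->|/hp [em en]] := eqVneq (phi w) 0; first by rewrite scaler0.
move: ne; rewrite -em -en !addn0 xpair_eqE => /negPf ->.
by rewrite scale0r.
Qed.

Lemma hom_prt m n phi : bihom m n (prt m n phi).
Proof.
move=> w; rewrite /prt; case: (boolP (_ && _)) => [/andP [/eqP <- /eqP <-]|].
  by rewrite !addn0.
by rewrite scale0r eqxx.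
Qed.

Lemma nich_prt m n phi : nich phi -> nich (prt m n phi).
Proof.
apply: (@nich_ind (prt m n @^-1` nich)%classic) => [|w].
  exact: subspace_preim (@prt_linear m n) nich_subspace.
rewrite /=; have [e|ne] := eqVneq (nV w, nW w) (m, n).
  by case: e => <- <-; rewrite prt_id; [apply: nich_lword|apply: hom_lword].
by rewrite (prt_0 (@hom_lword w) ne); apply: nich0.
Qed.

Lemma nich_hom_prt m n phi : nich phi -> nich_hom m n (prt m n phi).
Proof. by move=> nphi; split; [apply: nich_prt|apply: hom_prt]. Qed.

Lemma prt_yact m n h phi : prt m n (yact h phi) = yact h (prt m n phi).
Proof.
have gen a b : hom_off a b m n (yact h (fun w => ((nV w + a == m)%N && (nW w + b == n)%N)%:R *: phi w)).
  apply: hom_off_yact => w; case: (boolP (_ && _)) => [/andP [/eqP <- /eqP <-] //|].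
  by rewrite scale0r eqxx.
(* The offsets make the induction on [w] possible: they record the types of the removed letters,
   which the action preserves. *)
suff S a b psi w : ((nV w + a == m)%N && (nW w + b == n)%N)%:R *: yact h psi w =
    yact h (fun w => ((nV w + a == m)%N && (nW w + b == n)%N)%:R *: psi w) w.
  apply/funext => w; have := S 0 0 phi w; rewrite !addn0 /prt => ->; congr (yact h _ w).
  by apply/funext => v; rewrite !addn0.
elim: w a b psi {gen} => [//|i w IH] a b psi.
rewrite -[yact h psi _]/(shl i (yact h psi) w) -[RHS]/(shl i (yact h _) w).
rewrite !shl_yact !eval_sum scaler_sumr; apply: eq_bigr => l _; rewrite !evalZ.
have [->|rl] := eqVneq (rh h i l) 0; first by rewrite !scale0r scaler0.
rewrite !scalerA mulrC -scalerA; congr (_ *: _).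
have := IH (sd l + a)%N (~~ sd l + b)%N (shl l psi).
rewrite /= (rh_sd rl) !addnA ![(nV w + _)%N]addnC ![(nW w + _)%N]addnC => ->.
congr (yact h _ w); apply/funext => v.
by rewrite /shl /= !addnA ![(nV v + _)%N]addnC ![(nW v + _)%N]addnC.
Qed.

(* The deconcatenation coproduct of [phi], as a finite sum of tensors. *)
Definition decomp phi (L : seq (F * F)) : Prop :=
  forall w u, phi (w ++ u) = \sum_(x <- L) (x.2 u : k) *: x.1 w.

Lemma decomp_shl i phi L : decomp phi L -> decomp (shl i phi) [seq (shl i x.1, x.2) | x <- L].
Proof. by move=> dL w u; rewrite big_map; apply: (dL (i :: w)). Qed.

Lemma decomp_yact h phi L : decomp phi L ->
  decomp (yact h phi) [seq (yact h x.1, yact h x.2) | x <- L].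
Proof.
move=> dL w u; rewrite big_map /=.
elim: w phi L dL => [|i w IH] phi L dL /=.
  have -> : phi = \sum_(x <- L) (x.1 [::] : k) *: x.2.
    by apply/funext => v; rewrite eval_sum (dL [::]); apply: eq_bigr => x _; rewrite evalZ; apply: mulrC.
  rewrite yact_sum eval_sum; apply: eq_bigr => x _.
  by rewrite yactZ ?yact_nil evalZ; apply: mulrC.
under [RHS]eq_bigr => x _ do rewrite scaler_sumr.
rewrite exchange_big; apply: eq_bigr => l _ /=.
rewrite (IH _ _ (decomp_shl l dL)) big_map scaler_sumr.
by apply: eq_bigr => x _ /=; rewrite !scalerA mulrC.
Qed.

(** The coproduct of a product by a letter: [j] either multiplies the left factor, or passes it,
    acting by [dg j], and multiplies the right one. *)
Lemma decomp_lmul j phi L : decomp phi L ->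
  decomp (lmul j phi) ([seq (lmul j x.1, x.2) | x <- L] ++
                       [seq (yact (dg j) x.1, lmul j x.2) | x <- L]).
Proof.
move=> dL w u; rewrite big_cat !big_map /=.
elim: w phi L dL => [|i w IH] phi L dL /=.
  have -> : phi = \sum_(x <- L) (x.1 [::] : k) *: x.2.
    by apply/funext => v; rewrite eval_sum (dL [::]); apply: eq_bigr => x _; rewrite evalZ; apply: mulrC.
  rewrite lmul_sum eval_sum [X in _ = X + _]big1 ?add0r; last first.
    by move=> x _; rewrite scaler0.
  apply: eq_bigr => x _; by rewrite lmulZ ?yact_nil evalZ; apply: mulrC.
under [X in _ = X + _]eq_bigr => x _ do rewrite scalerDr.
rewrite big_split /= -addrA; congr (_ + _).
  by rewrite dL scaler_sumr; apply: eq_bigr => x _; rewrite !scalerA mulrC.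
under eq_bigr => l _ do rewrite (IH _ _ (decomp_shl l dL)) !big_map scalerDr.
rewrite big_split /=; congr (_ + _).
  under [RHS]eq_bigr => x _ do rewrite scaler_sumr.
  rewrite exchange_big; apply: eq_bigr => l _ /=; rewrite scaler_sumr.
  by apply: eq_bigr => x _; rewrite !scalerA mulrC.
under [RHS]eq_bigr => x _ do rewrite scaler_sumr.
rewrite exchange_big; apply: eq_bigr => l _ /=; rewrite scaler_sumr.
by apply: eq_bigr => x _ /=; rewrite !scalerA mulrC.
Qed.

Lemma nich_decomp phi : nich phi ->
  exists2 L, decomp phi L & forall x, x \in L -> nich x.1 /\ nich x.2.
Proof.
apply: (@nich_ind [set phi | exists2 L, decomp phi L &
  forall x, x \in L -> nich x.1 /\ nich x.2]%classic) => [|w].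
  split; first by exists [::] => // w u; rewrite big_nil.
  move=> a u v [L1 d1 n1] [L2 d2 n2].
  exists ([seq (x.1, a *: x.2) | x <- L1] ++ L2).
    move=> w' u'; rewrite big_cat big_map evalZD d1 d2 scaler_sumr; congr (_ + _).
    by apply: eq_bigr => x _; rewrite /= ?evalZ scalerA.
  move=> x; rewrite mem_cat => /orP [/mapP [y /n1 [? ?] ->]|/n2 //].
  by split=> //; apply: nichZ.
elim: w => [|j w [L dL nL]] /=.
  exists [:: (vac D, vac D)] => [w u|x]; last first.
    by rewrite inE => /eqP -> /=; split; apply: (nich_lword [::]).
  rewrite big_seq1 /=; case: w => [|? ?] /=; first by rewrite {3}/vac eqxx; apply/esym/mulr1.
  by rewrite {3}/vac scaler0.
exists ([seq (lmul j x.1, x.2) | x <- L] ++ [seq (yact (dg j) x.1, lmul j x.2) | x <- L]).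
  exact: decomp_lmul.
move=> x; rewrite mem_cat => /orP [] /mapP [y /nL [? ?] ->] /=; split=> //.
- exact: nich_lmul.
- exact: nich_yact.
- exact: nich_lmul.
Qed.

End NicholsModel.

(** * The component of bidegree (2, 1) *)

Section PerfectAction.
Variables (gT : finGroupType) (O : {set gT}).
Hypothesis OJ : forall x g, x \in O -> (x ^ g)%g \in O.

(** Extended by the identity outside [O], so as to be a permutation of the whole finite type, with a
    sign. *)
Definition conj_on (g x : gT) : gT := if x \in O then (x ^ g)%g else x.

Lemma conj_on_inj g : injective (conj_on g).
Proof.
move=> x y; rewrite /conj_on; case: ifP => xO; case: ifP => yO //.
- exact: conjg_inj.
- by move=> e; rewrite -e OJ in yO.
- by move=> e; rewrite e OJ in xO.
Qed.

Definition conj_perm g : {perm gT} := perm (@conj_on_inj g).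

Lemma conj_permM : {morph conj_perm : g h / (g * h)%g}.
Proof.
move=> g h; apply/permP => x; rewrite permM !permE /conj_on.
by case: ifP => xO; rewrite ?OJ ?conjgM // xO.
Qed.

(** The elements acting evenly form a subgroup that contains every commutator, and commutators
    generate a perfect group. *)
Lemma perfect_conj_even g : [set: gT]^`(1)%g = [set: gT] -> ~~ odd_perm (conj_perm g).
Proof.
move=> perf.
have c1 : conj_perm 1%g = 1%g.
  by apply: (mulgI (conj_perm 1%g)); rewrite -conj_permM !mulg1.
have cV x : conj_perm x^-1%g = (conj_perm x)^-1%g.
  by apply: (mulgI (conj_perm x)); rewrite -conj_permM !mulgV.
have gs : group_set [set x | ~~ odd_perm (conj_perm x)].
  apply/group_setP; split=> [|x y]; rewrite !inE ?c1 ?odd_perm1 // conj_permM odd_permM.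
  by move=> /negPf -> /negPf ->.
suff : [set: gT]^`(1)%g \subset Group gs by rewrite perf => /subsetP /(_ g); rewrite !inE; apply.
rewrite derg1 gen_subG; apply/subsetP => _ /imset2P [x y _ _ ->].
rewrite inE /= commgEl conjgE !conj_permM !cV !odd_permM !odd_permV.
by case: odd_perm; case: odd_perm.
Qed.

(** Under these hypotheses [g] would act on [O] as the transposition of [a] and [b], which is
    odd. *)
Lemma perfect_no_transposition g a b : [set: gT]^`(1)%g = [set: gT] ->
  a \in O -> b \in O -> a != b ->
  (a ^ g = b)%g -> (forall x, x \in O -> x != a -> x != b -> x ^ g = x)%g -> False.
Proof.
move=> perf aO bO ab gab gfix.
suff e : conj_perm g = tperm a b.
  by have := perfect_conj_even g perf; rewrite e odd_tperm ab.
(* The image of [b] is not [b], which is already the image of [a]; if it were a third point of [O],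
   it would be fixed by [g], and injectivity would make it equal to [b]. *)
have gba : (b ^ g = a)%g.
  apply/eqP; apply: contraT => ba; have bgb : (b ^ g != b)%g.
    by apply: contra ab => /eqP e; apply/eqP/(conjg_inj g); rewrite gab e.
  have := gfix _ (OJ g bO) ba bgb => /conjg_inj bb.
  by rewrite bb eqxx in bgb.
apply/permP => x; rewrite permE /conj_on.
case: tpermP => [->|->|/eqP xa /eqP xb]; rewrite ?aO ?bO //.
by case: ifP => // xO; apply: gfix.
Qed.

End PerfectAction.

Lemma simple_perfect (gT : finGroupType) : simple [set: gT] -> ~~ abelian [set: gT] ->
  [set: gT]^`(1)%g = [set: gT].
Proof.
move=> /simpleP [_ sG] nab; have [d1|//] := sG _ (der_normal 1 [set: gT]).
by case/negP: nab; apply/derG1P.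
Qed.

(** The subgroup generated by [O] is normal and nontrivial, hence everything. So [t] is central, and
    a nonabelian simple group has trivial centre. *)
Lemma simple_cent_closed (gT : finGroupType) (O : {set gT}) (t : gT) :
  simple [set: gT] -> ~~ abelian [set: gT] -> (forall x g, x \in O -> (x ^ g)%g \in O) ->
  (exists2 x, x \in O & x != 1%g) -> (forall x, x \in O -> commute x t) -> t = 1%g.
Proof.
move=> /simpleP [_ sG] nab OJ [x xO x1] cOt.
have nO : (<<O>> <| [set: gT])%g.
  rewrite /normal subsetT; apply/subsetP => g _; rewrite inE -genJ genS //.
  by apply/subsetP => _ /imsetP [y yO ->]; apply: OJ.
have [O1|OT] := sG _ nO.
  have : x \in <<O>>%g by rewrite mem_gen.
  by rewrite O1 inE (negPf x1).
have tZ : t \in 'Z([set: gT])%g.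
  rewrite inE in_setT -OT cent_gen; apply/centP => y yO; apply/commute_sym/cOt.
  exact: yO.
have [Z1|ZT] := sG _ (center_normal [set: gT]).
  by rewrite Z1 inE in tZ; apply/eqP.
by case/negP: nab; rewrite -ZT center_abelian.
Qed.

Section QuotientDegreeTwo.
Variables (k : fieldType) (gT : finGroupType) (D : ydd k gT).
Local Notation I := (ix D).
Local Notation F := (seq I -> k^o).
Implicit Types (phi psi : F) (i j l v : I) (g h : gT).

Definition Vimage m n : set F :=
  lspan [set psi | exists v phi, [/\ sd v, nich_hom m n phi & psi = lmul v phi]]%classic.

(* Sends a functional vanishing on the multiples of V to another one (twist_killsV);
   a product is tested against V B_(1,1) by twisting evaluation at a letter of W. *)
Definition twist (la : F -> k^o) i : F -> k^o :=
  fun psi => la (shl i psi) - la (yact (dg i)^-1 (shr [:: i] psi)).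

Lemma twist_linear la i : linear la -> linear (twist la i).
Proof.
move=> la_lin a phi psi; rewrite /twist (shl_linear i) (shr_linear [:: i]).
by rewrite yact_linear !la_lin scalerBr opprD addrACA.
Qed.

Definition killsV (la : F -> k^o) := forall v phi, sd v -> la (lmul v phi) = 0.

Lemma killsV_sum la (f : I -> F) (c : I -> k) (s : I) : linear la -> killsV la ->
  sd s -> (forall l, c l != 0 -> sd l = sd s) ->
  la (\sum_l c l *: lmul l (f l)) = 0.
Proof.
move=> la_lin kla ss cs; rewrite (linearf_sum la_lin) big1 // => l _.
have [->|/cs ls] := eqVneq (c l) 0; first by rewrite scale0r (linearf0 la_lin).
by rewrite (linearfZ la_lin) kla ?scaler0 // ls.
Qed.

(** On a product [lmul v phi] both terms of the twist contribute [la phi] when [i] is [v], and these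
    cancel; all other terms are multiples of V. *)
Lemma twist_killsV la i : linear la -> killsV la -> sd i -> killsV (twist la i).
Proof.
move=> la_lin kla si v phi sv; rewrite /twist shl_lmul shr_lmul yactD yactZ yact_lmul.
rewrite !(linearfD la_lin) [X in _ - (X + _)](killsV_sum _ la_lin kla sv); last first.
  by move=> l /rh_sd.
rewrite add0r.
rewrite (linearf_sum la_lin) big1 ?add0r; last first.
  move=> l _; have [->|/rh_sd sl] := eqVneq (rh (dg v) i l) 0.
    by rewrite scale0r (linearf0 la_lin).
  by rewrite (linearfZ la_lin) kla ?scaler0 // -?sl.
by case: eqP => [->|_]; rewrite ?yactK ?scale0r ?addr0 ?subrr.
Qed.

Lemma twist_lmul la i j phi : linear la -> i != j ->
  twist la i (lmul j phi) = \sum_l rh (dg j) i l *: la (lmul j (shl l phi)) -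
    \sum_l rh (dg i)^-1 l j *: la (lmul l (yact (dg i)^-1 (shr [:: i] phi))).
Proof.
move=> la_lin /negPf ij; rewrite /twist shl_lmul shr_lmul ij !scale0r add0r addr0.
rewrite yact_lmul !(linearf_sum la_lin); congr (_ - _).
  by apply: eq_bigr => l _; rewrite (linearfZ la_lin).
by apply: eq_bigr => l _; rewrite (linearfZ la_lin).
Qed.

Lemma rh_ex h i : exists l, rh h l i != 0 :> k.
Proof.
have : rh 1%g i i != 0 :> k by rewrite rh1 eqxx oner_eq0.
rewrite -(mulVg h) rhM => /sum_neq0 [l nz]; exists l.
by apply: contraNneq nz => ->; rewrite mulr0.
Qed.

Lemma shr_vac i : shr [:: i] (vac D) = 0.
Proof. by apply/funext => -[]. Qed.

Lemma shl_letter i m : shl i (lmul m (vac D)) = (i == m)%:R *: vac D.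
Proof. by rewrite shl_lmul big1 ?addr0 // => l _; rewrite shl_vac lmul0 scaler0. Qed.

Lemma shr_letter i m : shr [:: i] (lmul m (vac D)) = (i == m)%:R *: vac D.
Proof. by rewrite shr_lmul shr_vac lmul0 add0r yact_vac. Qed.

(** A doubly twisted functional that kills multiples of V must vanish on the product of [j], [n] and
    [m]. The letters [i] and [i'] occur in the images of [m] and [n] under [dg j], so that its value
    is a product of two nonzero matrix entries, unless the degrees of [n] and [m] are related as
    stated. *)
Lemma quotient_two :
  (forall psi, nich_hom 2 1 psi -> Vimage 1 1 psi) ->
  forall j n m : D, ~~ sd j -> sd n -> sd m ->
  ~ commute (dg n) (dg j) -> ~ commute (dg m) (dg j) ->
  dg m = dg n \/ dg m = (dg j * dg n * (dg j)^-1)%g.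
Proof.
move=> all_V j n m nsj sn sm ncn ncm.
have [i' ri'] := rh_ex (dg j) n; have [i ri] := rh_ex (dg j) m.
have si' : sd i' by rewrite (rh_sd ri').
have si : sd i by rewrite (rh_sd ri).
have sneq l : sd l -> l != j by apply: contraTneq => ->.
have di' := rh_dg ri'; have di := rh_dg ri.
(* Evaluation at a letter of W vanishes on multiples of V, and so do its twists by [i] and then
   [i']. *)
pose la0 (phi : F) : k^o := phi [:: j].
have la0_lin : linear la0 by [].
have k0 : killsV la0.
  move=> v phi sv; rewrite /la0 -[LHS]/(shl j (lmul v phi) [::]) shl_lmul evalD evalZ.
  rewrite eq_sym (negPf (sneq _ sv)) scale0r add0r eval_sum big1 // => l _.
  by rewrite evalZ lmul_nil scaler0.
have la1_lin := twist_linear i la0_lin.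
have k1 := twist_killsV la0_lin k0 si.
have k2 := twist_killsV la1_lin k1 si'.
have la2_lin := twist_linear i' la1_lin.
pose psi := lword [:: j; n; m].
have : twist (twist la0 i) i' psi = 0.
  have : Vimage 1 1 psi.
    apply: all_V; have := nich_hom_lword [:: j; n; m].
    by rewrite /nV /nW /= (negPf nsj) sn sm.
  move: psi; apply: lspan_min.
    split=> [|a x y x0 y0]; first exact: linearf0.
    by rewrite la2_lin x0 y0 scaler0 addr0.
  by move=> _ [v [phi [sv _ ->]]]; apply: k2.
rewrite twist_lmul //; last exact: sneq.
have [->|nm] := eqVneq (dg m) (dg n); first by left.
have i'n : i' != n.
  apply/eqP => e; apply: ncn; rewrite e in di'.
  by rewrite /commute {1}di' mulgKV.
have [i'm|i'm] := eqVneq i' m; first by move=> _; right; rewrite -di' i'm.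
(* The right derivative by [i'] of the product of [n] and [m] is 0, since [i'] differs from both. *)
rewrite [X in _ - X]big1 ?subr0; last first.
  move=> l _; rewrite shr_lmul shr_letter (negPf i'm) (negPf i'n) !scale0r lmul0 addr0.
  by rewrite yact0 lmul0 (linearf0 la1_lin) scaler0.
have im : i != m.
  apply/eqP => e; apply: ncm; rewrite e in di.
  by rewrite /commute {1}di mulgKV.
have la1E p : sd p -> twist la0 i (lmul j (lmul p (vac D))) =
   rh (dg j) i p - rh (dg i)^-1 j j * (i == p)%:R.
  move=> sp; rewrite twist_lmul ?sneq //; congr (_ - _).
    rewrite (bigD1 p) // shl_letter eqxx scale1r big1.
      apply: etrans (addr0 _) _; rewrite /la0 -[lmul j _ _]/(shl j (lmul j (vac D)) [::]) shl_letter eqxx.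
      by rewrite scale1r /vac eqxx; apply: mulr1.
    by move=> l; rewrite andTb => /negPf lp; rewrite shl_letter lp scale0r lmul0 (linearf0 la0_lin) scaler0.
  rewrite (bigD1 j) // shr_letter yactZ yact_vac lmulZ (linearfZ la0_lin).
  rewrite /la0 -[lmul j _ _]/(shl j (lmul j (vac D)) [::]) shl_letter eqxx scale1r.
  rewrite big1.
    by apply: etrans (addr0 _) _; rewrite /vac eqxx; congr (_ * _); apply: mulr1.
  move=> l; rewrite andTb => lj; rewrite lmulZ evalZ -[lmul l _ _]/(shl j (lmul l (vac D)) [::]) shl_letter [j == l]eq_sym (negPf lj).
  by rewrite scale0r !scaler0.
(* Both terms of [la1E] vanish at [n]: the conjugates of [dg m] and [dg n] by [dg j] differ, and if
   [i] is [n], the diagonal entry at [j] is 0 because [dg n] and [dg j] do not commute. *)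
have z0 : twist la0 i (lmul j (lmul n (vac D))) = 0.
  rewrite la1E // [rh (dg j) i n](_ : _ = 0); last first.
    apply/eqP/negPn/negP => /rh_dg e; rewrite e in di.
    by case/eqP: nm; apply: (mulgI (dg j)); apply: (mulIg (dg j)^-1%g); rewrite -di.
  case: eqP => [e|_]; last by rewrite mulr0 subrr.
  rewrite mulr1 sub0r; apply/eqP; rewrite oppr_eq0; apply/negPn/negP => /rh_dg.
  rewrite invgK => ej; apply: ncn; rewrite -e /commute {1}ej.
  by rewrite !mulgA mulgV mul1g.
have shE l : twist la0 i (lmul j (shl l (lmul n (lmul m (vac D))))) =
    (l == n)%:R *: twist la0 i (lmul j (lmul m (vac D))).
  rewrite shl_lmul lmulD lmulZ (linearfD la1_lin) (linearfZ la1_lin) lmul_sum.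
  rewrite (linearf_sum la1_lin) big1 ?addr0 // => p _.
  rewrite lmulZ shl_letter !lmulZ !(linearfZ la1_lin).
  by rewrite z0 !scaler0.
under eq_bigr => l _ do rewrite shE.
rewrite sum_delta'.
rewrite la1E // (negPf im) mulr0 subr0 => /eqP; rewrite mulf_eq0.
by rewrite (negPf ri) (negPf ri').
Qed.

End QuotientDegreeTwo.

(** Otherwise [quotient_two] leaves only two degrees of V that are moved by conjugation with [dg j],
    namely [dg n] and its image, so this conjugation would be a transposition of the degrees of
    V. *)
Lemma simple_quotient_two (k : fieldType) (gT : finGroupType) (D : ydd k gT) :
  simple [set: gT] -> ~~ abelian [set: gT] ->
  (exists i : D, sd i) -> (exists j : D, ~~ sd j) -> (forall i : D, dg i != 1%g) ->
  exists psi, nich_hom 2 1 psi /\ ~ @Vimage k gT D 1 1 psi.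
Proof.
move=> sG nab [i0 si0] [j nsj] d1.
apply: contrapT => /forallNP nex.
have all_V psi : nich_hom 2 1 psi -> @Vimage k gT D 1 1 psi.
  by move=> hp; apply: contrapT => nV; apply: (nex psi).
have qt := quotient_two all_V.
pose O := [set dg i | i : D & sd i]%SET.
have OJ x g : x \in O -> (x ^ g)%g \in O.
  case/imsetP => i; rewrite inE => si ->.
  have [l rl] := rh_ex g^-1 i; apply/imsetP; exists l; first by rewrite inE (rh_sd rl).
  by rewrite (rh_dg rl) invgK conjgE mulgA.
have O1 : exists2 x, x \in O & x != 1%g.
  by exists (dg i0) => //; apply/imsetP; exists i0; rewrite ?inE.
(* If [dg j] commuted with all degrees of V, it would be 1. *)
have [n [sn ncn]] : exists n : D, sd n /\ ~ commute (dg n) (dg j).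
  apply: contrapT => /forallNP nc; move/eqP: (d1 j); apply.
  apply: (simple_cent_closed sG nab OJ O1) => _ /imsetP [i + ->]; rewrite inE => si.
  by apply: contrapT => nci; apply: (nc i).
apply: (@perfect_no_transposition _ O OJ (dg j)^-1 (dg n) (dg n ^ (dg j)^-1)%g).
- exact: simple_perfect.
- by apply/imsetP; exists n; rewrite ?inE.
- by apply: OJ; apply/imsetP; exists n; rewrite ?inE.
- apply/eqP => e; apply: ncn; rewrite /commute {1}e conjgE invgK.
  by rewrite !mulgA mulgKV.
- by [].
move=> _ /imsetP [m + ->]; rewrite inE => sm mn mn'.
apply/eqP; apply: contraNeq mn' => nc.
have ncm : ~ commute (dg m) (dg j).
  by move=> c; case/eqP: nc; rewrite conjgE invgK mulgA -c mulgK eqxx.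
have [e|->] := qt j n m nsj sn sm ncn ncm; first by rewrite e eqxx in mn.
by rewrite conjgE invgK mulgA.
Qed.

(** * Lower bounds for the dimension *)

Section Lengths.
Variables (k : fieldType) (gT : finGroupType) (D : ydd k gT).
Local Notation I := (ix D).
Local Notation F := (seq I -> k^o).
Implicit Types (phi psi : F) (w u : seq I) (i j l : I) (g h : gT).

Definition indep n (S : set F) := has_indep [set (0 : F)]%classic S n.

Lemma size_nVW w : (nV w + nW w)%N = size w.
Proof. exact: count_predC. Qed.

Lemma nich_shls u phi : nich phi -> nich (fun w => phi (u ++ w)).
Proof.
elim: u phi => [//|i u IH] phi nphi.
by apply: (IH (shl i phi)); apply: nich_shl.
Qed.

(** For a word [w] in the support of [phi], the derivatives of [phi] along the prefixes of [w] are
    homogeneous of distinct lengths 0, ..., m + n, and each is nonzero at the corresponding suffix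
    of [w]. *)
Lemma nich_hom_indep m n phi : nich_hom m n phi -> phi <> 0 -> indep (m + n).+1 (@nich k gT D).
Proof.
move=> [nphi hphi] phi0; have [w phiw] : exists w, phi w != 0.
  apply: contrapT => /forallNP nw; apply: phi0; apply/funext => w.
  by apply/eqP; apply: contrapT => /negP; apply: nw.
have sz v : phi v != 0 -> size v = (m + n)%N.
  by move=> /hphi []; rewrite !addn0 -size_nVW => -> ->.
exists (fun i : 'I_(m + n).+1 => (fun v => phi (take i w ++ v)) : F).
split=> [i|c c0 i]; first exact: nich_shls.
have := congr1 (fun f : F => f (drop i w)) c0; rewrite /= eval_sum (bigD1 i) //= big1.
  rewrite addr0 evalZ cat_take_drop => /eqP; rewrite mulf_eq0 (negPf phiw) orbF.
  by move=> /eqP.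
move=> j ji; rewrite evalZ; apply/eqP; rewrite mulf_eq0; apply/orP; right.
apply: contraNT ji => /sz; rewrite size_cat size_take size_drop (sz _ phiw).
move=> e; apply/eqP/val_inj => /=; move: e (ltn_ord i) (ltn_ord j).
by case: ifP => /=; lia.
Qed.

(** A letter of degree 1 braids trivially with itself, so its powers differentiate as in a
    polynomial ring: the derivative of the power n + 1 is n + 1 times the power n. In characteristic
    0 no power vanishes. *)
Lemma central_indep i N : [pchar k] =i pred0 -> dg i = 1%g -> indep N (@nich k gT D).
Proof.
move=> k0 di.
pose x n : F := lword (nseq n i).
have shx n : shl i (x n.+1) = n.+1%:R *: x n.
  elim: n => [|n IH]; rewrite /x /= shl_lmul di sum_rh1 eqxx scale1r.
    by rewrite shl_vac lmul0 addr0 ?scale1r.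
  by rewrite -/(x n.+1) IH lmulZ -[lmul i _]/(x n.+1) [n.+2%:R]mulrS scalerDl scale1r.
have x0 n : x n (nseq n i) != 0.
  elim: n => [|n IH]; first by rewrite /x /= /vac eqxx oner_eq0.
  rewrite -[x _ _]/(shl i (x n.+1) (nseq n i)) shx evalZ mulf_neq0 //.
  by move/pcharf0P: k0 => /(_ n.+1) ->.
have := nich_hom_indep (nich_hom_lword (nseq N i)).
rewrite size_nVW size_nseq => /(_ _)/has_indep_le.
move=> H; apply: H => //; first exact: subspace_set0.
by move=> e; have := x0 N; rewrite /x e eqxx.
Qed.

End Lengths.

(** * Iterated braided commutators of V with W *)

Section Adjoint.
Variables (k : fieldType) (gT : finGroupType) (D : ydd k gT).
Local Notation I := (ix D).
Local Notation F := (seq I -> k^o).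
Implicit Types (phi psi : F) (w u : seq I) (i j l v : I) (g h e : gT).

(** The degree of the translate by [h] of the basis vector [j]; [cmul h j] is left multiplication by
    that translate. Using translates rather than single letters makes the family [ad_op] stable
    under G. *)
Definition cdg h j : gT := (h * dg j * h^-1)%g.

Definition cjop h (Z : F -> F) : F -> F := fun phi => yact h (Z (yact h^-1 phi)).

Definition cmul h j : F -> F := cjop h (lmul j).

(* Left multiplications by the iterated braided commutators
   ad(v_1)...ad(v_m)(w) with v_1, ..., v_m in V and w in W. *)
Inductive ad_op : nat -> gT -> (F -> F) -> Prop :=
  | AdOp0 h j : ~~ sd j -> ad_op 0 (cdg h j) (cmul h j)
  | AdOpS m g Z h v : sd v -> ad_op m g Z ->
      ad_op m.+1 (cdg h v * g)%g
        (fun phi => cmul h v (Z phi) - cjop (cdg h v) Z (cmul h v phi)).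

Lemma cjop_linear h Z : linear Z -> linear (cjop h Z).
Proof. by move=> Zl a x y; rewrite /cjop yact_linear Zl yact_linear. Qed.

Lemma cmul_linear h j : linear (cmul h j).
Proof. exact/cjop_linear/lmul_linear. Qed.

Lemma cmulE h j phi : cmul h j phi = \sum_l rh h l j *: lmul l phi.
Proof.
by rewrite /cmul /cjop yact_lmul; apply: eq_bigr => l _; rewrite yactVK.
Qed.

Lemma cjopM g h Z : cjop g (cjop h Z) = cjop (g * h)%g Z.
Proof. by apply/funext => phi; rewrite /cjop invMg !yactM. Qed.

Lemma cjop_cmul g h j : cjop g (cmul h j) = cmul (g * h)%g j.
Proof. exact: cjopM. Qed.

Lemma cdgM g h j : (g * cdg h j * g^-1)%g = cdg (g * h)%g j.
Proof. by rewrite /cdg invMg !mulgA. Qed.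

Lemma cmul1 j : cmul 1%g j = lmul j.
Proof. by apply/funext => phi; rewrite /cmul /cjop invg1 !yact1. Qed.

Lemma ad_op_linear m g Z : ad_op m g Z -> linear Z.
Proof.
elim=> {m g Z} [h j _|m g Z h v sv _ IH]; first exact: cmul_linear.
move=> a x y; rewrite IH !cmul_linear (cjop_linear _ IH) scalerBr opprD addrACA //.
Qed.

Lemma ad_op_cj m g Z e : ad_op m g Z -> ad_op m (e * g * e^-1)%g (cjop e Z).
Proof.
elim=> {m g Z} [h j nsj|m g Z h v sv _ IH].
  by rewrite cdgM cjop_cmul; apply: AdOp0.
have -> : (e * (cdg h v * g) * e^-1)%g = (cdg (e * h) v * (e * g * e^-1))%g.
  by rewrite -cdgM !mulgA mulgKV.
have -> : cjop e (fun phi => cmul h v (Z phi) - cjop (cdg h v) Z (cmul h v phi)) =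
  (fun phi => cmul (e * h)%g v (cjop e Z phi) -
     cjop (cdg (e * h)%g v) (cjop e Z) (cmul (e * h)%g v phi)); last exact: AdOpS.
apply/funext => phi; rewrite /cjop yactB; congr (_ - _).
  by rewrite -cjop_cmul /cjop yactK.
by rewrite -cdgM -cjop_cmul /cjop !invMg !yactM !invgK !yactK.
Qed.

Lemma nich_hom_cmul a b h j phi : nich_hom a b phi ->
  nich_hom (sd j + a) (~~ sd j + b) (cmul h j phi).
Proof. by move=> np; apply: nich_hom_yact; apply: nich_hom_lmul; apply: nich_hom_yact. Qed.

Lemma nich_hom_ad m g Z a b phi : ad_op m g Z -> nich_hom a b phi ->
  nich_hom (m + a) b.+1 (Z phi).
Proof.
move=> op; elim: op a b phi => {m g Z} [h j nsj|m g Z h v sv _ IH] a b phi np.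
  by have := nich_hom_cmul h j np; rewrite (negPf nsj).
have h1 := nich_hom_cmul h v (IH _ _ _ np).
have h2 := nich_hom_yact (cdg h v) (IH _ _ _ (nich_hom_yact (cdg h v)^-1%g (nich_hom_cmul h v np))).
rewrite sv /= add0n !add1n ?addnS in h1 h2.
exact: (subspaceB (nich_hom_subspace D _ _) h1 h2).
Qed.

Lemma nich_cmul h j phi : nich phi -> nich (cmul h j phi).
Proof. by move=> np; apply: nich_yact; apply: nich_lmul; apply: nich_yact. Qed.

Lemma nich_ad m g Z phi : ad_op m g Z -> nich phi -> nich (Z phi).
Proof.
move=> op; elim: op phi => {m g Z} [h j _|m g Z h v _ _ IH] phi np; first exact: nich_cmul.
apply: (subspaceB (nich_subspace D)); first by apply: nich_cmul; apply: IH.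
by apply: nich_yact; apply: IH; apply: nich_yact; apply: nich_cmul.
Qed.

Lemma rmul_yact i g phi : rmul i (yact g phi) = \sum_l rh g^-1 l i *: yact g (rmul l phi).
Proof.
suff H j x : yact g (rmul j x) = \sum_l rh g l j *: rmul l (yact g x).
  under eq_bigr => l _ do rewrite H.
  by rewrite sum_rhM' mulgV sum_rh1'.
apply: (@F_ind_eq _ _ _ (I * F) (fun y => yact g (rmul y.1 y.2))
  (fun y => \sum_l rh g l y.1 *: rmul l (yact g y.2)) _ _ (j, x)).
  move=> y; rewrite yact_nil rmul_nil eval_sum big1 // => l _.
  by rewrite evalZ rmul_nil scaler0.
move=> w IH [{}j {}x] m /=.
have IH' n y : yact g (rmul n y) w = \sum_l rh g l n *: rmul l (yact g y) w.
  by rewrite (IH (n, y)) eval_sum; apply: eq_bigr => l _; rewrite evalZ.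
rewrite -[LHS]/(shl m (yact g (rmul j x)) w) -[RHS]/(shl m (\sum_l _) w).
rewrite shl_yact shl_sum.
under [X in _ = X _]eq_bigr => l _ do rewrite shlZ shl_rmul scalerDr.
rewrite big_split /= sum_delta evalD.
under eq_bigr => l _ do rewrite shl_rmul yactD yactZ scalerDr.
rewrite big_split /= evalD sum_delta'; congr (_ + _).
under eq_bigr => l _ do rewrite yact_sum.
rewrite !eval_sum.
transitivity (\sum_n \sum_l (rh g m n * rh (g * (dg n)^-1)%g l j) *: rmul l (yact g (shl n x)) w).
  apply: eq_bigr => n _; rewrite evalZ eval_sum.
  transitivity (rh g m n *: \sum_q rh (dg n)^-1 q j *: \sum_l rh g l q *: rmul l (yact g (shl n x)) w).
    by congr (_ *: _); apply: eq_bigr => q _; rewrite yactZ evalZ IH'.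
  by rewrite sum_rhM' scaler_sumr; apply: eq_bigr => l _; rewrite scalerA.
transitivity (\sum_n \sum_l (rh g m n * rh ((dg m)^-1 * g)%g l j) *: rmul l (yact g (shl n x)) w).
  apply: eq_bigr => n _; apply: eq_bigr => l _.
  have [->|/rh_dg e] := eqVneq (rh g m n) 0; first by rewrite !mul0r.
  by rewrite e !invMg invgK !mulgA mulgKV.
transitivity ((\sum_l rh g l j *: \sum_q rh (dg m)^-1 q l *: rmul q (shl m (yact g x))) w); last by rewrite eval_sum.
rewrite sum_rhM' eval_sum exchange_big; apply: eq_bigr => l _ /=.
rewrite evalZ shl_yact rmul_sum eval_sum scaler_sumr; apply: eq_bigr => n _.
by rewrite rmulZ evalZ scalerA mulrC.
Qed.

(** The relation of [rmul_lmul]: with respect to right multiplications, [Z] behaves as left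
    multiplication by an element of degree [g]. *)
Definition rcomm g (Z : F -> F) := forall i phi,
  rmul i (Z phi) = \sum_l rh g^-1 l i *: Z (rmul l phi).

Lemma rcomm_cj g e Z : linear Z -> rcomm g Z -> rcomm (e * g * e^-1)%g (cjop e Z).
Proof.
move=> Zl cZ i phi; rewrite /cjop rmul_yact.
under eq_bigr => l _.
  rewrite cZ yact_sum.
  under eq_bigr => m _ do rewrite rmul_yact (linearf_sum Zl) yactZ yact_sum.
  under eq_bigr => m _.
    under eq_bigr => n _ do rewrite (linearfZ Zl) yactZ.
    over.
  rewrite sum_rhM'.
  over.
by rewrite sum_rhM' !invMg !invgK !mulgA.
Qed.

Lemma rcomm_lmul j : rcomm (dg j) (@lmul k gT D j).
Proof. by move=> i phi; apply: rmul_lmul. Qed.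

Lemma rcomm_comp g g' Z Z' : linear Z -> rcomm g Z -> rcomm g' Z' ->
  rcomm (g * g')%g (fun phi => Z (Z' phi)).
Proof.
move=> Zl cZ cZ' i phi; rewrite cZ.
under eq_bigr => l _.
  rewrite cZ' (linearf_sum Zl).
  under eq_bigr => m _ do rewrite (linearfZ Zl).
  over.
by rewrite sum_rhM' invMg.
Qed.

Lemma ad_op_rcomm m g Z : ad_op m g Z -> rcomm g Z.
Proof.
elim=> {m g Z} [h j _|m g Z h v sv op IH].
  exact: (@rcomm_cj (dg j) h (lmul j) (@lmul_linear _ _ _ _) (@rcomm_lmul j)).
have cl := cmul_linear h v; have Zl := ad_op_linear op.
have cc : rcomm (cdg h v) (cmul h v) := @rcomm_cj (dg v) h (lmul v) (@lmul_linear _ _ _ _) (@rcomm_lmul v).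
have c1 := rcomm_comp cl cc IH.
have c2 := rcomm_comp (Z' := cmul h v) (cjop_linear (cdg h v) Zl) (@rcomm_cj g (cdg h v) Z Zl IH) cc.
(* Both orders of the product have the same degree: with e for [cdg h v], the element e g e^-1 times
   e is e g. *)
rewrite mulgKV in c2; move=> i phi.
rewrite (linearfB (@rmul_linear _ _ _ i)) c1 c2 -sumrB.
by apply: eq_bigr => l _; rewrite scalerBr.
Qed.

End Adjoint.

(** Bookkeeping for [ad_op_skew_prim]; [x] and [y] are the two cross terms that cancel. *)
Lemma skew_prim_sum (k : fieldType) (x y a1 a2 a3 a5 a6 b1 b3 b4 b5 : k) : x + y = 0 ->
  a1 + (a2 + a3) + (x + (a5 + a6)) + (b1 + y + (b3 + b4 + b5)) =
  a1 + b1 + (a5 + b4 + (a2 + (b3 + (a3 + a6 + b5)))).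
Proof. by move=> /eqP; rewrite addr_eq0 => /eqP ->; ring. Qed.

Section AdjointCoproduct.
Variables (k : fieldType) (gT : finGroupType) (D : ydd k gT).
Local Notation I := (ix D).
Local Notation F := (seq I -> k^o).
Implicit Types (phi psi : F) (w u : seq I) (i j l v : I) (g h e : gT).
Implicit Types (L : seq (F * F)).

(** The right ideal generated by V, in all bidegrees at once; [Vright_prt] relates it to
    [Vimage]. *)
Definition Vright : set F :=
  lspan [set psi | exists v phi, [/\ sd v, nich phi & psi = lmul v phi]]%classic.

Lemma Vright_subspace : subspace Vright.
Proof. exact: lspan_subspace. Qed.

Lemma Vright_lmul v phi : sd v -> nich phi -> Vright (lmul v phi).
Proof. by move=> sv np; apply: sub_lspan; exists v, phi. Qed.

Lemma Vright_nich psi : Vright psi -> nich psi.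
Proof.
move: psi; apply: lspan_min; first exact: nich_subspace.
by move=> _ [v [phi [_ np ->]]]; apply: nich_lmul.
Qed.

Lemma Vright_cmul h v phi : sd v -> nich phi -> Vright (cmul h v phi).
Proof.
move=> sv np; rewrite cmulE.
apply: (@subspace_sum _ _ Vright) => [|l _]; first exact: Vright_subspace.
have [->|/rh_sd sl] := eqVneq (rh h l v) 0.
  by rewrite scale0r; case: Vright_subspace.
apply: (subspaceZ _ Vright_subspace); apply: Vright_lmul => //.
by rewrite sl.
Qed.

Lemma Vright_yact h psi : Vright psi -> Vright (yact h psi).
Proof.
move: psi; apply: (@lspan_min _ _ _ (yact h @^-1` Vright)%classic).
  exact: subspace_preim (@yact_linear _ _ D h) Vright_subspace.
move=> _ [v [phi [sv np ->]]] /=; have <- : cmul h v (yact h phi) = yact h (lmul v phi).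
  by rewrite /cmul /cjop yactK.
by apply: Vright_cmul => //; apply: nich_yact.
Qed.

Definition lnich L := forall x, x \in L -> nich x.1.
Definition lVright L := forall x, x \in L -> Vright x.1.

Lemma lVright_cat L1 L2 : lVright L1 -> lVright L2 -> lVright (L1 ++ L2).
Proof. by move=> h1 h2 x; rewrite mem_cat => /orP [/h1|/h2]. Qed.

Lemma lVright_map (f f' : F -> F) L : (forall x, x \in L -> Vright (f x.1)) ->
  lVright [seq (f x.1, f' x.2) | x <- L].
Proof. by move=> fL _ /mapP [x /fL ? ->]. Qed.

Lemma lnich_cat L1 L2 : lnich L1 -> lnich L2 -> lnich (L1 ++ L2).
Proof. by move=> h1 h2 x; rewrite mem_cat => /orP [/h1|/h2]. Qed.

Lemma lnich_map (f f' : F -> F) L : (forall phi, nich phi -> nich (f phi)) -> lnich L ->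
  lnich [seq (f x.1, f' x.2) | x <- L].
Proof. by move=> nf nL _ /mapP [x /nL ? ->]; apply: nf. Qed.

(* Modulo [Vright] in the first factor, [Z] is primitive. *)
Definition skew_prim g (Z : F -> F) := forall phi L, decomp phi L -> lnich L ->
  exists2 L', lVright L' & decomp (Z phi)
    ([seq (Z x.1, x.2) | x <- L] ++ [seq (yact g x.1, Z x.2) | x <- L] ++ L').

Lemma skew_prim_cj g e Z : skew_prim g Z -> skew_prim (e * g * e^-1)%g (cjop e Z).
Proof.
move=> pZ phi L dL nL.
have [L' VL' dL'] := pZ _ _ (decomp_yact e^-1 dL) (lnich_map (@nich_yact _ _ _ _) nL).
exists [seq (yact e x.1, yact e x.2) | x <- L'].
  by apply: lVright_map => x /VL'; apply: Vright_yact.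
have := decomp_yact e dL'; rewrite /cjop; congr decomp.
rewrite !map_cat -!map_comp; congr (_ ++ (_ ++ _)).
  by apply: eq_map => x /=; rewrite yactVK.
by apply: eq_map => x /=; rewrite !yactM.
Qed.

Lemma decomp_cmul h j phi L : decomp phi L -> decomp (cmul h j phi)
  ([seq (cmul h j x.1, x.2) | x <- L] ++ [seq (yact (cdg h j) x.1, cmul h j x.2) | x <- L]).
Proof.
move=> dL; have := decomp_yact h (decomp_lmul j (decomp_yact h^-1 dL)).
rewrite /cmul /cjop; congr decomp.
rewrite !map_cat -!map_comp; congr (_ ++ _).
  by apply: eq_map => x /=; rewrite yactVK.
by apply: eq_map => x /=; rewrite !yactM.
Qed.

Lemma decompB phi psi L L' : decomp phi L -> decomp psi L' ->
  decomp (phi - psi) (L ++ [seq (x.1, - x.2) | x <- L']).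
Proof.
move=> d d' w u; rewrite big_cat big_map evalB d d' -sumrN; congr (_ + _).
by apply: eq_bigr => x _; rewrite -scaleNr.
Qed.

(** In the coproduct of a braided commutator of [v] and [Z], the terms with [Z] on the left and [v]
    on the right cancel. Those with [v] on the left and [Z] on the right ([A3], [B3]) have their
    first factor in V B, and so do the terms coming from the remainders of the induction hypothesis
    ([A6], [B6]). *)
Lemma ad_op_skew_prim m g Z : ad_op m g Z -> skew_prim g Z.
Proof.
elim=> {m g Z} [h j _ phi L dL _|m g Z h v sv op pZ].
  by exists [::] => //; rewrite cats0; apply: decomp_cmul.
move=> phi L dL nL; set c := cmul h v; set e := cdg h v.
have Zl := ad_op_linear op.
have [L1 V1 d1] := pZ _ _ dL nL.
have dA := decomp_cmul h v d1.
have nc : lnich ([seq (c x.1, x.2) | x <- L] ++ [seq (yact e x.1, c x.2) | x <- L]).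
  apply: lnich_cat; last exact: lnich_map (@nich_yact _ _ _ _) nL.
  exact: (lnich_map (f' := id) (@nich_cmul _ _ _ _ _) nL).
have [L2 V2 dB] := skew_prim_cj e pZ (decomp_cmul h v dL) nc.
have dAB := decompB dA dB.
set A3 := [seq (c (yact g x.1), Z x.2) | x <- L].
set B3 := [seq (yact (e * g * e^-1)%g (c x.1), - cjop e Z x.2) | x <- L].
set A6 := [seq (c x.1, x.2) | x <- L1] ++ [seq (yact e x.1, c x.2) | x <- L1].
set B6 := [seq (x.1, - x.2) | x <- L2].
exists (A3 ++ B3 ++ A6 ++ B6).
  apply: lVright_cat.
    apply: (@lVright_map (fun y => c (yact g y)) Z) => x /nL nx.
    by apply: Vright_cmul => //; apply: nich_yact.
  apply: lVright_cat.
    apply: (@lVright_map (fun y => yact _ (c y)) (fun y => - cjop e Z y)) => x /nL nx.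
    by apply: Vright_yact; apply: Vright_cmul.
  apply: lVright_cat; last first.
    by move=> _ /mapP [x /V2 ? ->].
  apply: lVright_cat.
    by apply: (@lVright_map c id) => x /V1 /Vright_nich; apply: Vright_cmul.
  by apply: lVright_map => x /V1; apply: Vright_yact.
move=> w u; rewrite (dAB w u) /A3 /B3 /A6 /B6 !(map_cat, big_cat, big_map) /=.
have R1 : \sum_(x <- L) (x.2 u : k) *: (c (Z x.1) - cjop e Z (c x.1)) w =
    \sum_(x <- L) (x.2 u : k) *: c (Z x.1) w +
    \sum_(x <- L) ((- x.2) u : k) *: cjop e Z (c x.1) w.
  by rewrite -big_split; apply: eq_bigr => x _ /=; rewrite evalB scalerBr -scaleNr.
have R2 : \sum_(x <- L) ((c (Z x.2) - cjop e Z (c x.2)) u : k) *: yact (e * g)%g x.1 w =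
    \sum_(x <- L) (c (Z x.2) u : k) *: yact e (yact g x.1) w +
    \sum_(x <- L) ((- cjop e Z (c x.2)) u : k) *: yact (e * g * e^-1)%g (yact e x.1) w.
  rewrite -big_split; apply: eq_bigr => x _ /=.
  by rewrite -!yactM mulgKV -scalerDl.
have R3 : \sum_(x <- L) (c x.2 u : k) *: yact e (Z x.1) w +
    \sum_(x <- L) ((- c x.2) u : k) *: cjop e Z (yact e x.1) w = 0.
  rewrite -big_split big1 //= => x _.
  by rewrite /cjop yactK -scalerDl; rewrite -evalD subrr scale0r.
rewrite R1 R2; move: R3.
do ?[move: (\sum_(x <- _) _) => ?].
exact: skew_prim_sum.
Qed.

End AdjointCoproduct.

(** * The grading by G, and generators of B_(m+1,1) modulo V B_(m,1) *)

Section GroupDegree.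
Variables (k : fieldType) (gT : finGroupType) (D : ydd k gT).
Local Notation I := (ix D).
Local Notation F := (seq I -> k^o).
Implicit Types (phi psi : F) (w u : seq I) (i j l v : I) (g h e a c : gT).

Definition gdeg w : gT := foldr (fun i g => (dg i * g)%g) 1%g w.

(** The factor [c] accounts for the degrees of letters already removed from the front of the words,
    for inductions on words. *)
Definition ghom_off c a phi := forall w, phi w != 0 -> (c * gdeg w)%g = a.
Definition ghom a phi := forall w, phi w != 0 -> gdeg w = a.

Lemma ghom_off_shl c a l phi : ghom_off c a phi -> ghom_off (c * dg l)%g a (shl l phi).
Proof. by move=> hp w /hp <-; rewrite /= mulgA. Qed.

Lemma ghom_off1 a phi : ghom a phi <-> ghom_off 1%g a phi.
Proof. by split=> hp w /hp; rewrite mul1g. Qed.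

Lemma ghom_off_lmul c a j phi : ghom_off c a phi -> ghom_off (c * (dg j)^-1)%g a (lmul j phi).
Proof.
move=> hp w; elim: w c phi hp => [|i w IH] c phi hp; first by rewrite eqxx.
rewrite -[lmul j phi _]/(shl i (lmul j phi) w) shl_lmul evalD eval_sum => nz.
have [/andP [/eqP -> pw]|] := boolP ((i == j) && (phi w != 0)).
  by rewrite /= !mulgA mulgKV; apply: hp.
rewrite negb_and => ijp.
have e0 : ((i == j)%:R *: phi) w = 0.
  rewrite evalZ; case/orP: ijp => [/negPf ->|]; first by rewrite scale0r.
  by rewrite negbK => /eqP ->; rewrite scaler0.
move: nz; rewrite e0 add0r => /sum_neq0 [l].
rewrite evalZ => nz; have rl : rh (dg j) i l != 0.
  by apply: contraNneq nz => ->; rewrite scale0r.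
have : lmul j (shl l phi) w != 0 by apply: contraNneq nz => ->; rewrite scaler0.
move=> /(IH _ _ (ghom_off_shl (l := l) hp)) <-.
by rewrite /= (rh_dg rl) !mulgA mulgKV.
Qed.

Lemma ghom_lmul a j phi : ghom a phi -> ghom (dg j * a)%g (lmul j phi).
Proof.
move=> /ghom_off1 /(ghom_off_lmul (j := j)) hp w /hp <-.
by rewrite mul1g mulKVg.
Qed.

Lemma ghom_yact a h phi : ghom a phi -> ghom (h * a * h^-1)%g (yact h phi).
Proof.
move=> /ghom_off1 hp.
suff H c psi w : ghom_off c a psi -> yact h psi w != 0 -> (c * h^-1 * gdeg w * h)%g = a.
  by move=> w /(H _ _ _ hp) <-; rewrite mul1g !mulgA mulgV mul1g mulgK.
elim: w c psi {hp} => [|i w IH] c psi hp.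
  by move=> /hp <-; rewrite /= !mulg1 mulgKV.
rewrite -[yact h psi _]/(shl i (yact h psi) w) shl_yact eval_sum => /sum_neq0 [l].
rewrite evalZ => nz; have rl : rh h i l != 0.
  by apply: contraNneq nz => ->; rewrite scale0r.
have : yact h (shl l psi) w != 0 by apply: contraNneq nz => ->; rewrite scaler0.
move=> /(IH _ _ (ghom_off_shl (l := l) hp)) <-.
by rewrite /= (rh_dg rl) !mulgA mulgKV.
Qed.

Lemma ghom_subspace a : subspace [set phi | ghom a phi]%classic.
Proof.
split=> [w|b phi psi hp hq w]; first by rewrite eqxx.
rewrite evalZD; have [->|/hp //] := eqVneq (phi w) 0.
by rewrite scaler0 add0r => /hq.
Qed.

Lemma ghom_cmul a h j phi : ghom a phi -> ghom (cdg h j * a)%g (cmul h j phi).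
Proof.
move=> /(ghom_yact (h := h^-1)) /(ghom_lmul (j := j)) /(ghom_yact (h := h)).
by rewrite /cdg invgK !mulgA mulgK.
Qed.

Lemma ghom_ad m g Z a phi : ad_op m g Z -> ghom a phi -> ghom (g * a)%g (Z phi).
Proof.
move=> op; elim: op a phi => {m g Z} [h j _|m g Z h v _ _ IH] a phi hp.
  exact: ghom_cmul.
have h1 := ghom_cmul (h := h) (j := v) (IH _ _ hp).
have h2 := ghom_yact (h := cdg h v) (IH _ _ (ghom_yact (h := (cdg h v)^-1) (ghom_cmul (h := h) (j := v) hp))).
move: (cdg h v) h1 h2 => E h1 h2.
rewrite invgK mulKg !mulgA mulgK in h2; rewrite mulgA in h1.
exact: (subspaceB (ghom_subspace _) h1 h2).
Qed.

Lemma ghom_vac : ghom 1%g (vac D).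
Proof. by case=> // i w; rewrite eqxx. Qed.

Lemma ghom_lword w : ghom (gdeg w) (lword w).
Proof. by elim: w => [|j w IH]; [apply: ghom_vac|apply: ghom_lmul]. Qed.

Definition pg a phi : F := fun w => (gdeg w == a)%:R *: phi w.

Lemma pg_linear a : linear (pg a).
Proof.
move=> b phi psi; apply/funext => w.
by rewrite /pg !evalZD !scalerDr !scalerA mulrC.
Qed.

Lemma pg_ghom a b phi : ghom a phi -> pg b phi = (a == b)%:R *: phi.
Proof.
move=> hp; apply/funext => w; rewrite /pg evalZ.
by have [->|/hp ->] := eqVneq (phi w) 0; rewrite ?scaler0.
Qed.

Lemma nich_hom_span m n phi : nich_hom m n phi ->
  lspan [set psi | exists w, [/\ nV w = m, nW w = n & psi = lword w]]%classic phi.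
Proof.
move=> [np /prt_id <-]; move: phi np.
set S := lspan _; have sS : subspace S by apply: lspan_subspace.
apply: (@nich_ind _ _ _ (prt m n @^-1` S)%classic) => [|w] /=.
  exact: subspace_preim (@prt_linear _ _ D m n) sS.
have [e|ne] := eqVneq (nV w, nW w) (m, n).
  case: e => em en; rewrite prt_id; last by rewrite -em -en; apply: hom_lword.
  by apply: sub_lspan; exists w.
by rewrite (prt_0 (@hom_lword _ _ _ w) ne); case: sS.
Qed.

Lemma Vimage_subspace m n : subspace (@Vimage k gT D m n).
Proof. exact: lspan_subspace. Qed.

Lemma Vimage_lmul m n v phi : sd v -> nich_hom m n phi -> Vimage m n (lmul v phi).
Proof. by move=> sv np; apply: sub_lspan; exists v, phi. Qed.

Lemma Vimage_nich_hom m n psi : Vimage m n psi -> nich_hom m.+1 n psi.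
Proof.
move: psi; apply: lspan_min; first exact: nich_hom_subspace.
by move=> _ [v [phi [sv np ->]]]; have := nich_hom_lmul v np; rewrite sv.
Qed.

Lemma Vimage_yact m n h psi : Vimage m n psi -> Vimage m n (yact h psi).
Proof.
move: psi; apply: (@lspan_min _ _ _ (yact h @^-1` Vimage m n)%classic).
  exact: subspace_preim (@yact_linear _ _ D h) (Vimage_subspace m n).
move=> _ [v [phi [sv np ->]]] /=; rewrite yact_lmul.
apply: (@subspace_sum _ _ (Vimage m n)) => [|l _]; first exact: Vimage_subspace.
have [->|/rh_sd sl] := eqVneq (rh h l v) 0.
  by rewrite scale0r; case: (Vimage_subspace m n).
apply: (subspaceZ _ (Vimage_subspace m n)); apply: Vimage_lmul; rewrite ?sl //.
exact: nich_hom_yact.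
Qed.

Lemma Vimage_pg m n a psi : Vimage m n psi -> Vimage m n (pg a psi).
Proof.
move: psi; apply: (@lspan_min _ _ _ (pg a @^-1` Vimage m n)%classic).
  exact: subspace_preim (pg_linear a) (Vimage_subspace m n).
move=> _ [v [phi [sv /nich_hom_span np ->]]] /=; move: phi np.
apply: (@lspan_min _ _ _ ((fun phi => pg a (lmul v phi)) @^-1` Vimage m n)%classic).
  apply: subspace_preim (Vimage_subspace m n).
  exact: linearf_comp (@lmul_linear _ _ D v) (pg_linear a).
move=> _ [w [<- <- ->]] /=.
rewrite -[lmul v _]/(lword (v :: w)) (pg_ghom _ (@ghom_lword (v :: w))).
apply: (subspaceZ _ (Vimage_subspace _ _)); apply: Vimage_lmul => //.
exact: nich_hom_lword.
Qed.

Lemma Vright_prt m n psi : Vright psi -> Vimage m n (prt m.+1 n psi).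
Proof.
move: psi; apply: (@lspan_min _ _ _ (prt m.+1 n @^-1` Vimage m n)%classic).
  exact: subspace_preim (@prt_linear _ _ D m.+1 n) (Vimage_subspace m n).
move=> _ [v [phi [sv np ->]]] /=; move: phi np.
apply: (@nich_ind _ _ _ ((fun phi => prt m.+1 n (lmul v phi)) @^-1` Vimage m n)%classic) => [|w] /=.
  apply: subspace_preim (Vimage_subspace m n).
  exact: linearf_comp (@lmul_linear _ _ D v) (@prt_linear _ _ D m.+1 n).
rewrite -[lmul v _]/(lword (v :: w)).
have [e|ne] := eqVneq (nV (v :: w), nW (v :: w)) (m.+1, n); last first.
  by rewrite (prt_0 (@hom_lword _ _ _ (v :: w)) ne); case: (Vimage_subspace m n).
case: e => em en; rewrite prt_id; last by rewrite -em -en; apply: hom_lword.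
apply: Vimage_lmul => //; move: em en (nich_hom_lword w); rewrite /nV /nW /= sv /=.
by rewrite add1n add0n => -[<-] <-.
Qed.

Lemma cjop1 (Z : F -> F) : cjop 1%g Z = Z.
Proof. by apply/funext => phi; rewrite /cjop invg1 !yact1. Qed.

Definition ad_vec m psi := exists g Z, @ad_op k gT D m g Z /\ psi = Z (vac D).

(** In a word, the letters of V before the letter of W already put it in V B_(m,1). Otherwise the
    letter of W comes first, and the letters of V after it are moved to the left: each exchange
    yields a multiple of V and a commutator with one more letter, until an iterated commutator
    applied to the vacuum remains. *)
Lemma ad_vec_span m phi : nich_hom m.+1 1 phi ->
  lspan [set psi | Vimage m 1 psi \/ ad_vec m.+1 psi]%classic phi.
Proof.
set S := lspan _; have sS : subspace S by apply: lspan_subspace.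
have ad_word w p g Z : all (@sd k gT D) w -> ad_op p g Z -> (p + size w)%N = m.+1 -> S (Z (lword w)).
  elim: w p g Z => [|v w IH] p g Z.
    by move=> _ op; rewrite addn0 => pm; apply: sub_lspan; right; rewrite -pm; exists g, Z.
  move=> /= /andP [sv sw] op sz.
  (* Conjugated by the inverse degree of [v], so that the second term of its commutator with [v] is
     [Z] followed after [v]. *)
  have op' := ad_op_cj (cdg 1%g v)^-1 op.
  have := AdOpS 1%g sv op'; rewrite cjopM mulgV cjop1 cmul1 => op2.
  have := IH _ _ _ sw op2; rewrite addSnnS => /(_ sz) S2.
  have S1 : S (lmul v (cjop (cdg 1%g v)^-1 Z (lword w))).
    apply: sub_lspan; left; apply: Vimage_lmul => //.
    have := nich_hom_ad op' (nich_hom_lword w).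
    move: sw; rewrite all_count => /eqP nVw.
    rewrite {1}/nV nVw; congr (nich_hom _ _.+1 _); first by move: sz; rewrite addnS => -[].
    by have := size_nVW w; rewrite {1}/nV nVw => /eqP; rewrite -{2}[size w]addn0 eqn_add2l => /eqP.
  by have := subspaceB sS S1 S2; rewrite opprB addrCA subrr addr0.
move=> /nich_hom_span; move: phi; apply: lspan_min => // _ [[|j w] [nVw nWw ->]] //.
have [sj|nsj] := boolP (sd j).
  apply: sub_lspan; left; apply: Vimage_lmul => //.
  move: nVw nWw (nich_hom_lword w); rewrite /nV /nW /= sj /=.
  by rewrite add1n add0n => -[<-] <-.
have := AdOp0 1%g nsj; rewrite cmul1 => op.
apply: (ad_word w _ _ _ _ op).
  move: nWw; rewrite /nW /= nsj add1n => -[/eqP].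
  by rewrite eqn0Ngt -has_count has_predC negbK.
by move: nVw nWw; rewrite /nV /nW /= nsj (negPf nsj) add0n add1n => <- [nWw]; rewrite add0n -size_nVW /nW nWw addn0.
Qed.

End GroupDegree.

Lemma sum_sig (I : finType) (P : pred I) (M : nmodType) (f : I -> M) :
  (forall i, ~~ P i -> f i = 0) -> \sum_(x : {i | P i}) f (val x) = \sum_i f i.
Proof.
move=> f0; rewrite [RHS](bigID P) /= [X in _ + X]big1 ?addr0 //.
rewrite (reindex_omap (val : {i | P i} -> I) insub) => [|i Pi]; last by rewrite insubT.
by apply: eq_bigl => -[i Pi] /=; rewrite insubT Pi /= eqxx.
Qed.

(** * Reflection *)

Section Reflection.
Variables (k : fieldType) (gT : finGroupType) (D : ydd k gT).
Local Notation I := (ix D).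
Local Notation F := (seq I -> k^o).
Variables (m n : nat) (lY : 'I_n -> F) (gY : 'I_n -> gT) (ZY : 'I_n -> F -> F).
Hypothesis opY : forall j, ad_op m.+1 (gY j) (ZY j).
Hypothesis lYE : forall j, lY j = ZY j (vac D).
Hypothesis lYi : indep_mod (@Vimage k gT D m 1) lY.
Hypothesis lY_max : forall x, @ad_vec k gT D m.+1 x ->
  exists c : 'I_n -> k, Vimage m 1 (x - \sum_i c i *: lY i).
Hypothesis V_max : forall psi, nich_hom m.+2 1 psi -> @Vimage k gT D m.+1 1 psi.
Implicit Types (phi psi : F) (u w : seq I) (g h : gT).

Local Notation Q := (@Vimage k gT D m 1).
Let sQ : subspace Q := @Vimage_subspace k gT D m 1.

Lemma nich_hom_spanY phi : nich_hom m.+1 1 phi -> span_mod Q lY phi.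
Proof.
move=> /ad_vec_span; move: phi; apply: lspan_min; first exact: span_mod_subspace.
by move=> x [/sub_span_mod|/lY_max]; [apply|].
Qed.

Lemma nich_homY j : nich_hom m.+1 1 (lY j).
Proof.
rewrite lYE; have := nich_hom_ad (opY j) (nich_hom_lword (D := D) [::]).
by rewrite addn0.
Qed.

(** The coordinates on W' = B_(m+1,1) / V B_(m,1) in the basis of classes of [lY]; linear on
    B_(m+1,1). *)
Definition la (i : 'I_n) phi : k := coef_mod Q lY phi i.

Lemma laZD i a phi psi : nich_hom m.+1 1 phi -> nich_hom m.+1 1 psi ->
  la i (a *: phi + psi) = a * la i phi + la i psi.
Proof.
move=> /nich_hom_spanY sp /nich_hom_spanY sq.
by rewrite /la (coef_mod_linear sQ lYi).
Qed.

Lemma la_Q i phi : Q phi -> la i phi = 0.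
Proof. by move=> Qp; rewrite /la (coef_mod0 sQ lYi). Qed.

Lemma la0 i : la i 0 = 0.
Proof. by apply: la_Q; case: sQ. Qed.

Lemma laZ i a phi : nich_hom m.+1 1 phi -> la i (a *: phi) = a * la i phi.
Proof.
move=> np; have n0 : nich_hom m.+1 1 (0 : F) by case: (nich_hom_subspace D m.+1 1).
by rewrite -[a *: phi]addr0 laZD // la0 addr0.
Qed.

Lemma laD i phi psi : nich_hom m.+1 1 phi -> nich_hom m.+1 1 psi ->
  la i (phi + psi) = la i phi + la i psi.
Proof. by move=> np nq; rewrite -[phi]scale1r laZD // mul1r scale1r. Qed.

Lemma la_sum i (T : eqType) (r : seq T) (f : T -> F) :
  (forall x, x \in r -> nich_hom m.+1 1 (f x)) ->
  la i (\sum_(x <- r) f x) = \sum_(x <- r) la i (f x).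
Proof.
elim: r => [|x r IH] nf; first by rewrite !big_nil la0.
have nr y : y \in r -> nich_hom m.+1 1 (f y) by move=> yr; apply: nf; rewrite inE yr orbT.
rewrite !big_cons laD ?IH //; first by apply: nf; rewrite inE eqxx.
rewrite big_seq; apply: (@subspace_sum _ _ (nich_hom m.+1 1)) => //.
exact: nich_hom_subspace.
Qed.

Lemma la_lY i j : la i (lY j) = (i == j)%:R.
Proof. by rewrite /la (coef_mod_e sQ lYi). Qed.

Lemma la_expand phi : nich_hom m.+1 1 phi -> Q (phi - \sum_i la i phi *: lY i).
Proof. by move=> /nich_hom_spanY /coef_modP. Qed.

Definition rhY h (i j : 'I_n) : k := la i (yact h (lY j)).

Lemma la_yact i h phi : nich_hom m.+1 1 phi ->
  la i (yact h phi) = \sum_j rhY h i j * la j phi.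
Proof.
move=> np; set s := \sum_j la j phi *: lY j.
have ns : nich_hom m.+1 1 s.
  apply: (@subspace_sum _ _ (nich_hom m.+1 1)) => [|j _]; first exact: nich_hom_subspace.
  exact: (subspaceZ _ (nich_hom_subspace D _ _) (nich_homY j)).
have nd := subspaceB (nich_hom_subspace D _ _) np ns.
have -> : yact h phi = yact h (phi - s) + yact h s by rewrite -yactD subrK.
rewrite laD; try exact: nich_hom_yact.
rewrite la_Q ?add0r; last by apply: Vimage_yact; apply: la_expand.
rewrite /s yact_sum la_sum => [|j _].
  apply: eq_bigr => j _; rewrite yactZ laZ; first by rewrite /rhY mulrC.
  by apply: nich_hom_yact; apply: nich_homY.
rewrite yactZ; apply: (subspaceZ _ (nich_hom_subspace D _ _)).
by apply: nich_hom_yact; apply: nich_homY.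
Qed.

Lemma rhY1 i j : rhY 1%g i j = (i == j)%:R.
Proof. by rewrite /rhY yact1 la_lY. Qed.

Lemma rhYM g h i j : rhY (g * h)%g i j = \sum_l rhY g i l * rhY h l j.
Proof. by rewrite /rhY yactM la_yact //; apply: nich_hom_yact; apply: nich_homY. Qed.

Lemma ghom_lY j : ghom (gY j) (lY j).
Proof.
by rewrite lYE; have := ghom_ad (opY j) (@ghom_vac _ _ D); rewrite mulg1.
Qed.

(** The translate of [lY j] is homogeneous of degree [a]. Projecting its expansion to degree [a]
    removes the terms with another [gY l], so uniqueness of coordinates makes their coefficients
    0. *)
Lemma rhY_dg h i j : rhY h i j != 0 -> gY i = (h * gY j * h^-1)%g.
Proof.
apply: contra_neqP => /eqP; set a := (h * gY j * h^-1)%g => ne.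
set x := yact h (lY j).
have nx : nich_hom m.+1 1 x by apply: nich_hom_yact; apply: nich_homY.
have gx : ghom a x := ghom_yact (h := h) (@ghom_lY j).
have := @Vimage_pg _ _ D _ _ a _ (la_expand nx).
rewrite (linearfB (@pg_linear _ _ D a)) (linearf_sum (@pg_linear _ _ D a)).
rewrite (pg_ghom _ gx) eqxx scale1r.
under eq_bigr => l _ do
  rewrite (linearfZ (@pg_linear _ _ D a)) (pg_ghom _ (@ghom_lY l)) scalerA.
move=> /(coef_mod_uniq sQ lYi) e; rewrite /rhY /la e (negPf ne).
by rewrite mulr0.
Qed.

Definition ixR : finType := ({i : I | sd i} + 'I_n)%type.

Definition dgR (x : ixR) : gT :=
  match x with inl i => (dg (val i))^-1%g | inr j => gY j end.

(* The contragredient of V on the first summand. *)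
Definition rhR h (x y : ixR) : k :=
  match x, y with
  | inl i, inl j => rh h^-1%g (val j) (val i)
  | inr i, inr j => rhY h i j
  | _, _ => 0
  end.

Definition sdR (x : ixR) : bool := if x is inl _ then true else false.

Lemma rhR1 x y : rhR 1%g x y = (x == y)%:R.
Proof.
case: x y => [i|i] [j|j] //=; last exact: rhY1.
by rewrite invg1 rh1 eq_sym.
Qed.

Lemma sum_ixR (M : nmodType) (f : ixR -> M) :
  \sum_x f x = \sum_i f (inl i) + \sum_j f (inr j).
Proof. by rewrite big_sumType. Qed.

Lemma rhRM g h x y : rhR (g * h)%g x y = \sum_z rhR g x z * rhR h z y.
Proof.
rewrite sum_ixR; case: x y => [i|i] [j|j] /=.
- rewrite [X in _ + X]big1 ?addr0 => [|l _]; last by rewrite mul0r.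
  rewrite (@sum_sig _ _ _ (fun l => rh g^-1%g l (val i) * rh h^-1%g (val j) l)).
    by rewrite invMg rhM; apply: eq_bigr => l _; rewrite mulrC.
  move=> l nl; have [->|/rh_sd e] := eqVneq (rh g^-1%g l (val i)) 0; first by rewrite mul0r.
  by rewrite e (valP i) in nl.
- by rewrite !big1 ?addr0 // => l _; rewrite ?mul0r ?mulr0.
- by rewrite !big1 ?addr0 // => l _; rewrite ?mul0r ?mulr0.
by rewrite big1 ?add0r => [|l _]; rewrite ?mul0r ?rhYM.
Qed.

Lemma rhR_dg h x y : rhR h x y != 0 -> dgR x = (h * dgR y * h^-1)%g.
Proof.
case: x y => [i|i] [j|j] /=; rewrite ?eqxx //; last exact: rhY_dg.
by move=> /rh_dg ->; rewrite !invMg !invgK !mulgA mulgV mul1g mulgK.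
Qed.

Lemma rhR_sd h x y : rhR h x y != 0 -> sdR x = sdR y.
Proof. by case: x y => [i|i] [j|j] //=; rewrite eqxx. Qed.

Definition refl : ydd k gT := @Ydd k gT ixR dgR rhR sdR rhR1 rhRM rhR_dg rhR_sd.

(** The skew derivation for a letter of W': the coproduct followed by [la i] on left factors of
    bidegree (m+1, 1). *)
Definition alam (i : 'I_n) phi : F := fun u => la i (prt m.+1 1 (shr u phi)).

Lemma nich_hom_prt_shr a b u phi : nich phi -> nich_hom a b (prt a b (shr u phi)).
Proof. by move=> np; apply: nich_hom_prt; apply: nich_shr. Qed.

Lemma alamZD i a phi psi : nich phi -> nich psi ->
  alam i (a *: phi + psi) = a *: alam i phi + alam i psi.
Proof.
move=> np nq; apply/funext => u; rewrite evalZD /alam.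
by rewrite shr_linear prt_linear laZD //; apply: nich_hom_prt_shr.
Qed.

Lemma alam0 i : alam i 0 = 0.
Proof.
apply/funext => u; rewrite /alam; have -> : prt m.+1 1 (shr u (0 : F)) = 0.
  by apply/funext => w; rewrite /prt scaler0.
exact: la0.
Qed.

Lemma alamZ i a phi : nich phi -> alam i (a *: phi) = a *: alam i phi.
Proof.
by move=> np; rewrite -[a *: phi]addr0 alamZD ?alam0 ?addr0 //; apply: nich0.
Qed.

Lemma alam_sum i (T : Type) (r : seq T) (P : pred T) (f : T -> F) :
  (forall x, P x -> nich (f x)) ->
  alam i (\sum_(x <- r | P x) f x) = \sum_(x <- r | P x) alam i (f x).
Proof.
move=> nf; elim: r => [|x r IH]; first by rewrite !big_nil alam0.
rewrite !big_cons; case: ifP => // Px.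
by rewrite -[f x]scale1r alamZD ?IH ?scale1r //; [apply: nf|apply: nich_sum].
Qed.

Lemma alam_decomp i phi L : decomp phi L -> lnich L ->
  alam i phi = \sum_(x <- L) la i (prt m.+1 1 x.1) *: x.2.
Proof.
move=> dL nL; apply/funext => u; rewrite eval_sum /alam.
have -> : shr u phi = \sum_(x <- L) (x.2 u : k) *: x.1.
  by apply/funext => w; rewrite eval_sum /shr dL; apply: eq_bigr => x _; rewrite evalZ.
rewrite (linearf_sum (@prt_linear _ _ D _ _)) la_sum => [|x xL].
  rewrite big_seq [RHS]big_seq; apply: eq_bigr => x xL.
  rewrite (linearfZ (@prt_linear _ _ D _ _)) laZ ?evalZ; first exact: mulrC.
  by apply: nich_hom_prt; apply: nL.
rewrite (linearfZ (@prt_linear _ _ D _ _)).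
apply: (subspaceZ _ (nich_hom_subspace D _ _)).
by apply: nich_hom_prt; apply: nL.
Qed.

Lemma nich_alam i phi : nich phi -> nich (alam i phi).
Proof.
move=> np; have [L dL nL] := nich_decomp np.
rewrite (alam_decomp i dL) => [|x /nL [] //].
rewrite big_seq; apply: nich_sum => x /nL [_ n2].
exact: nichZ.
Qed.

Lemma prt_ZY j phi : nich phi -> prt m.+1 1 (ZY j phi) = phi [::] *: lY j.
Proof.
have Zl := ad_op_linear (opY j).
move: phi; apply: (@nich_ind _ _ _ [set phi : F | prt m.+1 1 (ZY j phi) = (phi [::] : k) *: lY j]%classic).
  split=> [|a x y /= ex ey] /=.
    by rewrite (linearf0 Zl) (linearf0 (@prt_linear _ _ D _ _)) scale0r.
  by rewrite Zl prt_linear ex ey evalZD scalerDl scalerA.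
move=> w /=; have nw := nich_hom_ad (opY j) (nich_hom_lword (D := D) w).
case: w nw => [|v w] nw.
  rewrite /= /vac eqxx scale1r -lYE; apply: prt_id.
  by case: (nich_homY j).
rewrite -[lword _ [::]]/(0 : k) scale0r; apply: (prt_0 nw.2).
apply/eqP => -[]; have := size_nVW (v :: w).
by rewrite [size _]/= => /[swap]; lia.
Qed.

(** Apply [la i] to the first factors of the coproduct given by [ad_op_skew_prim]. The factors
    [ZY j x.1] give the delta term by [prt_ZY], the factors acted on by [gY j] give the sum, and the
    remainder lies in V B, which [la i] kills. *)
Lemma alam_ZY i j phi : nich phi ->
  alam i (ZY j phi) = (i == j)%:R *: phi + \sum_t rhY (gY j) i t *: ZY j (alam t phi).
Proof.
move=> np; have Zl := ad_op_linear (opY j).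
have [L dL nL] := nich_decomp np.
have nL1 : lnich L by move=> x /nL [].
have [L' VL' dZ] := ad_op_skew_prim (opY j) dL nL1.
have nL2 : lnich ([seq (ZY j x.1, x.2) | x <- L] ++
     [seq (yact (gY j) x.1, ZY j x.2) | x <- L] ++ L').
  apply: lnich_cat; first exact: (lnich_map (f' := id) (fun phi => @nich_ad _ _ D _ _ _ phi (opY j)) nL1).
  apply: lnich_cat; first exact: lnich_map (@nich_yact _ _ _ _) nL1.
  by move=> x /VL' /Vright_nich.
rewrite (alam_decomp i dZ nL2) !big_cat !big_map /=.
rewrite [X in _ + (_ + X)]big1_seq ?addr0; last first.
  by move=> x /andP [_ /VL' Vx]; rewrite la_Q ?scale0r //; apply: Vright_prt.
congr (_ + _).
  have -> : phi = \sum_(x <- L) (x.1 [::] : k) *: x.2.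
    apply/funext => u; rewrite eval_sum (dL [::] u); apply: eq_bigr => x _.
    by rewrite evalZ; apply: mulrC.
  rewrite scaler_sumr big_seq [RHS]big_seq; apply: eq_bigr => x xL.
  by rewrite prt_ZY ?laZ ?la_lY ?scalerA 1?mulrC //; [apply: nich_homY|apply: nL1].
under [RHS]eq_bigr => t _ do rewrite (alam_decomp t dL nL1) (linearf_sum Zl) scaler_sumr.
rewrite exchange_big /= big_seq [RHS]big_seq; apply: eq_bigr => x xL.
rewrite prt_yact la_yact; last by apply: nich_hom_prt; apply: nL1.
rewrite scaler_suml; apply: eq_bigr => t _.
by rewrite (linearfZ Zl) scalerA.
Qed.

(** By [V_max] only products [lmul t x] with [t] in V need be considered. There both sides equal
    [la i x] or 0, according to whether [v] is [t], up to elements of V B_(m,1). *)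
Lemma la_shl_shr i v psi : sd v -> nich_hom m.+2 1 psi ->
  la i (shl v psi) = la i (yact (dg v)^-1 (shr [:: v] psi)).
Proof.
move=> sv npsi.
have nshl x : nich_hom m.+2 1 x -> nich_hom m.+1 1 (shl v x).
  by move=> nx; apply: (nich_hom_shl (j := v)); rewrite sv.
have nshr x : nich_hom m.+2 1 x -> nich_hom m.+1 1 (shr [:: v] x).
  by move=> nx; apply: (nich_hom_shr (u := [:: v])); rewrite /nV /nW /= sv.
suff [] : nich_hom m.+2 1 psi /\
    la i (shl v psi) = la i (yact (dg v)^-1 (shr [:: v] psi)) by [].
have [s0 sZD] := nich_hom_subspace D m.+2 1.
have := V_max npsi; move: psi {npsi}; apply: (@lspan_min _ _ _ [set psi : F | nich_hom m.+2 1 psi /\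
    la i (shl v psi) = la i (yact (dg v)^-1 (shr [:: v] psi))]%classic).
  split=> [|a x y /= [nx ex] [ny ey]] /=.
    by split; [exact: s0|rewrite (linearf0 (shr_linear _)) yact0].
  split; first exact: sZD.
  rewrite shl_linear shr_linear yact_linear.
  rewrite (laZD _ _ (nshl _ nx) (nshl _ ny)) ex ey.
  by rewrite (laZD _ _ (nich_hom_yact _ (nshr _ nx)) (nich_hom_yact _ (nshr _ ny))).
move=> _ [t [x [st nx ->]]] /=.
have nt : nich_hom m.+2 1 (lmul t x) by have := nich_hom_lmul t nx; rewrite st.
split; first exact: nt.
have nmshl l : sd l -> nich_hom m 1 (shl l x).
  by move=> sl; apply: (nich_hom_shl (j := l)); rewrite sl.
have nmshr : nich_hom m 1 (shr [:: v] x).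
  by apply: (nich_hom_shr (u := [:: v])); rewrite /nV /nW /= sv.
have Q1 : Q (\sum_l rh (dg t) v l *: lmul t (shl l x)).
  apply: (@subspace_sum _ _ Q) => // l _.
  have [->|/rh_sd sl] := eqVneq (rh (dg t) v l) 0; first by rewrite scale0r; case: sQ.
  by apply: (subspaceZ _ sQ); apply: Vimage_lmul => //; apply: nmshl; rewrite -sl.
have Q2 : Q (yact (dg v)^-1 (lmul t (shr [:: v] x))).
  by apply: Vimage_yact; apply: Vimage_lmul.
rewrite shl_lmul shr_lmul yactD yactZ.
have nQ y : Q y -> nich_hom m.+1 1 y := @Vimage_nich_hom _ _ D m 1 y.
have nz a y : nich_hom m.+1 1 y -> nich_hom m.+1 1 (a *: y) := subspaceZ a (nich_hom_subspace D m.+1 1).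
case: (v =P t) => [e|_]; last by rewrite !scale0r add0r addr0 (la_Q _ Q1) (la_Q _ Q2).
subst t; rewrite !scale1r yactK.
by rewrite (laD _ nx (nQ _ Q1)) (laD _ (nQ _ Q2) nx) (la_Q _ Q1) (la_Q _ Q2) addr0 add0r.
Qed.

(** [la_shl_shr] trades the first letter [v] of the left factor for a last letter [v], which then
    becomes the first letter of the right factor. *)
Lemma alam_shl i v phi : sd v -> nich phi ->
  alam i (shl v phi) = \sum_t rhY (dg v)^-1 i t *: shl v (alam t phi).
Proof.
move=> sv np; apply/funext => u; rewrite eval_sum.
pose psi := prt m.+2 1 (shr u phi).
have npsi : nich_hom m.+2 1 psi := nich_hom_prt_shr _ _ _ np.
have nr : nich_hom m.+1 1 (shr [:: v] psi).
  by apply: (nich_hom_shr (u := [:: v])); rewrite /nV /nW /= sv.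
have El : prt m.+1 1 (shr u (shl v phi)) = shl v psi.
  apply/funext => w; rewrite /psi /prt /shl /shr /nV /nW /= sv add0n add1n eqSS.
  by [].
have Er : prt m.+1 1 (shr (v :: u) phi) = shr [:: v] psi.
  apply/funext => w; rewrite /psi /prt /shr /nV /nW -catA !count_cat /= sv /= !addn0 addn1.
  by rewrite eqSS.
rewrite /alam El (la_shl_shr _ sv npsi) (la_yact _ _ nr); apply: eq_bigr => t _.
by rewrite evalZ /shl -Er.
Qed.

(* The operators making B(D) a Fock space for [refl]: letters of V^* are created by
   left derivations and annihilated by multiplications, and those of W' the other way
   round (annih_creat is the commutation relation). *)
Definition creat (x : ixR) phi : F :=
  match x with
  | inl i => - \sum_l rh (dg (val i))^-1 (val i) l *: shl l phi
  | inr j => ZY j phi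
  end.

Definition annih (x : ixR) phi : F :=
  match x with inl i => rmul (val i) phi | inr j => alam j phi end.

Lemma nich_creat x phi : nich phi -> nich (creat x phi).
Proof.
case: x => [i|j] np /=; last exact: (nich_ad (opY j)).
rewrite -scaleN1r; apply: nichZ; apply: nich_sum => l _.
by apply: nichZ; apply: nich_shl.
Qed.

Lemma nich_annih x phi : nich phi -> nich (annih x phi).
Proof. by case: x => [i|j] np /=; [apply: nich_rmul|apply: nich_alam]. Qed.

Lemma annihZD x a phi psi : nich phi -> nich psi ->
  annih x (a *: phi + psi) = a *: annih x phi + annih x psi.
Proof. by case: x => [i|j] np nq /=; [apply: rmul_linear|apply: alamZD]. Qed.

Lemma rh_conj_dg (i l : D) : rh (dg i)^-1 i l != 0 :> k -> dg l = dg i.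
Proof.
move=> /rh_dg; rewrite invgK => e; apply: (mulgI (dg i)^-1%g); apply: (mulIg (dg i)).
by rewrite -e mulVg mul1g.
Qed.

(** This is [shl_rmul] solved for the term in which [rmul] comes last. All letters entering
    [creat (inl j)] have the degree of [j], so the same twist is inverted in every term. *)
Lemma creat_rmul (i j : {i : D | sd i}) phi :
  \sum_l rh (dg (val j)) l (val i) *: creat (inl j) (rmul l phi) =
  rmul (val i) (creat (inl j) phi) - (val i == val j)%:R *: phi.
Proof.
rewrite /creat; move: (val i) (val j) => {}i {}j.
under eq_bigr => l _ do rewrite scalerN scaler_sumr.
have rN x : rmul i (- x) = - rmul i x by rewrite -scaleN1r rmulZ scaleN1r.
rewrite sumrN exchange_big /= rN rmul_sum -opprD; congr (- _).
transitivity (\sum_q rh (dg j)^-1 j q *: (rh (dg j) q i *: phi + rmul i (shl q phi))).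
  apply: eq_bigr => q _; have [->|/rh_conj_dg e] := eqVneq (rh (dg j)^-1 j q) 0.
    by rewrite scale0r big1 // => l _; rewrite scale0r scaler0.
  transitivity (\sum_l rh (dg j)^-1 j q *: (rh (dg j) l i *: shl q (rmul l phi))).
    by apply: eq_bigr => l _; rewrite !scalerA mulrC.
  rewrite -scaler_sumr; congr (_ *: _).
  under eq_bigr => l _ do rewrite shl_rmul e scalerDr.
  rewrite big_split /= sum_delta; congr (_ + _).
  by rewrite sum_rhM' mulVg sum_rh1'.
under eq_bigr => q _ do rewrite scalerDr scalerA.
rewrite big_split /= -scaler_suml -rhM mulVg rh1 eq_sym addrC; congr (_ + _).
by apply: eq_bigr => q _; rewrite rmulZ.
Qed.

(** The relation has the form of [shl_lmul] for [refl]. The four cases rest on [creat_rmul],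
    [ad_op_rcomm], [alam_shl] and [alam_ZY]. *)
Lemma annih_creat x y phi : nich phi ->
  annih x (creat y phi) =
  (x == y)%:R *: phi + \sum_t rhR (dgR y) x t *: creat y (annih t phi).
Proof.
move=> np; rewrite sum_ixR; case: x y => [i|i] [j|j].
- rewrite [X in _ + (_ + X)]big1 ?addr0 => [|l _]; last by rewrite scale0r.
  under eq_bigr => l _ do rewrite /rhR /dgR invgK /annih.
  rewrite (@sum_sig _ _ _ (fun l => rh (dg (val j)) l (val i) *: creat (inl j) (rmul l phi))).
    by rewrite creat_rmul addrCA [X in _ = X + _]/= subrr addr0.
  move=> l nl; have [->|/rh_sd e] := eqVneq (rh (dg (val j)) l (val i)) 0; first by rewrite scale0r.
  by rewrite e (valP i) in nl.
- rewrite [X in _ + (_ + X)]big1 ?addr0 => [|l _]; last by rewrite scale0r.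
  rewrite scale0r add0r [annih _ _]/= (ad_op_rcomm (opY j)).
  rewrite -(@sum_sig _ (@sd _ _ D) _ (fun l => rh (gY j)^-1 l (val i) *: ZY j (rmul l phi))) //.
  move=> l nl; have [->|/rh_sd e] := eqVneq (rh (gY j)^-1 l (val i)) 0; first by rewrite scale0r.
  by rewrite e (valP i) in nl.
- rewrite big1 ?add0r => [|l _]; last by rewrite scale0r.
  rewrite scale0r add0r /annih /creat /dgR /rhR.
  rewrite -scaleN1r alamZ; last by apply: nich_sum => l _; apply: nichZ; apply: nich_shl.
  rewrite alam_sum => [|l _]; last by apply: nichZ; apply: nich_shl.
  transitivity (-1 *: \sum_l rh (dg (val j))^-1 (val j) l *: \sum_t rhY (dg (val j))^-1 i t *: shl l (alam t phi)).
    congr (_ *: _); apply: eq_bigr => l _.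
    rewrite alamZ; last exact: nich_shl.
    have [->|nz] := eqVneq (rh (dg (val j))^-1 (val j) l) 0; first by rewrite !scale0r.
    have sl : sd l by rewrite -(rh_sd nz) (valP j).
    by rewrite (alam_shl _ sl np) (rh_conj_dg nz).
  under eq_bigr => l _ do rewrite scaler_sumr.
  rewrite exchange_big scaler_sumr; apply: eq_bigr => t _ /=.
  rewrite scaleN1r scalerN scaler_sumr; congr (- _); apply: eq_bigr => l _.
  by rewrite !scalerA mulrC.
rewrite big1 ?add0r => [|l _]; last by rewrite scale0r.
by rewrite /= alam_ZY.
Qed.

(** * The map from B(V + W) to functions on words in V' + W' *)

Section FockSpace.
Variables (Lam : F) (aV : nat) (w0 : seq I).
Hypothesis nLam : nich_hom aV 0 Lam.
Hypothesis Lam0 : Lam w0 != 0.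
Hypothesis aV_top : forall phi, nich_hom aV.+1 0 phi -> phi = 0.

(** A vacuum functional: it is 1 on [Lam] and 0 on everything created. [Psi] reads an element
    through iterated annihilations followed by [eps], as a function on words is read through its
    derivatives. *)
Definition eps phi : k := (Lam w0)^-1 * phi w0.

Fixpoint Psi phi (w : seq ixR) : k^o :=
  if w is x :: w' then Psi (annih x phi) w' else eps phi.

Lemma w0_type : nV w0 = aV /\ nW w0 = 0%N.
Proof. by have [] := nLam.2 _ Lam0; rewrite !addn0. Qed.

Lemma PsiZD (a : k) phi psi (w : seq ixR) : nich phi -> nich psi ->
  Psi (a *: phi + psi) w = a *: Psi phi w + Psi psi w.
Proof.
elim: w phi psi => [|x w IH] phi psi np nq /=.
  by rewrite /eps evalZD mulrDr; congr (_ + _); apply: mulrCA.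
by rewrite annihZD // IH //; apply: nich_annih.
Qed.

Lemma Psi0 (w : seq ixR) : Psi 0 w = 0.
Proof.
have n0 : nich (0 : F) by apply: nich0.
have := PsiZD (-1) w n0 n0; rewrite scaleN1r oppr0 addr0 scaleN1r addNr => ->.
by [].
Qed.

Lemma Psi_sum (T : Type) (r : seq T) (P : pred T) (c : T -> k) (f : T -> F) (w : seq ixR) :
  (forall x, P x -> nich (f x)) ->
  Psi (\sum_(x <- r | P x) c x *: f x) w = \sum_(x <- r | P x) c x *: Psi (f x) w.
Proof.
move=> nf; elim: r => [|x r IH]; first by rewrite !big_nil Psi0.
rewrite !big_cons; case: ifP => // Px; rewrite PsiZD ?IH //; first exact: nf.
by apply: nich_sum => y Py; apply: nichZ; apply: nf.
Qed.

(** The word [w0] has bidegree (aV, 0). A derivation by V would read [phi] in bidegree (aV+1, 0),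
    where all elements vanish, and an element of W' creates a letter of W. *)
Lemma eps_creat x phi : nich phi -> eps (creat x phi) = 0.
Proof.
move=> np; rewrite /eps; suff -> : creat x phi w0 = 0 by rewrite mulr0.
have [v0 v1] := w0_type; case: x => [i|j] /=.
  rewrite -[LHS]/(- (\sum_l rh (dg (val i))^-1 (val i) l *: shl l phi) w0).
  rewrite eval_sum big1 ?oppr0 // => l _; rewrite evalZ.
  have [->|/rh_sd sl] := eqVneq (rh (dg (val i))^-1 (val i) l) 0; first exact: scale0r.
  have := congr1 (fun f : F => f (l :: w0)) (aV_top (nich_hom_prt aV.+1 0 np)).
  rewrite {1}/prt /nV /nW /= -sl (valP i) /= -/(nV w0) -/(nW w0) v0 v1 add1n add0n !eqxx.
  by rewrite scale1r /shl => ->; rewrite scaler0.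
move: phi np; apply: (@nich_ind _ _ _ [set phi : F | ZY j phi w0 = 0]%classic).
  have Zl := ad_op_linear (opY j); split=> [|a x y /= ex ey] /=.
    by rewrite (linearf0 Zl).
  by rewrite Zl evalZD ex ey scaler0 addr0.
move=> w /=; apply/eqP; apply: contraT => nz.
have [_ /(_ _ nz) [_]] := nich_hom_ad (opY j) (nich_hom_lword (D := D) w).
by rewrite v1.
Qed.

(** By [annih_creat] and [shl_lmul] both sides obey the same recursion on words, and [eps_creat] is
    its initial value. *)
Lemma Psi_creat y phi : nich phi -> Psi (creat y phi) = @lmul k gT refl y (Psi phi).
Proof.
move=> np; apply/funext => w; elim: w phi np => [|x w IH] phi np.
  exact: eps_creat.
rewrite -[RHS]/(@shl k gT refl x (@lmul k gT refl y (Psi phi)) w) shl_lmul evalD evalZ.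
rewrite -[LHS]/(Psi (annih x (creat y phi)) w) annih_creat // PsiZD //; last first.
  by apply: nich_sum => t _; apply: nichZ; apply: nich_creat; apply: nich_annih.
congr (_ + _); rewrite Psi_sum => [|t _]; last by apply: nich_creat; apply: nich_annih.
rewrite eval_sum; apply: eq_bigr => t _; rewrite evalZ IH //.
exact: nich_annih.
Qed.

(** Multiplication by a letter of V leads above the top degree, and [alam] needs a letter of W. *)
Lemma annih_Lam x : annih x Lam = 0.
Proof.
case: x => [i|j] /=.
  by apply: aV_top; have := nich_hom_rmul (val i) nLam; rewrite (valP i).
apply/funext => u; rewrite /alam [prt _ _ _](_ : _ = 0) ?la0 //.
apply/funext => w; rewrite /prt; case: (boolP (_ && _)) => [/andP [_ /eqP nw]|_]; last exact: scale0r.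
rewrite scale1r; apply/eqP; apply: contraT => /nLam.2 [_].
by rewrite addn0 /nW count_cat -/(nW w) nw.
Qed.

Lemma Psi_Lam : Psi Lam = vac refl.
Proof.
apply/funext => -[|x w]; first by rewrite /= /eps mulVf.
by rewrite /= annih_Lam Psi0.
Qed.

Definition cword (w : seq ixR) : F := foldr creat Lam w.

Lemma nich_cword (w : seq ixR) : nich (cword w).
Proof. by elim: w => [|x w IH] /=; [case: nLam|apply: nich_creat]. Qed.

Lemma Psi_cword (w : seq ixR) : Psi (cword w) = @lword k gT refl w.
Proof.
elim: w => [|x w IH] /=; first exact: Psi_Lam.
by rewrite Psi_creat ?IH //; apply: nich_cword.
Qed.

Definition cspan : set F := lspan [set phi | exists w : seq ixR, phi = cword w]%classic.

Lemma cspan_nich phi : cspan phi -> nich phi.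
Proof.
move: phi; apply: lspan_min; first exact: nich_subspace.
by move=> _ [w ->]; apply: nich_cword.
Qed.

Lemma cspan_Psi phi : cspan phi -> @nich k gT refl (Psi phi).
Proof.
move=> cp; suff [] : nich phi /\ @nich k gT refl (Psi phi) by [].
move: phi cp; apply: (@lspan_min _ _ _ [set phi : F | nich phi /\ @nich k gT refl (Psi phi)]%classic).
  split=> [|a x y /= [nx px] [ny py]] /=.
    split; first exact: nich0.
    by rewrite [Psi 0](_ : _ = 0); [apply: nich0|apply/funext => w; apply: Psi0].
  split; first exact: ((nich_subspace D).2 a _ _ nx ny).
  have -> : Psi (a *: x + y) = (a *: (Psi x : seq refl -> k^o) + Psi y)%R.
    by apply/funext => w; rewrite PsiZD.
  exact: ((nich_subspace refl).2 a _ _ px py).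
move=> _ [w ->] /=; split; first exact: nich_cword.
by rewrite Psi_cword; apply: nich_lword.
Qed.

Lemma Psi_lift (psi : seq refl -> k^o) : @nich k gT refl psi -> exists2 phi, cspan phi & Psi phi = psi.
Proof.
move: psi; apply: (@nich_ind _ _ refl [set psi : seq refl -> k^o | exists2 phi, cspan phi & Psi phi = psi]%classic).
  have [c0 cZD] : subspace cspan by apply: lspan_subspace.
  split=> [|a x y [f cf <-] [g cg <-]].
    by exists 0 => //; apply/funext => w; apply: Psi0.
  exists (a *: f + g); first exact: cZD.
  by apply/funext => w; rewrite PsiZD //; apply: cspan_nich.
move=> w; exists (cword w); last exact: Psi_cword.
by apply: sub_lspan; exists w.
Qed.

Lemma Psi_indep_lift N (e : 'I_N -> (seq refl -> k^o)) (f : 'I_N -> F) :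
  (forall i, cspan (f i)) -> (forall i, Psi (f i) = e i) ->
  indep_mod [set (0 : seq refl -> k^o)]%classic e -> indep_mod [set (0 : F)]%classic f.
Proof.
move=> cf fe ei c /= c0; apply: ei => /=; apply/funext => w; rewrite (@eval_sum _ _ refl).
transitivity (Psi (\sum_i c i *: f i) w); last by rewrite c0 Psi0.
rewrite Psi_sum => [|i _]; last exact: cspan_nich.
by apply: eq_bigr => i _; rewrite -fe.
Qed.

(** [Psi] maps [cspan] onto the reflected algebra, and preimages of independent elements are
    independent; so reflection does not increase the dimension. *)
Lemma indep_refl N : indep N (@nich k gT refl) -> indep N (@nich k gT D).
Proof.
move=> [e [ne ei]].
have [f fP] := choice (fun i => let: ex_intro2 phi cp pe := Psi_lift (ne i) in
  ex_intro (fun phi => cspan phi /\ Psi phi = e i) phi (conj cp pe)).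
exists f; split=> [i|]; first by apply: cspan_nich; case: (fP i).
by apply: (@Psi_indep_lift _ e) => // i; case: (fP i).
Qed.

(* Dimension d of the reflected algebra forces the independent preimages to be a basis
   of B(D), whose dimension is at most d; hence Psi is injective. *)
Lemma Psi_min d phi : ~ indep d.+1 (@nich k gT D) -> indep d (@nich k gT refl) ->
  nich phi -> phi <> 0 -> @nich k gT refl (Psi phi) /\ Psi phi <> 0.
Proof.
move=> nd [e [ne ei]] np p0.
have [f fP] := choice (fun i => let: ex_intro2 phi cp pe := Psi_lift (ne i) in
  ex_intro (fun phi => cspan phi /\ Psi phi = e i) phi (conj cp pe)).
have cf i : cspan (f i) by case: (fP i).
have fe i : Psi (f i) = e i by case: (fP i).
have fi := Psi_indep_lift cf fe ei.
have nf i : nich (f i) by apply: cspan_nich.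
have [c /= /eqP] := indep_mod_ex (@subspace_set0 _ _) nf fi np nd.
rewrite subr_eq0 => /eqP ephi; split.
  apply: cspan_Psi; rewrite ephi; apply: (@subspace_sum _ _ cspan) => [|i _].
    exact: lspan_subspace.
  by apply: (subspaceZ _ (lspan_subspace _)); apply: cf.
move=> Psi_0; apply: p0; rewrite ephi big1 // => i _.
suff -> : c i = 0 by rewrite scale0r.
apply: ei => /=; rewrite -[RHS]Psi_0 ephi; apply/funext => w; rewrite (@eval_sum _ _ refl).
by rewrite Psi_sum //; apply: eq_bigr => j _; rewrite -fe.
Qed.

(** The annihilations along [w] must lead from bidegree (a, b) to (aV, 0), the only one that [eps]
    sees. A letter of V' adds (1, 0) and a letter of W' subtracts (m+1, 1). *)
Lemma Psi_hom a b phi : nich phi -> bihom a b phi -> forall w : seq ixR, Psi phi w != 0 ->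
  @nW k gT refl w = b /\ (a + @nV k gT refl w = aV + m.+1 * b)%N.
Proof.
move=> np hp w; elim: w a b phi np hp => [|x w IH] a b phi np hp.
  rewrite /= /eps mulf_eq0 negb_or => /andP [_ /hp].
  by have [-> ->] := w0_type; rewrite !addn0 => -[<- <-]; rewrite muln0 addn0.
case: x => [i|j] nz.
  have hr : bihom (sd (val i) + a) (~~ sd (val i) + b) (rmul (val i) phi) := hom_off_rmul hp.
  have := IH _ _ _ (nich_rmul _ np) hr nz.
  by rewrite (valP i) /= /nV /nW /= => -[e1 e2]; rewrite !add0n; split=> //; rewrite -e2; lia.
have ha u : alam j phi u != 0 -> (nV u + m.+1 = a)%N /\ (nW u + 1 = b)%N.
  rewrite /alam; case: (pselect (exists w1, prt m.+1 1 (shr u phi) w1 != 0)) => [[w1]|].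
    rewrite /prt; case: (boolP (_ && _)) => [/andP [/eqP e1 /eqP e2]|_]; last by rewrite scale0r eqxx.
    rewrite scale1r => /hp []; rewrite /nV /nW !count_cat !addn0 -/(nV _) -/(nW _) -/(nV _) -/(nW _).
    by rewrite e1 e2 addnC [(1 + _)%N]addnC => -> ->.
  move=> /forallNP nw; rewrite [prt _ _ _](_ : _ = 0) ?la0 ?eqxx //.
  by apply/funext => w1; apply/eqP; apply: contrapT => /negP; apply: nw.
have [u nzu] : exists u, alam j phi u != 0.
  apply: contrapT => /forallNP nu; move: nz => /=; rewrite [alam j phi](_ : _ = 0) ?Psi0 ?eqxx //.
  by apply/funext => u; apply/eqP; apply: contrapT => /negP; apply: nu.
have [ea eb] := ha u nzu.
have hh : bihom (nV u) (nW u) (alam j phi).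
  by move=> v /ha [e1 e2]; rewrite !addn0; split; lia.
have := IH _ _ _ (nich_alam j np) hh nz.
rewrite -ea -eb /nV /nW /= add0n add1n => -[-> e2]; split; first by rewrite addn1.
by move: e2; lia.
Qed.

End FockSpace.

End Reflection.

(** * Minimal dimension and iterated reflections *)

Definition two_sided (k : fieldType) (gT : finGroupType) (D : ydd k gT) : Prop :=
  (exists i : D, sd i) /\ (exists j : D, ~~ sd j).

Lemma last_true (P : nat -> Prop) a N : P a -> (forall n, (N <= n)%N -> ~ P n) ->
  exists n, [/\ (a <= n)%N, P n & ~ P n.+1].
Proof.
move=> Pa PN; apply: contrapT => nex.
have step n : P (a + n)%N.
  elim: n => [|n IH]; first by rewrite addn0.
  apply: contrapT => nP; apply: nex; exists (a + n)%N; split=> //; first exact: leq_addr.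
  by rewrite -addnS.
exact: PN (leq_addl a N) (step N).
Qed.

Lemma reflection (k : fieldType) (gT : finGroupType) (D : ydd k gT) m d :
  two_sided D ->
  (exists psi, nich_hom m.+1 1 psi /\ ~ @Vimage k gT D m 1 psi) ->
  (forall psi, nich_hom m.+2 1 psi -> @Vimage k gT D m.+1 1 psi) ->
  ~ indep d.+1 (@nich k gT D) ->
  (forall D' : ydd k gT, two_sided D' -> indep d (@nich k gT D')) ->
  forall a b (phi : seq D -> k^o), nich_hom a b phi -> phi <> 0 ->
  exists (D' : ydd k gT) a' (phi' : seq D' -> k^o),
    [/\ two_sided D', ~ indep d.+1 (@nich k gT D'), nich_hom a' b phi', phi' <> 0 &
        (m.+1 * b < a' + a)%N].
Proof.
move=> [[i si] twoD] [psi [npsi nVpsi]] V_max nd dmin a b phi [np hp] p0.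
have sQ := @Vimage_subspace k gT D m 1.
have nQ : ~ has_indep (@Vimage k gT D m 1) (@ad_vec k gT D m.+1) d.+1.
  move=> hi; apply: nd; have sub0 : ([set 0] `<=` @Vimage k gT D m 1)%classic.
    by move=> _ ->; case: sQ.
  apply: has_indepS (has_indepW sub0 hi) => _ [g [Z [op ->]]].
  by apply: (nich_ad op); apply: (nich_lword [::]).
have [n [lY [adY lYi lY_max]]] := indep_mod_max sQ nQ.
have [gY gYP] := choice adY; have [ZY ZYP] := choice gYP.
have opY j : ad_op m.+1 (gY j) (ZY j) by case: (ZYP j).
have lYE j : lY j = ZY j (vac D) by case: (ZYP j).
have two' : two_sided (refl opY lYE lYi lY_max).
  split; first by exists (inl (exist _ i si)).
  (* If W' had an empty basis, [psi] would lie in V B_(m,1). *)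
  case: n lY adY lYi lY_max gY gYP ZY ZYP opY lYE => [|n] lY adY lYi lY_max gY gYP ZY ZYP opY lYE.
    have [c] := nich_hom_spanY lY_max npsi.
    by rewrite big_ord0 subr0 => /nVpsi.
  by exists (inr ord0).
have topP (c : nat) : (d <= c)%N -> ~ exists f : seq D -> k^o, nich_hom c 0 f /\ f <> 0.
  move=> dc [f [nf f0]]; apply: nd; have := nich_hom_indep nf f0; rewrite addn0.
  by apply: has_indep_le; [exact: subspace_set0|].
(* A degree just before a vanishing one for V alone; it is at least 1 because a letter of V is
   nonzero, and this makes the final inequality strict. *)
have [aV [aV1 [Lam [nLam Lam0]] naV]] : exists c, [/\ (1 <= c)%N,
    exists f : seq D -> k^o, nich_hom c 0 f /\ f <> 0 &
    ~ exists f : seq D -> k^o, nich_hom c.+1 0 f /\ f <> 0].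
  apply: last_true topP; exists (lword [:: i]); split.
    by have := nich_hom_lword [:: i]; rewrite /nV /nW /= si.
  move=> /(congr1 (fun f : seq D -> k^o => f [:: i])).
  rewrite -[lword _ _]/(shl i (lmul i (vac D)) [::]) shl_letter eqxx scale1r /vac eqxx.
  by move/eqP; rewrite oner_eq0.
have aV_top (f : seq D -> k^o) : nich_hom aV.+1 0 f -> f = 0.
  by move=> nf; apply: contrapT => f0; apply: naV; exists f.
have [w0 Lw0] : exists w, Lam w != 0.
  apply: contrapT => /forallNP nw; apply: Lam0; apply/funext => w.
  by apply/eqP; apply: contrapT => /negP; apply: nw.
pose P := @Psi k gT D m n lY Lam w0 phi.
(* Minimality of [d] is applied to the reflected datum, so [Psi] keeps [phi] nonzero. *)
have [nP P0] := Psi_min V_max nLam Lw0 aV_top nd (dmin _ two') np p0.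
have [w P_w] : exists w, P w != 0.
  apply: contrapT => /forallNP nw; apply: P0; apply/funext => w.
  by apply/eqP; apply: contrapT => /negP; apply: nw.
have PE w' : P w' != 0 -> _ := Psi_hom opY lYE lYi lY_max nLam Lw0 np hp (w := w').
have [_ eV] := PE _ P_w.
exists (refl opY lYE lYi lY_max), (@nV k gT (refl opY lYE lYi lY_max) w), P; split=> //.
- by move=> /(indep_refl V_max nLam Lw0 aV_top).
- split=> // w1 /PE [-> e1]; rewrite !addn0; split=> //.
  by apply/(@addnI a); rewrite e1 eV.
- by rewrite addnC eV -[X in (X < _)%N]add0n ltn_add2r.
Qed.

Section Swap.
Variables (k : fieldType) (gT : finGroupType) (D : ydd k gT).

Lemma rh_nsd h (i j : D) : rh h i j != 0 -> ~~ sd i = ~~ sd j.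
Proof. by move=> /rh_sd ->. Qed.

Definition swap : ydd k gT :=
  @Ydd k gT (ix D) (@dg k gT D) (@rh k gT D) (predC (@sd k gT D))
    (@rh1 k gT D) (@rhM k gT D) (@rh_dg k gT D) rh_nsd.

Lemma two_sided_swap : two_sided D -> two_sided swap.
Proof. by move=> [[i si] [j sj]]; split; [exists j|exists i; rewrite /= negbK]. Qed.

Lemma nich_hom_swap m n phi : @nich_hom k gT D m n phi -> @nich_hom k gT swap n m phi.
Proof.
move=> [np hp]; split=> // w /hp [<- <-]; split=> //.
by congr (_ + _)%N; apply: eq_count => i /=; rewrite negbK.
Qed.

End Swap.

Theorem two_sided_indep (k : fieldType) (gT : finGroupType) :
  [pchar k] =i pred0 -> simple [set: gT] -> ~~ abelian [set: gT] ->
  forall D : ydd k gT, two_sided D -> forall N, indep N (@nich k gT D).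
Proof.
move=> hk sG nabG D0 two0 N0; apply: contrapT => nind0.
pose fin N := exists D : ydd k gT, two_sided D /\ ~ indep N (@nich k gT D).
(* [d] is the least dimension that occurs: [~ indep d.+1] bounds the dimension of one algebra by
   [d], and no algebra has a smaller one. *)
have [d [[D1 [two1 nd1]] dmin]] : exists d, fin d.+1 /\ ~ fin d.
  have : fin N0 by exists D0.
  elim: N0 {nind0} => [|N IH] fN.
    by case: fN => D [_ []]; exists (fun i => 0); split=> [[]|c _ []].
  by case: (pselect (fin N)) => [/IH|nfN] //; exists N.
have {dmin} dmin (D' : ydd k gT) : two_sided D' -> indep d (@nich k gT D').
  by move=> two'; apply: contrapT => nd'; apply: dmin; exists D'.
(* The induction keeps m <= n: reflecting and then exchanging the two sides turns (m, n) into (n,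
   a') with a' > n. *)
have grow N : exists (D : ydd k gT) m n (phi : seq D -> k^o),
    [/\ two_sided D, ~ indep d.+1 (@nich k gT D), nich_hom m n phi, phi <> 0 &
        (m <= n)%N /\ (N <= n)%N].
  elim: N => [|N [D [m [n [phi [twoD ndD hp p0 [le_mn le_Nn]]]]]]].
    exists D1, 0%N, 0%N, (vac D1); split=> //; first exact: (nich_hom_lword [::]).
    by move=> /(congr1 (fun f : seq D1 -> k^o => f [::])) /eqP; rewrite oner_eq0.
  have dg1 (i : D) : dg i != 1%g by apply/eqP => /(central_indep d.+1 hk).
  have [M [M1 [psi psiP] nVM]] : exists M, [/\ (1 <= M)%N,
      exists psi, nich_hom M.+1 1 psi /\ ~ @Vimage k gT D M 1 psi &
      ~ exists psi, nich_hom M.+2 1 psi /\ ~ @Vimage k gT D M.+1 1 psi].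
    apply: (@last_true (fun M => exists psi, nich_hom M.+1 1 psi /\
      ~ @Vimage k gT D M 1 psi) _ d).
      by apply: simple_quotient_two => //; case: twoD.
    move=> M le_dM [psi [npsi nV]].
    have psi0 : psi <> 0 by move=> e; apply: nV; rewrite e; case: (@Vimage_subspace _ _ D M 1).
    apply: ndD; apply: has_indep_le (nich_hom_indep npsi psi0); first exact: subspace_set0.
    by lia.
  have V_max (psi' : seq D -> k^o) : nich_hom M.+2 1 psi' -> Vimage M.+1 1 psi'.
    by move=> np'; apply: contrapT => nV'; apply: nVM; exists psi'.
  have [D' [a' [phi' [two' nd' hp' p0' lt_a']]]] :=
    reflection twoD (ex_intro _ psi psiP) V_max ndD dmin hp p0.
  exists (swap D'), n, a', phi'; split=> //; first exact: two_sided_swap.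
    exact: nich_hom_swap.
  (* Reflection gives (M+1) n < a' + m; with M >= 1 and m <= n this yields n < a'. *)
  by split; nia.
have [D [m [n [phi [twoD ndD hp p0 [_ le_dn]]]]]] := grow d.
apply: ndD; apply: has_indep_le (nich_hom_indep hp p0); first exact: subspace_set0.
by lia.
Qed.

Local Notation iota := Defs.iota.

(** * From Yetter-Drinfeld modules to words *)

Section Degree1.
Variables (k : fieldType) (U : lmodType k).

Definition pr1 : talg U -> U := talg_lift (fun w => if w is [:: u] then u else 0).

Lemma pr1_multilin : multilin (fun w : seq U => if w is [:: u] then u else 0).
Proof.
move=> [|x [|y p]] [|z q] a u u' //=; rewrite ?scaler0 ?addr0 //.
Qed.

Lemma pr1_linear : linear pr1.
Proof. exact/talg_lift_linear/pr1_multilin. Qed.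

Lemma pr1_word w : pr1 (word w) = if w is [:: u] then u else 0.
Proof. exact/talg_lift_word/pr1_multilin. Qed.

Lemma pr1_iotaM (u : U) (x : talg U) : pr1 (iota u * x) = talg_counit x *: u.
Proof.
move: x; apply: talg_eq => [||w].
- exact: linearf_comp (@talg_mul_linr k U (iota u)) pr1_linear.
- by move=> a x y; rewrite talg_counit_linear scalerDl scalerA.
rewrite -wordM pr1_word talg_counit_word.
by case: w => [|? ?] /=; rewrite ?scale1r ?scale0r.
Qed.

Lemma counit_iotaM (u : U) (x : talg U) : talg_counit (iota u * x) = 0.
Proof.
move: x; apply: talg_eq => [||w].
- exact: linearf_comp (@talg_mul_linr k U (iota u)) (@talg_counit_linear k U).
- by move=> a x y; rewrite scaler0 addr0.
by rewrite -wordM talg_counit_word.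
Qed.

End Degree1.

Section Link.
Variables (k : fieldType) (gT : finGroupType) (U : yd_module k gT).
Local Notation T := (talg U).

Lemma pr1_act g (x : T) : pr1 (talg_act g x) = yd_act g (pr1 x).
Proof.
move: x; apply: talg_eq => [||w].
- exact: linearf_comp (@talg_act_linear _ _ U g) (@pr1_linear k U).
- exact: linearf_comp (@pr1_linear k U) (@yd_act_linear _ _ U g).
rewrite talg_act_word !pr1_word.
by case: w => [|? [|? ?]] //=; rewrite (linearf0 (@yd_act_linear _ _ U g)).
Qed.

Lemma pr1_ge2 (x : T) : @talg_ge2 _ _ U x -> pr1 x = 0.
Proof.
move: x; apply: (@lspan_min _ _ _ [set x : T | pr1 x = 0]%classic).
  exact: subspace_preim (@pr1_linear k U) (@subspace_set0 _ _).
by move=> _ [[|? [|? ?]] // _ ->] /=; rewrite pr1_word.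
Qed.

Lemma iota_nichols (u : U) : @nichols_ideal _ _ U (iota u) -> u = 0.
Proof. by move=> /nichols_ideal_ge2 /pr1_ge2; rewrite pr1_word. Qed.

Let t2 := (tens_bilin T T).2.

Lemma braid_mul_iotal u (a b : T) :
  braid_mul (tens (iota u) 1) (tens a b) = tens (iota u * a) b.
Proof.
rewrite braid_mul_tens (bigD1 1%g) //= talg_proj_one eqxx talg_act1 mul1r.
by rewrite big1 ?addr0 // => s /negPf s1; rewrite talg_proj_one s1 mul0r (linearf0 (t2 _)).
Qed.

Lemma braid_mul_iotar s u (a b : T) : yd_deg s u ->
  braid_mul (tens 1 (iota u)) (tens a b) = tens (talg_act s a) (iota u * b).
Proof.
move=> su; rewrite braid_mul_tens (bigD1 s) //= talg_proj_iota su mul1r.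
rewrite big1 ?addr0 // => t /negPf ts.
by rewrite talg_proj_iota -su yd_projK ts (linearf0 (@iota_linear _ _ U)) mul0r (linearf0 (t2 _)).
Qed.

(* The skew derivation (c pr1 (x) id) Delta attached to a linear form c on U. *)
Definition dleft (c : U -> k^o) (x : T) : T :=
  tprod_lift (fun a b => (c (pr1 a) : k) *: b) (talg_delta x).

Section LeftDerivation.
Variable c : U -> k^o.
Hypothesis cl : linear c.

Lemma dleft_bilin : bilin (fun a b : T => (c (pr1 a) : k) *: b).
Proof.
split=> [b a x y|a b x y]; last by rewrite scalerDr !scalerA mulrC.
by rewrite pr1_linear cl scalerDl scalerA.
Qed.

Lemma dleft_linear : linear (dleft c).
Proof. exact: linearf_comp (@talg_delta_linear _ _ U) (tprod_lift_linear dleft_bilin). Qed.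

Lemma dleft1 : dleft c 1 = 0.
Proof.
rewrite /dleft talg_delta1 tprod_lift_tens; last exact: dleft_bilin.
by rewrite -[1]/(word [::]) pr1_word (linearf0 cl) scale0r.
Qed.

(** In the coproduct of [x] every term has a factor in [J]. A left factor in [J] has no component of
    degree 1 and is killed; otherwise the right factor, which survives, is in [J]. *)
Lemma dleft_coideal (J : set T) x : coideal J -> (J `<=` @talg_ge2 _ _ U)%classic ->
  J x -> J (dleft c x).
Proof.
move=> [sJ _ dJ] J2 Jx; have := dJ x Jx; rewrite /dleft.
move: (talg_delta x); apply: (@lspan_min _ _ _ [set z |
  J (tprod_lift (fun a b : T => (c (pr1 a) : k) *: b) z)]%classic).
  exact: subspace_preim (tprod_lift_linear dleft_bilin) sJ.
move=> _ [a [b [Jab ->]]] /=; rewrite tprod_lift_tens; last exact: dleft_bilin.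
case: Jab => [/J2 /pr1_ge2 ->|Jb]; last exact: subspaceZ.
by rewrite (linearf0 cl) scale0r; case: sJ.
Qed.

End LeftDerivation.

(** The left counit law. On a product by [u], the summand with [u] on the left is killed by the
    counit, and the one with [u] on the right restores the factor [u]. *)
Lemma counit_delta (x : T) :
  tprod_lift (fun a b : T => (talg_counit a : k) *: b) (talg_delta x) = x.
Proof.
have bl : bilin (fun a b : T => (talg_counit a : k) *: b).
  split=> [b a y z|a b y z]; last by rewrite scalerDr !scalerA mulrC.
  by rewrite talg_counit_linear scalerDl scalerA.
have ll := tprod_lift_linear bl.
move: x; apply: talg_eq => // [|w].
  exact: linearf_comp (@talg_delta_linear _ _ U) ll.
elim: w => [|u w IH].
  by rewrite talg_delta1 tprod_lift_tens // (talg_counit_word (U := U) [::]) eqxx scale1r.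
rewrite -cat1s wordM talg_delta_mul -[word [:: u]]/(iota u) talg_delta_iota.
rewrite (linearfD (@braid_mul_linl _ _ U _)) (linearfD ll).
rewrite -[X in _ = _ * X]IH.
move: (talg_delta (word w)) => z.
rewrite [X in X + _](_ : _ = 0) ?add0r.
  move: z; apply: tprod_eq => [||a b].
  - by apply: linearf_comp ll; apply: braid_mul_linr.
  - by apply: linearf_comp ll _; apply: talg_mul_linr.
  rewrite braid_mul_tens (linearf_sum ll) tprod_lift_tens //.
  under eq_bigr => s _.
    rewrite tprod_lift_tens // mul1r.
    have -> : talg_counit (talg_act s a) = talg_counit a.
      move: a; apply: talg_eq => [||v].
      - exact: linearf_comp (@talg_act_linear _ _ U s) (@talg_counit_linear k U).
      - exact: talg_counit_linear.
      by rewrite talg_act_word !talg_counit_word; case: v.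
    over.
  rewrite -scaler_sumr -mulr_suml talg_proj_sum.
  exact: scalerAr.
move: z; apply: tprod_eq => [||a b].
- by apply: linearf_comp ll; apply: braid_mul_linr.
- by move=> a x y; rewrite scaler0 addr0.
by rewrite braid_mul_iotal tprod_lift_tens // counit_iotaM scale0r.
Qed.

(** With [u] in the left factor, degree 1 forces the counit on the left part of [x], and
    [counit_delta] applies; with [u] in the right factor, [u] has passed that left part and acted on
    it by [s]. *)
Lemma dleft_iotaM (c : U -> k^o) s u x : linear c -> yd_deg s u ->
  dleft c (iota u * x) =
  (c u : k) *: x + iota u * dleft (fun v => c (yd_act s v)) x.
Proof.
move=> cl su.
have cl' : linear (fun v => c (yd_act s v)) by exact: linearf_comp (@yd_act_linear _ _ U s) cl.
have ll := tprod_lift_linear (dleft_bilin cl).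
have ll' := tprod_lift_linear (dleft_bilin cl').
rewrite -[X in _ *: X]counit_delta /dleft talg_delta_mul talg_delta_iota.
rewrite (linearfD (@braid_mul_linl _ _ U _)) (linearfD ll).
move: (talg_delta x) => z.
have bl : bilin (fun a b : T => (talg_counit a : k) *: b).
  split=> [b a y y'|a b y y']; last by rewrite scalerDr !scalerA mulrC.
  by rewrite talg_counit_linear scalerDl scalerA.
congr (_ + _); move: z; apply: tprod_eq => [||a b].
- by apply: linearf_comp ll; apply: braid_mul_linr.
- move=> e x1 x2; rewrite (tprod_lift_linear bl) scalerDr !scalerA; congr (_ *: _ + _).
  exact: mulrC.
- rewrite braid_mul_iotal !tprod_lift_tens //; last exact: dleft_bilin.
  by rewrite pr1_iotaM (linearfZ cl) !scalerA; congr (_ *: _); apply: mulrC.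
- by apply: linearf_comp ll; apply: braid_mul_linr.
- by apply: linearf_comp ll' _; apply: talg_mul_linr.
rewrite (braid_mul_iotar _ _ su) (tprod_lift_tens _ _ (dleft_bilin cl)).
rewrite (tprod_lift_tens _ _ (dleft_bilin cl')) pr1_act.
exact: scalerAr.
Qed.

End Link.

Section NicholsMap.
Variables (k : fieldType) (gT : finGroupType) (U : yd_module k gT) (D : ydd k gT).
Variables (b : D -> U) (co : D -> U -> k^o).
Hypothesis co_linear : forall i, linear (co i).
Hypothesis co_b : forall i j, co i (b j) = (i == j)%:R.
Hypothesis b_deg : forall i, yd_deg (dg i) (b i).
Hypothesis co_act : forall h i u, co i (yd_act h u) = \sum_l rh h i l *: co l u.
Local Notation T := (talg U).
Local Notation F := (seq D -> k^o).

(** The passage from T(U) to the shuffle model, an element being recorded by the counits of its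
    iterated skew derivatives. *)
Fixpoint nmap_rec (x : T) (w : seq D) : k^o :=
  if w is i :: w' then nmap_rec (dleft (co i) x) w' else talg_counit x.
Definition nmap (x : T) : F := nmap_rec x.

Lemma shl_nmap i x : shl i (nmap x) = nmap (dleft (co i) x).
Proof. by []. Qed.

Lemma nmap_linear : linear nmap.
Proof.
move=> a x y; apply/funext => w; rewrite evalZD.
elim: w x y => [|i w IH] x y; first exact: talg_counit_linear.
rewrite /nmap /= (dleft_linear (co_linear i)); exact: IH.
Qed.

Lemma dleft_letter i j x :
  dleft (co i) (iota (b j) * x) =
  (i == j)%:R *: x + \sum_l rh (dg j) i l *: (iota (b j) * dleft (co l) x).
Proof.
rewrite (dleft_iotaM _ (co_linear i) (b_deg j)) co_b; congr (_ + _).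
have -> : dleft (fun v => co i (yd_act (dg j) v)) x = \sum_l rh (dg j) i l *: dleft (co l) x.
  rewrite /dleft; move: (talg_delta x); apply: tprod_eq.
  - apply: tprod_lift_linear; apply: (dleft_bilin (c := fun v => co i (yd_act (dg j) v))).
    exact: linearf_comp (@yd_act_linear _ _ U _) (co_linear i).
  - apply: linearf_sumf => l; apply: linearf_comp (tprod_lift_linear (dleft_bilin (co_linear l))) _.
    by move=> a y z; rewrite scalerDr !scalerA mulrC.
  move=> y z; rewrite tprod_lift_tens; last first.
    apply: (dleft_bilin (c := fun v => co i (yd_act (dg j) v))).
    exact: linearf_comp (@yd_act_linear _ _ U _) (co_linear i).
  under eq_bigr => l _ do rewrite (tprod_lift_tens _ _ (dleft_bilin (co_linear l))) scalerA.
  by rewrite -scaler_suml co_act.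
by rewrite mulr_sumr; apply: eq_bigr => l _; apply/esym/scalerAr.
Qed.

Lemma nmap_letter j x : nmap (iota (b j) * x) = lmul j (nmap x).
Proof.
move: x; apply: F_ind_eq => [x|w IH x i]; first exact: counit_iotaM.
rewrite -[LHS]/(shl i (nmap (iota (b j) * x)) w) -[RHS]/(shl i (lmul j (nmap x)) w).
rewrite shl_nmap shl_lmul dleft_letter (linearfD nmap_linear) !evalD.
rewrite (linearfZ nmap_linear); congr (_ + _).
rewrite (linearf_sum nmap_linear) !eval_sum; apply: eq_bigr => l _.
by rewrite (linearfZ nmap_linear) !evalZ IH.
Qed.

Lemma nmap_word w : nmap (word (map b w)) = lword w.
Proof.
elim: w => [|j w IH] /=; last by rewrite -cat1s wordM nmap_letter IH.
apply/funext => -[|i w]; first by rewrite /nmap /= talg_counit_word.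
rewrite -[LHS]/(shl i (nmap 1) w) shl_nmap dleft1 //.
by rewrite (linearf0 nmap_linear).
Qed.

(** The ideal is a coideal in degrees at least 2, hence stable under the skew derivations, and the
    counit vanishes on it. *)
Lemma nmap_nichols x : nichols_ideal x -> nmap x = 0.
Proof.
move=> Jx; apply/funext => w.
elim: w x Jx => [|i w IH] x Jx; first by have [_ J0 _] := nichols_ideal_coideal U; apply: J0.
apply: IH; apply: (dleft_coideal (co_linear i) _ _ Jx); first exact: nichols_ideal_coideal.
exact: nichols_ideal_ge2.
Qed.

Lemma nmap_onto phi : nich phi -> exists x, nmap x = phi.
Proof.
move: phi; apply: (@nich_ind _ _ D [set phi : F | exists x, nmap x = phi]%classic).
  split; first by exists 0; apply: linearf0 nmap_linear.
  by move=> a _ _ [x <-] [y <-]; exists (a *: x + y); apply: nmap_linear.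
by move=> w; exists (word (map b w)); apply: nmap_word.
Qed.

(** The values of [nmap] depend only on classes in the Nichols algebra and exhaust the shuffle
    model, so independent elements of the model lift. *)
Lemma indep_nichols N : indep N (@nich k gT D) ->
  has_indep [set (0 : nichols U)]%classic [set: nichols U]%classic N.
Proof.
move=> [e [ne ei]]; have [x xP] := choice (fun i => nmap_onto (ne i)).
exists (fun i => lquot_pi _ (x i)); split=> // c /= c0; apply: ei => /=.
have pl := @lquot_pi_linear _ _ (@nichols_ideal _ _ U).
have : lquot_pi (@nichols_ideal _ _ U) (\sum_i c i *: x i) = lquot_pi _ 0.
  rewrite (linearf0 pl) -[RHS]c0 (linearf_sum pl).
  by apply: eq_bigr => i _; apply: linearfZ.
move=> /lquot_piP; rewrite subr0 => /(lspan_min _ (@subset_refl _ _)) Jx.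
have {Jx} /nmap_nichols : nichols_ideal (\sum_i c i *: x i).
  by apply: Jx; case: (nichols_ideal_coideal U).
rewrite (linearf_sum nmap_linear) => E; rewrite -[RHS]E; apply: eq_bigr => i _.
by rewrite (linearfZ nmap_linear) xP.
Qed.

End NicholsMap.

(** * Finite dimension and the splitting of a reducible module *)

Lemma finite_dim_indep (k : fieldType) (V : lmodType k) : finite_dim V ->
  exists n, ~ has_indep [set (0 : V)]%classic [set: V]%classic n.
Proof.
move=> [n [f [g fK gK]]]; exists n.+1 => -[e [_ ei]].
pose M := \matrix_i f (e i).
(* The images of n + 1 vectors are the rows of a matrix with n columns, which has a nonzero left
   kernel. *)
have : \rank (kermx M) != 0%N.
  by rewrite mxrank_ker subn_eq0 -ltnNge ltnS rank_leq_col.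
rewrite mxrank_eq0 => /rowV0Pn [v /sub_kermxP vM v0].
case/negP: v0; apply/eqP/rowP => i; rewrite mxE; apply: (ei (v ord0)) => /=.
apply: (can_inj fK); rewrite linear_sum linear0 -[RHS]vM; apply/rowP => j.
rewrite summxE mxE; apply: eq_bigr => l _.
by rewrite linearZ /= !mxE.
Qed.

(** The Nichols ideal lives in degrees at least 2, so [U] embeds in its Nichols algebra. *)
Lemma yd_indep (k : fieldType) (gT : finGroupType) (U : yd_module k gT) N :
  has_indep [set (0 : U)]%classic [set: U]%classic N ->
  has_indep [set (0 : nichols U)]%classic [set: nichols U]%classic N.
Proof.
move=> [e [_ ei]]; exists (fun i => lquot_pi _ (iota (e i))); split=> // c /= c0.
apply: ei => /=; apply: iota_nichols.
have pl := @lquot_pi_linear _ _ (@nichols_ideal _ _ U).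
rewrite (linearf_sum (@iota_linear _ _ U)).
have : lquot_pi (@nichols_ideal _ _ U) (\sum_i iota (c i *: e i)) = lquot_pi _ 0.
  rewrite (linearf0 pl) -[RHS]c0 (linearf_sum pl).
  by apply: eq_bigr => i _; rewrite (linearfZ (@iota_linear _ _ U)) (linearfZ pl).
move=> /lquot_piP; rewrite subr0 => /(lspan_min _ (@subset_refl _ _)); apply.
by case: (nichols_ideal_coideal U).
Qed.

Section Complement.
Variables (k : fieldType) (gT : finGroupType) (U : yd_module k gT).
Implicit Types (N Q : set U).

(** A maximal independent family of homogeneous elements of [N] suffices, since the homogeneous
    components of an element of [N] are in [N]. *)
Lemma hom_basis Q N n : subspace Q -> yd_submodule N -> ~ has_indep Q N n ->
  exists p (e : 'I_p -> U) (t : 'I_p -> gT),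
    [/\ forall i, N (e i), forall i, yd_deg (t i) (e i), indep_mod Q e &
        forall x, N x -> span_mod Q e x].
Proof.
move=> sQ [sN _ pN] nN.
have nN' : ~ has_indep Q [set x | N x /\ exists s, yd_deg s x]%classic n.
  by move=> hi; apply: nN; apply: has_indepS hi => x [].
have [p [e [eN ei emax]]] := indep_mod_max sQ nN'.
have [t tP] := choice (fun i => (eN i).2).
exists p, e, t; split=> // [i|x Nx]; first by case: (eN i).
rewrite -[x]yd_proj_sum; apply: (@subspace_sum _ _ (span_mod Q e)) => [|s _].
  exact: span_mod_subspace.
apply: emax; split; first exact: pN.
by exists s; rewrite /yd_deg /= yd_projK eqxx.
Qed.

Variable n : nat.
Hypothesis U_fin : ~ has_indep [set (0 : U)]%classic [set: U]%classic n.
Hypothesis k0 : [pchar k] =i pred0.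

Lemma yd_submoduleT : yd_submodule [set: U]%classic.
Proof. by []. Qed.

(* Maschke: average over G the projection along a graded complement. *)
Lemma yd_projection N : yd_submodule N -> exists f : U -> U,
  [/\ linear f, forall x, N (f x), forall x, N x -> f x = x,
      forall h x, f (yd_act h x) = yd_act h (f x) &
      forall s x, f (yd_proj s x) = yd_proj s (f x)].
Proof.
move=> [sN aN pN].
have nN : ~ has_indep N [set: U]%classic n.
  by move=> hi; apply: U_fin; apply: has_indepW hi => _ ->; case: sN.
have [q [e [t [_ et ei espan]]]] := hom_basis sN yd_submoduleT nN.
have sp x : span_mod N e x by apply: espan.
pose f x := x - \sum_i coef_mod N e x i *: e i.
have fl : linear f.
  move=> a x y; rewrite /f coef_mod_linear // scalerBr scaler_sumr addrACA.
  congr (_ + _); rewrite -opprD -big_split; congr (- _); apply: eq_bigr => i _ /=.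
  by rewrite scalerDl scalerA.
have fN x : N (f x) by apply: coef_modP.
have fid x : N x -> f x = x.
  by move=> Nx; rewrite /f (coef_mod0 sN ei Nx) big1 ?subr0 // => i _; rewrite scale0r.
(* Since the vectors [e i] are homogeneous, the component of [f x] is that of [x] minus a
   combination of them. It lies in [N], so uniqueness of coordinates identifies it. *)
have fp s x : f (yd_proj s x) = yd_proj s (f x).
  have pl := @yd_proj_linear _ _ U s.
  have E : yd_proj s (f x) =
      yd_proj s x - \sum_i ((s == t i)%:R * coef_mod N e x i) *: e i.
    rewrite /f (linearfB pl) (linearf_sum pl); congr (_ - _); apply: eq_bigr => i _.
    rewrite (linearfZ pl) -(et i) yd_projK mulrC -scalerA.
    by case: eqP => _; rewrite ?scale1r ?scale0r ?scaler0.
  have := pN s _ (fN x); rewrite E => /(coef_mod_uniq sN ei) E'.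
  by rewrite {1}/f E'.
pose c : k := #|gT|%:R^-1.
have c0 : #|gT|%:R != 0 :> k.
  by have /pcharf0P -> := k0; rewrite -lt0n; apply/card_gt0P; exists 1%g.
pose g x := c *: \sum_h yd_act h (f (yd_act h^-1%g x)).
have al h := @yd_act_linear _ _ U h.
exists g; split.
- apply: (@linearf_comp _ _ _ _ (fun x => \sum_h yd_act h (f (yd_act h^-1%g x))) (fun x => c *: x)).
    apply: linearf_sumf => h; apply: linearf_comp (al h).
    exact: linearf_comp (al _) fl.
  by move=> a x y; rewrite scalerDr !scalerA mulrC.
- move=> x; apply: subspaceZ => //; apply: (@subspace_sum _ _ N) => // h _.
  by apply: aN.
- move=> x Nx; rewrite /g (eq_bigr (fun=> x)) => [|h _].
    by rewrite sumr_const -scaler_nat scalerA mulVf ?scale1r.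
  by rewrite fid; [rewrite -yd_actM mulgV yd_act1|apply: aN].
- move=> h x; rewrite /g (linearfZ (al h)); congr (_ *: _).
  rewrite (linearf_sum (al h)) (reindex_inj (mulgI h)); apply: eq_bigr => l _ /=.
  by rewrite yd_actM; congr (yd_act _ (yd_act _ (f _))); rewrite -yd_actM invMg mulgKV.
move=> s x; rewrite /g (linearfZ (@yd_proj_linear _ _ U s)); congr (_ *: _).
rewrite (linearf_sum (@yd_proj_linear _ _ U s)); apply: eq_bigr => l _.
rewrite yd_act_proj fp yd_act_proj; congr (yd_proj _ _).
by rewrite invgK !mulgA mulgV mul1g mulgK.
Qed.

Lemma yd_complement N : yd_submodule N -> exists f : U -> U,
  [/\ linear f, forall x, N (f x), forall x, N x -> f x = x &
      yd_submodule [set x | f x = 0]%classic].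
Proof.
move=> sN; have [f [fl fN fid fa fp]] := yd_projection sN.
exists f; split=> //; split=> [|h u|s u] /=.
- exact: subspace_preim fl (@subspace_set0 _ _).
- by rewrite fa => ->; apply: linearf0 (@yd_act_linear _ _ U h).
- by rewrite fp => ->; apply: linearf0 (@yd_proj_linear _ _ U s).
Qed.

(** [N] and the kernel of its projection serve as V and W. Their homogeneous bases are both nonempty
    because [N] is neither 0 nor [U], and together they form a basis of [U] with dual coordinates
    [co]. *)
Lemma two_sided_datum N : yd_submodule N -> N <> [set 0]%classic -> N <> [set: U]%classic ->
  exists (D : ydd k gT) (b : D -> U) (co : D -> U -> k^o),
  two_sided D /\ [/\ forall i, linear (co i), forall i j, co i (b j) = (i == j)%:R,
    forall i, yd_deg (dg i) (b i) &
    forall h i u, co i (yd_act h u) = \sum_l rh h i l *: co l u].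
Proof.
move=> smN N0 NT; have [f [fl fN fid smK]] := yd_complement smN.
set K : set U := [set x | f x = 0]%classic in smK.
have ff x : f (f x) = f x by apply: fid.
have fK x : K (x - f x) by rewrite /K /= (linearfB fl) ff subrr.
have s0 := @subspace_set0 k U.
have nfin S : ~ has_indep [set (0 : U)]%classic S n.
  by move=> hi; apply: U_fin; apply: has_indepS hi.
have [p [e [t [eN et ei esp]]]] := hom_basis s0 smN (nfin N).
have [q [e' [t' [eK et' ei' esp']]]] := hom_basis s0 smK (nfin K).
have [i0 _] : exists i : 'I_p, true.
  apply: contrapT => np; apply: N0; apply/seteqP; split=> [x /esp [c /= /eqP]|_ ->].
    by rewrite subr_eq0 => /eqP ->; apply: big1 => i _; case: np; exists i.
  by case: smN => -[].
have [j0 _] : exists j : 'I_q, true.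
  apply: contrapT => nq; apply: NT; apply/seteqP; split=> // x _.
  have [c /= /eqP] := esp' _ (fK x); rewrite subr_eq0 big1 => [|i _]; last by case: nq; exists i.
  by rewrite subr_eq0 => /eqP ->.
have [sN aN _] := smN; have [sK aK _] := smK.
pose I : finType := ('I_p + 'I_q)%type.
pose b (i : I) := match i with inl i => e i | inr j => e' j end.
pose d (i : I) := match i with inl i => t i | inr j => t' j end.
pose side (i : I) := if i is inl _ then true else false.
pose co (i : I) (x : U) : k^o := match i with
  | inl i => coef_mod [set 0]%classic e (f x) i
  | inr j => coef_mod [set 0]%classic e' (x - f x) j end.
have co_lin i : linear (co i).
  case: i => i a x y /=.
    by rewrite fl (coef_mod_linear s0 ei) //; apply: esp.
  rewrite fl opprD addrACA -scalerBr (coef_mod_linear s0 ei') //.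
    by apply: esp'; apply: fK.
  by apply: esp'; apply: fK.
have co_b i j : co i (b j) = (i == j)%:R.
  case: i j => [i|i] [j|j] /=.
  - by rewrite fid // (coef_mod_e s0 ei).
  - by have -> : f (e' j) = 0 := eK j; rewrite (coef_mod0 s0 ei).
  - by rewrite fid // subrr (coef_mod0 s0 ei').
  - by have -> : f (e' j) = 0 := eK j; rewrite subr0 (coef_mod_e s0 ei').
have co_ex x : x = \sum_i (co i x : k) *: b i.
  rewrite big_sumType /= -[LHS](subrK (f x)) [LHS]addrC; congr (_ + _); apply/eqP; rewrite -subr_eq0; apply/eqP.
    exact: (coef_modP (esp _ (fN x))).
  exact: (coef_modP (esp' _ (fK x))).
have b_deg i : yd_deg (d i) (b i) by case: i.
pose r h (i j : I) : k := co i (yd_act h (b j)).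
have co_act h i u : co i (yd_act h u) = \sum_l r h i l *: co l u.
  rewrite {1}[u]co_ex (linearf_sum (@yd_act_linear _ _ U h)) (linearf_sum (co_lin i)).
  apply: eq_bigr => l _; rewrite (linearfZ (@yd_act_linear _ _ U h)) (linearfZ (co_lin i)).
  exact: mulrC.
have r1 i j : r 1%g i j = (i == j)%:R by rewrite /r yd_act1 co_b.
have rM g h i j : r (g * h)%g i j = \sum_l r g i l * r h l j.
  by rewrite {1}/r yd_actM co_act.
have co_proj s i x : d i != s -> co i (yd_proj s x) = 0.
  move=> ne; rewrite [x]co_ex (linearf_sum (@yd_proj_linear _ _ U s)) (linearf_sum (co_lin i)).
  apply: big1 => l _; rewrite (linearfZ (@yd_proj_linear _ _ U s)) (linearfZ (co_lin i)).
  rewrite -(b_deg l) yd_projK; case: eqP => [e0|_]; last by rewrite (linearf0 (co_lin i)) scaler0.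
  rewrite (b_deg l) co_b; case: eqP => [il|_]; last by rewrite scaler0.
  by rewrite il -e0 eqxx in ne.
have r_deg h i j : r h i j != 0 -> d i = (h * d j * h^-1)%g.
  rewrite /r -(b_deg j) yd_act_proj => nz; apply/eqP; apply: contraNT nz => ne.
  by rewrite co_proj.
have r_side h i j : r h i j != 0 -> side i = side j.
  rewrite /r; case: i j => [i|i] [j|j] //=.
    have -> : f (yd_act h (e' j)) = 0 by apply: (aK h _ (eK j)).
    by rewrite (coef_mod0 s0 ei) ?eqxx.
  by rewrite fid; [rewrite subrr (coef_mod0 s0 ei') ?eqxx|apply: aN].
exists (@Ydd k gT I d r side r1 rM r_deg r_side), b, co; split=> //.
by split; [exists (inl i0)|exists (inr j0)].
Qed.

End Complement.

Theorem corollary8p3 (k : closedFieldType) (hk : [pchar k] =i pred0)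
    (gT : finGroupType) (hsimple : simple [set: gT])
    (hnonab : ~~ abelian [set: gT])
    (U : yd_module k gT) (hU : exists u : U, u != 0)
    (hfin : finite_dim (nichols U)) :
  yd_irreducible U.
Proof.
split=> // N smN; have [n nB] := finite_dim_indep hfin.
have nU : ~ has_indep [set (0 : U)]%classic [set: U]%classic n.
  by move=> /yd_indep.
case: (pselect (N = [set 0]%classic)) => [|N0]; first by left.
right; apply: contrapT => NT; apply: nB.
have [D [b [co [twoD [co_lin co_b b_deg co_act]]]]] := two_sided_datum nU hk smN N0 NT.
apply: (indep_nichols co_lin co_b b_deg co_act).
exact: two_sided_indep.
Qed.
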